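(* Let $C$ be a real analytic Banach manifold and let $J\colon TC\to TC$ be a real analytic almost complex structure on $C$. Denote by $\Omega\colon TC\oplus TC\to TC$ the torsion of $J$. Then $\Omega=0$ if and only if there exists on $C$ a structure of complex Banach manifold whose underlying real analytic structure is the original structure of $C$ and such that $J_pv=\mathrm{i}v$ whenever $p\in C$ and $v\in T_pC$.
   Context: An almost complex structure on a smooth real Banach manifold $M$ is a mapping $J\colon TM\to TM$ such that for all $p\in M$ we have $J(T_pM)\subseteq T_pM$, the restriction $J_p:=J|_{T_pM}\colon T_pM\to T_pM$ is a bounded real-linear operator, and $(J_p)^2=-\mathrm{id}_{T_pM}$. For an open subset $D$ of a real Banach space $X$, the Lie bracket on $\mathcal{C}^\infty(D,X)$ is $[a,b]_x=a'_x(b_x)-b'_x(a_x)$, where $a_x:=a(x)$ and $a'_x\colon X\to X$ is the differential of $a$ at $x$; this defines, in local coordinates, the bracket of smooth vector fields on a manifold. The torsion of a smooth almost complex structure $J$ on $M$ is the smooth mapping $\Omega\colon TM\oplus TM\to TM$ (where $TM\oplus TM$ is the Whitney sum) such that for all locally defined smooth vector fields $a,b$ on $M$ we have $$\Omega(a,b)=J[Ja,b]+J[a,Jb]+[a,b]-[Ja,Jb]$$ on any open set where both $a$ and $b$ are defined. (The right-hand side at a point depends only on the values of $a$ and $b$ at that point, so $\Omega$ is well defined.) *)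

(* Defs.v *)
From HB Require Import structures.
From mathcomp Require Import all_boot all_order all_algebra.
From mathcomp Require Import complex.
From mathcomp Require Import all_classical all_reals all_analysis.
Set Implicit Arguments.
Unset Strict Implicit.
Unset Printing Implicit Defensive.
Import Order.TTheory GRing.Theory Num.Theory.
Import numFieldNormedType.Exports.
Local Open Scope classical_set_scope.
Local Open Scope complex_scope.
Local Open Scope ring_scope.

(* Restriction of scalars: a complex Banach space seen as a real one.  The
   additive group and the topology are those of E, by conversion; the real norm
   is Re `|x|, which is `|x| itself since norms in E are nonnegative elements of
   R[i] (realified_normE). *)
Definition realified (R : realType) (E : completeNormedModType R[i]) : Type := E.

Section Realified.
Context (R : realType) (E : completeNormedModType R[i]).
Local Notation T := (realified E).

HB.instance Definition _ := GRing.Zmodule.copy T E.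
HB.instance Definition _ := PointedUniform.copy T E.
HB.instance Definition _ := Uniform_isComplete.Build T (@cauchy_cvg E).

Let scale (a : R) (x : T) : T := a%:C *: (x : E).
Let scaleA a b v : scale a (scale b v) = scale (a * b) v.
Proof. by rewrite /scale scalerA rmorphM. Qed.
Let scale1 : left_id 1 scale.
Proof. by move=> v; rewrite /scale rmorph1 scale1r. Qed.
Let scaleDr : right_distributive scale +%R.
Proof. by move=> a u v; rewrite /scale scalerDr. Qed.
Let scaleDl v : {morph scale^~ v : a b / a + b}.
Proof. by move=> a b; rewrite /scale rmorphD scalerDl. Qed.
HB.instance Definition _ :=
  GRing.Zmodule_isLmodule.Build R T scaleA scale1 scaleDr scaleDl.

Let norm (x : T) : R := complex.Re `|x : E|.

Let RRe (z : R[i]) : 0 <= z -> (complex.Re z)%:C = z.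
Proof. by case: z => a b; rewrite lecE /= => /andP[/eqP-> _]. Qed.

Let normE x : (norm x)%:C = `|x : E|.
Proof. exact: RRe. Qed.

Let norm_triangle x y : norm (x + y) <= norm x + norm y.
Proof. by rewrite -lecR rmorphD /= !normE ler_normD. Qed.
Let norm0_eq0 x : norm x = 0 -> x = 0.
Proof.
by move=> /(congr1 (real_complex R)) /=; rewrite normE => /normr0_eq0.
Qed.
Let normMn x n : norm (x *+ n) = norm x *+ n.
Proof.
apply: complexI; rewrite /= normE -mulr_natr rmorphM rmorph_nat /= normE.
by rewrite mulr_natr normrMn.
Qed.
Let normN x : norm (- x) = norm x.
Proof. by rewrite /norm normrN. Qed.
HB.instance Definition _ :=
  Num.Zmodule_isNormed.Build R T norm_triangle norm0_eq0 normMn normN.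

Let rball (x : T) (e : R) : set T := ball_ (fun x : T => norm x) x e.
Let rballE x e : rball x e = ball (x : E) e%:C.
Proof.
by apply/seteqP; split => y; rewrite -ball_normE /rball /ball_ /= -ltcR normE.
Qed.
Let rball_center x e : 0 < e -> rball x e x.
Proof. by move=> e0; rewrite rballE; apply: ballxx; rewrite ltcR. Qed.
Let rball_sym x y e : rball x e y -> rball y e x.
Proof. by rewrite !rballE; exact: ball_sym. Qed.
Let rball_triangle x y z e1 e2 :
  rball x e1 y -> rball y e2 z -> rball x (e1 + e2) z.
Proof. by rewrite !rballE rmorphD; exact: ball_triangle. Qed.
Let rentourageE : @entourage T = entourage_ rball.
Proof.
rewrite -[LHS](@entourage_ballE _ E); apply/seteqP; split => A [e e0 eA].
  have eE : (complex.Re e)%:C = e by apply/RRe/ltW.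
  exists (complex.Re e) => [|xy] /=; first by rewrite -ltcR eE.
  by rewrite rballE eE; exact: eA.
exists e%:C => [|xy xye]; first by rewrite /= ltcR.
by apply: eA; rewrite /= rballE.
Qed.
HB.instance Definition _ := Uniform_isPseudoMetric.Build R T
  rball_center rball_sym rball_triangle rentourageE.
HB.instance Definition _ := NormedZmod_PseudoMetric_eq.Build R T erefl.
Let normZ (a : R) (x : T) : `|a *: x| = `|a| * `|x|.
Proof.
apply: complexI; rewrite rmorphM /= !normE normrZ.
by rewrite normc_def /= expr0n addr0 sqrtr_sqr.
Qed.
HB.instance Definition _ :=
  PseudoMetricNormedZmod_Lmodule_isNormedModule.Build R T normZ.

Lemma realified_normE (x : T) : (`|x|)%:C = `|x : E|.
Proof. exact: normE. Qed.

End Realified.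

Section Calculus.
Context (K : numFieldType).

Definition multilinear (X Y : normedModType K) n
    (a : ('I_n -> X) -> Y) : Prop :=
  forall (v : 'I_n -> X) (i : 'I_n),
    linear (fun t => a (fun j => if j == i then t else v j)).

(* K-analyticity between normed spaces: near x, f is the sum of a power series
   h |-> \sum_n a_n(h, .., h) of bounded n-linear maps with `|a_n| <= M / r^n.
   By polarization this is the usual notion, in which the terms are continuous
   n-homogeneous polynomials and the radius of convergence is positive.  It is
   real analyticity for K = R and complex analyticity (holomorphy) for
   K = R[i]; in the latter case 0 < r forces r to be real. *)
Definition analytic_at (X Y : normedModType K) (f : X -> Y) (x : X) : Prop :=
  exists (a : forall n, ('I_n -> X) -> Y) (M r : K),
    [/\ 0 < r,
        forall n, multilinear (a n),
        forall n v, `|a n v| <= M * r^-1 ^+ n * \prod_(i < n) `|v i|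
      & \forall h \near (0 : X),
          series (fun n => a n (fun=> h)) @ \oo --> f (x + h)].

Definition analytic_on (X Y : normedModType K) (D : set X) (f : X -> Y)
    : Prop :=
  forall x, D x -> analytic_at f x.

Definition vcons (X : Type) n (h : X) (v : 'I_n -> X) : 'I_n.+1 -> X :=
  fun i => if unlift ord0 i is Some j then v j else h.

(* C^oo in the sense of Frechet on an open set D: F n x is the n-th derivative
   of f at x as a bounded n-linear map, and F n.+1 x is the Frechet derivative,
   for the operator norm on n-linear maps, of F n at x. *)
Definition smooth_on (X Y : normedModType K) (D : set X) (f : X -> Y) : Prop :=
  exists F : forall n, X -> ('I_n -> X) -> Y,
    (forall x v, D x -> F 0%N x v = f x) /\
    forall n x, D x ->
      [/\ multilinear (F n x),
          exists k : K, forall v, `|F n x v| <= k * \prod_(i < n) `|v i|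
        & forall e : K, 0 < e -> \forall h \near (0 : X), forall v,
            `|F n (x + h) v - F n x v - F n.+1 x (vcons h v)|
              <= e * `|h| * \prod_(i < n) `|v i| ].

End Calculus.

(* A chart is a homeomorphism of an open set of M onto an open set of a Banach
   space.  Different charts may have different model spaces.  The values of
   chart_map and chart_inv outside these open sets are irrelevant. *)
Record chart (K : numFieldType) (M : topologicalType) := Chart {
  model : completeNormedModType K;
  chart_dom : set M;
  chart_map : M -> model;
  chart_inv : model -> M;
  chart_dom_open : open chart_dom;
  chart_cod_open : open (chart_map @` chart_dom);
  chart_mapK : {in chart_dom, cancel chart_map chart_inv};
  chart_map_continuous : {in chart_dom, continuous chart_map};
  chart_inv_continuous : {in chart_map @` chart_dom, continuous chart_inv}
}.

Arguments chart_map {K M} c p : rename.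
Arguments chart_inv {K M} c x : rename.

Section Manifolds.
Context (K : numFieldType) (M : topologicalType).
Implicit Types c : chart K M.

Definition compatible c c' : Prop :=
  let D := chart_dom c `&` chart_dom c' in
  analytic_on (chart_map c @` D) (chart_map c' \o chart_inv c) /\
  analytic_on (chart_map c' @` D) (chart_map c \o chart_inv c').

(* An analytic Banach manifold over K is a topological space M with an analytic
   structure, given by an atlas.  No separation axiom is imposed on M; all the
   structures considered on M induce its given topology. *)
Record analytic_structure := AnalyticStructure {
  chart_index : Type;
  atlas : chart_index -> chart K M;
  atlas_cover : forall p, exists i, chart_dom (atlas i) p;
  atlas_compatible : forall i j, compatible (atlas i) (atlas j)
}.

Arguments atlas : clear implicits.

(* The charts of the maximal atlas; two atlases define the same structure when
   their maximal atlases coincide. *)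
Definition admissible (S : analytic_structure) c : Prop :=
  forall i, compatible c (atlas S i).

Definition same_structure (S S' : analytic_structure) : Prop :=
  forall c, admissible S c <-> admissible S' c.

(* A tangent vector at p is the family of its coordinates in the charts of the
   atlas at p, related to each other by the differentials of the transition
   maps.  The coordinates in the charts that do not contain p are set to 0, so
   that the family is determined by the tangent vector. *)
Record tangent (S : analytic_structure) (p : M) := Tangent {
  tcoord : forall i : chart_index S, model (atlas S i);
  tcoord_transition : forall i j,
    chart_dom (atlas S i) p -> chart_dom (atlas S j) p ->
    tcoord j = 'd (chart_map (atlas S j) \o chart_inv (atlas S i))
                  (chart_map (atlas S i) p) (tcoord i);
  tcoord_default : forall i, ~ chart_dom (atlas S i) p -> tcoord i = 0
}.

End Manifolds.

Arguments atlas {K M} S i : rename.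
Arguments tcoord {K M S p} u i : rename.

Section TangentSpace.
Context (K : numFieldType) (M : topologicalType) (S : analytic_structure K M).
Context (p : M).
Local Notation T := (tangent S p).

Lemma tangent_eq (u v : T) : (forall i, tcoord u i = tcoord v i) -> u = v.
Proof.
case: u v => [u u1 u2] [v v1 v2] /= uv.
have {}uv : u = v by apply: functional_extensionality_dep.
by subst v; congr Tangent; exact: Prop_irrelevance.
Qed.

HB.instance Definition _ := gen_eqMixin T.
HB.instance Definition _ := gen_choiceMixin T.

Program Definition tangent0 : T := @Tangent K M S p (fun=> 0) _ _.
Next Obligation. by move=> *; rewrite linear0. Qed.
Next Obligation. by []. Qed.

Program Definition tangentN (u : T) : T :=
  @Tangent K M S p (fun i => - tcoord u i) _ _.
Next Obligation.
by move=> u i j hi hj /=; rewrite (tcoord_transition u hi hj) linearN.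
Qed.
Next Obligation. by move=> u i hi /=; rewrite tcoord_default ?oppr0. Qed.

Program Definition tangentD (u v : T) : T :=
  @Tangent K M S p (fun i => tcoord u i + tcoord v i) _ _.
Next Obligation.
move=> u v i j hi hj /=.
by rewrite (tcoord_transition u hi hj) (tcoord_transition v hi hj) linearD.
Qed.
Next Obligation. by move=> u v i hi /=; rewrite !tcoord_default ?addr0. Qed.

Program Definition tangentZ (k : K) (u : T) : T :=
  @Tangent K M S p (fun i => k *: tcoord u i) _ _.
Next Obligation.
by move=> k u i j hi hj /=; rewrite (tcoord_transition u hi hj) linearZ.
Qed.
Next Obligation. by move=> k u i hi /=; rewrite tcoord_default ?scaler0. Qed.

Let addA : associative tangentD.
Proof. by move=> u v w; apply: tangent_eq => i /=; rewrite addrA. Qed.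
Let addC : commutative tangentD.
Proof. by move=> u v; apply: tangent_eq => i /=; rewrite addrC. Qed.
Let add0 : left_id tangent0 tangentD.
Proof. by move=> u; apply: tangent_eq => i /=; rewrite add0r. Qed.
Let addN : left_inverse tangent0 tangentN tangentD.
Proof. by move=> u; apply: tangent_eq => i /=; rewrite addNr. Qed.
HB.instance Definition _ := GRing.isZmodule.Build T addA addC add0 addN.

Let scaleA a b v : tangentZ a (tangentZ b v) = tangentZ (a * b) v.
Proof. by apply: tangent_eq => i /=; rewrite scalerA. Qed.
Let scale1 : left_id 1 tangentZ.
Proof. by move=> v; apply: tangent_eq => i /=; rewrite scale1r. Qed.
Let scaleDr : right_distributive tangentZ +%R.
Proof. by move=> a u v; apply: tangent_eq => i /=; rewrite scalerDr. Qed.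
Let scaleDl v : {morph tangentZ^~ v : a b / a + b}.
Proof. by move=> a b; apply: tangent_eq => i /=; rewrite scalerDl. Qed.
HB.instance Definition _ :=
  GRing.Zmodule_isLmodule.Build K T scaleA scale1 scaleDr scaleDl.

(* The tangent vector at p with coordinate v in chart i.  When chart i contains
   p it exists by the chain rule and is unique; otherwise the value is junk. *)
Definition tvec i (v : model (atlas S i)) : T :=
  xget 0 [set u : T | tcoord u i = v].

(* The value on u of the differential at p of the chart c, which need not belong
   to the atlas, computed through the chart i of the atlas.  When c is
   admissible and both charts contain p, it does not depend on i. *)
Definition dchart i (c : chart K M) (u : T) : model c :=
  'd (chart_map c \o chart_inv (atlas S i)) (chart_map (atlas S i) p)
    (tcoord u i).

End TangentSpace.

Arguments tvec {K M S} p i v : rename.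
Arguments dchart {K M S p} i c u : rename.

Section Torsion.
Context (K : numFieldType) (M : topologicalType) (S : analytic_structure K M).
Implicit Types (i : chart_index S) (W : set M).
Local Notation chart_ := (atlas S).

(* A locally defined vector field is a total one, considered only on an open
   set W. *)
Definition vector_field : Type := forall p, tangent S p.
Implicit Types a b : vector_field.

Definition field_coord i a (x : model (chart_ i)) : model (chart_ i) :=
  tcoord (a (chart_inv (chart_ i) x)) i.

Arguments field_coord i a x : clear implicits.

Definition smooth_field W a : Prop :=
  forall i, smooth_on (chart_map (chart_ i) @` (chart_dom (chart_ i) `&` W))
                      (field_coord i a).

(* The bracket [a, b] computed in chart i; at the points of this chart where a
   and b are smooth it does not depend on i. *)
Definition lie_bracket i a b : vector_field := fun p =>
  let x := chart_map (chart_ i) p in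
  let ai := field_coord i a in let bi := field_coord i b in
  tvec p i ('d ai x (bi x) - 'd bi x (ai x)).

(* A fibre-preserving map TM -> TM is a family of maps of the tangent spaces.
   Boundedness refers to the norms that the charts at p induce on T_pM, which
   are equivalent to one another. *)
Record almost_complex := AlmostComplex {
  acs :> forall p, tangent S p -> tangent S p;
  acs_linear : forall p, linear (@acs p);
  acs_bounded : forall p i, chart_dom (chart_ i) p ->
    exists k : K, forall u : tangent S p,
      `|tcoord (acs u) i| <= k * `|tcoord u i|;
  acs_sqr : forall p (u : tangent S p), acs (acs u) = - u
}.

(* Analyticity of J : TM -> TM in the bundle charts (x, v) of TM. *)
Definition analytic_acs (J : almost_complex) : Prop :=
  forall i,
    analytic_on [set xv : model (chart_ i) * model (chart_ i) |
                  (chart_map (chart_ i) @` chart_dom (chart_ i)) xv.1]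
      (fun xv => tcoord (J _ (tvec (chart_inv (chart_ i) xv.1) i xv.2)) i).

Definition acs_field (J : almost_complex) a : vector_field :=
  fun p => J p (a p).

(* Omega is the torsion of J: a smooth map TM (+) TM -> TM over M, smoothness
   being read in the bundle charts ((x, v), w), with
   Omega(a, b) = J[Ja, b] + J[a, Jb] + [a, b] - [Ja, Jb]
   for all smooth vector fields a and b defined on an open set W. *)
Definition is_torsion (J : almost_complex)
    (Omega : forall p, tangent S p -> tangent S p -> tangent S p) : Prop :=
  (forall i,
    smooth_on [set z : model (chart_ i) * model (chart_ i) * model (chart_ i) |
                (chart_map (chart_ i) @` chart_dom (chart_ i)) z.1.1]
      (fun z => let p := chart_inv (chart_ i) z.1.1 in
         tcoord (Omega p (tvec p i z.1.2) (tvec p i z.2)) i)) /\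
  forall W a b, open W -> smooth_field W a -> smooth_field W b ->
    forall i p, chart_dom (chart_ i) p -> W p ->
      let Ja := acs_field J a in let Jb := acs_field J b in
      Omega p (a p) (b p) =
        J p (lie_bracket i Ja b p) + J p (lie_bracket i a Jb p)
        + lie_bracket i a b p - lie_bracket i Ja Jb p.

End Torsion.

Section UnderlyingReal.
Context (R : realType).

Lemma analytic_at_realified (X Y : completeNormedModType R[i]) (f : X -> Y) x :
  analytic_at f x -> analytic_at (f : realified X -> realified Y) x.
Proof.
move=> [a [m [r [r0 aL aM ar]]]].
have RRe (z : R[i]) : 0 <= z -> (complex.Re z)%:C = z.
  by case: z => u v; rewrite lecE /= => /andP[/eqP-> _].
have m0 : 0 <= m.
  have := aM 0%N (fun=> 0); rewrite expr0 mulr1 big_ord0 mulr1.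
  exact: le_trans.
exists a, (complex.Re m), (complex.Re r); split => //.
- by rewrite -ltcR RRe // ltW.
- by move=> n v i k u w; exact: (aL n v i k%:C u w).
- move=> n v; rewrite -lecR 2!rmorphM rmorphXn fmorphV rmorph_prod /=.
  rewrite (RRe m)// (RRe r (ltW r0)) realified_normE.
  by under eq_bigr do rewrite realified_normE; exact: aM.
Qed.

Context (M : topologicalType).

Definition real_chart (c : chart R[i] M) : chart R M :=
  @Chart R M (realified (model c)) (chart_dom c) (chart_map c) (chart_inv c)
    (chart_dom_open c) (chart_cod_open c) (@chart_mapK _ _ c)
    (@chart_map_continuous _ _ c) (@chart_inv_continuous _ _ c).

Program Definition real_structure (Z : analytic_structure R[i] M) :
    analytic_structure R M :=
  @AnalyticStructure R M (chart_index Z) (fun j => real_chart (atlas Z j)) _ _.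
Next Obligation. by move=> Z p; exact: atlas_cover. Qed.
Next Obligation.
move=> Z j k; have [h h'] := atlas_compatible j k.
by split=> x Dx; apply: analytic_at_realified; [exact: h|exact: h'].
Qed.

End UnderlyingReal.

(* Main.v *)
From HB Require Import structures.
Require Import Defs.
From mathcomp Require Import all_boot all_order all_algebra.
From mathcomp Require Import complex.
From mathcomp Require Import all_classical all_reals all_analysis.
From mathcomp Require Import ring lra zify.
Set Implicit Arguments.
Unset Strict Implicit.
Unset Printing Implicit Defensive.
Import Order.TTheory GRing.Theory Num.Theory.
Import numFieldNormedType.Exports.
Local Open Scope classical_set_scope.
Local Open Scope complex_scope.
Local Open Scope ring_scope.

(** The torsion of J vanishes if J comes from a complex structure: if c is a
    complex chart, then D c (J v) = i D c v, and the derivative of this equation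
    expresses the image of the torsion under D c by the second differential of c,
    whose symmetry cancels all terms (torsion_of_complex_linear).

    The converse is local.  It is enough to find, in a chart at a given point,
    analytic coordinates Phi with D Phi (J v) = I (D Phi v), where I is the value
    of J at this point (complex_coordinates).  For two such systems of coordinates
    the transition map is real analytic and has complex linear differentials, and
    such a map is complex analytic (complex_analytic_of_holo); so the coordinates
    form a complex atlas, with model spaces the tangent spaces made complex by J.

    To find Phi, J is extended to a holomorphic family JJ of complex structures
    near the diagonal X of the complexification X * X.  The eigenvectors of JJ for
    -i form a holomorphic distribution, which is the graph of a family of linear
    maps m, and a function constant along this distribution restricts to X as a
    function with D Phi (J v) = I (D Phi v).  The torsion of JJ vanishes by the
    identity theorem (holo_identity), which makes the distribution involutive;
    what remains is an analytic theorem of Frobenius (frobenius).  The usual proof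
    of the latter solves differential equations.  Here the flow is a Lie series:
    the distribution is dilated by a parameter t, the sum of
    (-t)^k / k! Y^k applied to the first coordinate is the pullback of this
    coordinate to t = 0 by the flow of the radial field Y, and it is constant along
    the fields K of the distribution because they commute with Y and preserve the
    coordinate at t = 0 (lie_series_invariant).

    Everything is done with convergent power series in Banach spaces, in the norm
    of pser, which bounds the sum of the norms of the terms on a ball of fixed
    radius.  In this norm multilinear maps and compositions are bounded, limits
    exist, and differentiation costs the inverse of the loss of radius (Cauchy's
    estimate, pser_deriv).  Composition, the inverse function theorem and the
    convergence of Lie series all follow from these facts.  Complex spaces occur
    as real spaces with an operator I, and holomorphic maps as real analytic maps
    with complex linear differentials (holo). *)

(** * Identities in modules *)

(** Scaling of vectors is a product in the square-zero extension of R by M, a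
    commutative ring: there an identity between vectors is one between ring
    elements, and the ring tactic decides it. *)
Definition triv_ext (R : comNzRingType) (M : lmodType R) : Type := (R * M)%type.

Section TrivialExtension.
Context (R : comNzRingType) (M : lmodType R).
Local Notation T := (triv_ext M).
HB.instance Definition _ := GRing.Zmodule.copy T (R * M)%type.
Let one : T := (1, 0).
Let mul (x y : T) : T := (x.1 * y.1, x.1 *: y.2 + y.1 *: x.2).
Let mulA : associative mul.
Proof.
move=> [a m] [b n] [c p]; rewrite /mul /= mulrA; congr (_, _).
by rewrite !scalerDr !scalerA !addrA mulrC [c * a]mulrC [c * b]mulrC.
Qed.
Let mulC : commutative mul.
Proof. by move=> [a m] [b n]; rewrite /mul /= mulrC addrC. Qed.
Let mul1 : left_id one mul.
Proof. by move=> [a m]; rewrite /mul /= mul1r scale1r scaler0 addr0. Qed.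
Let mulD : left_distributive mul +%R.
Proof.
move=> [a m] [b n] [c p]; rewrite /mul /=; congr (_, _) => /=.
  by rewrite mulrDl.
by rewrite scalerDl scalerDr addrACA.
Qed.
Let one_neq0 : one != 0 :> T.
Proof. by apply/eqP => -[/eqP]; rewrite oner_eq0. Qed.
HB.instance Definition _ :=
  GRing.Zmodule_isComNzRing.Build T mulA mulC mul1 mulD one_neq0.

Definition te_scalar (a : R) : T := (a, 0).
Definition te_vector (m : M) : T := (0, m).
Let te_scalarB : zmod_morphism te_scalar.
Proof. by move=> a b; congr (_, _); rewrite subr0. Qed.
HB.instance Definition _ := GRing.isZmodMorphism.Build R T te_scalar te_scalarB.
Let te_scalarM : monoid_morphism te_scalar.
Proof. by split=> // a b; congr (_, _); rewrite /= !scaler0 addr0. Qed.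
HB.instance Definition _ := GRing.isMonoidMorphism.Build R T te_scalar te_scalarM.
Let te_vectorB : zmod_morphism te_vector.
Proof. by move=> a b; congr (_, _); rewrite subr0. Qed.
HB.instance Definition _ := GRing.isZmodMorphism.Build M T te_vector te_vectorB.
Lemma te_vectorZ a m : te_vector (a *: m) = te_scalar a * te_vector m.
Proof. by congr (_, _); rewrite /= ?mulr0 ?scale0r ?addr0. Qed.
Lemma te_vectorE : (forall m n, te_vector (m + n) = te_vector m + te_vector n) *
 (forall m, te_vector (- m) = - te_vector m) * (te_vector 0 = 0) * (forall m n, te_vector (m *+ n) = te_vector m *+ n).
Proof. by do !split => *; rewrite ?raddfD ?raddfN ?raddf0 ?raddfMn. Qed.
Lemma te_vector_inj : injective te_vector.
Proof. by move=> m n []. Qed.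
End TrivialExtension.

Ltac module := apply: te_vector_inj;
  rewrite ?te_vectorE; rewrite ?te_vectorZ ?te_vectorE ?te_vectorZ ?te_vectorE ?te_vectorZ ?te_vectorE; ring.

(** * Convergent series in Banach spaces *)

Definition sums (R : realType) (Y : normedModType R) (u : nat -> Y) (s : Y) :=
  series u @ \oo --> s.

Section Sums.
Context (R : realType).
Implicit Types Y Z : normedModType R.

Lemma series_ordE (W : zmodType) (u : nat -> W) n :
  series u n = \sum_(k < n) u k.
Proof. by rewrite /series /= big_mkord. Qed.

Lemma sums_series Y (u : nat -> Y) s (e : R) : sums u s -> 0 < e ->
  \forall n \near \oo, `|s - \sum_(k < n) u k| < e.
Proof.
move=> /cvgrPdist_lt us e0; move: (us _ e0); apply: filterS => n.
by rewrite series_ordE => h; exact: h.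
Qed.

Lemma sumsP Y (u : nat -> Y) s :
  (forall e : R, 0 < e -> \forall n \near \oo, `|s - \sum_(k < n) u k| < e) ->
  sums u s.
Proof.
move=> h; apply/cvgrPdist_lt => e e0; move: (h _ e0); apply: filterS => n.
by rewrite series_ordE => h'; exact: h'.
Qed.

Lemma sums_unique Y (u : nat -> Y) s t : sums u s -> sums u t -> s = t.
Proof. by move=> us ut; apply: (cvg_unique _ us ut); exact: norm_hausdorff. Qed.

Lemma sumsD Y (u v : nat -> Y) s t : sums u s -> sums v t ->
  sums (fun n => u n + v n) (s + t).
Proof. by rewrite /sums (_ : (fun n => _) = u + v)// seriesD; exact: cvgD. Qed.

Lemma sumsZ Y (u : nat -> Y) s (k : R) : sums u s ->
  sums (fun n => k *: u n) (k *: s).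
Proof.
by rewrite /sums (_ : (fun n => _) = k *: u)// seriesZ => us; apply: cvgZl_tmp; exact: us.
Qed.

Lemma sumsB Y (u v : nat -> Y) s t : sums u s -> sums v t ->
  sums (fun n => u n - v n) (s - t).
Proof.
move=> us vt; have := sumsD us (sumsZ (k := -1) vt); rewrite scaleN1r.
by rewrite /sums (_ : (fun n => u n + -1 *: v n) = fun n => u n - v n) //;
  apply/funext => n; rewrite scaleN1r.
Qed.

Lemma sums_add_fin Y n (u : nat -> nat -> Y) (s : nat -> Y) :
  (forall i, (i < n)%N -> sums (u i) (s i)) ->
  sums (fun k => \sum_(i < n) u i k) (\sum_(i < n) s i).
Proof.
elim: n => [_|n IH H].
  rewrite big_ord0 (_ : (fun _ => _) = fun=> 0); last first.
    by apply/funext => k; rewrite big_ord0.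
  apply: sumsP => e e0; apply: nearW => k.
  by rewrite sub0r normrN big1 // normr0.
rewrite big_ord_recr /=.
rewrite (_ : (fun k => _) = fun k => \sum_(i < n) u i k + u n k); last first.
  by apply/funext => k; rewrite big_ord_recr.
by apply: sumsD; [apply: IH => i /ltnW|]; exact: H.
Qed.

Lemma sums_comp Y Z (L : {linear Y -> Z}) (u : nat -> Y) s :
  continuous L -> sums u s -> sums (fun n => L (u n)) (L s).
Proof.
move=> Lc us; rewrite /sums (_ : series _ = L \o series u).
  by apply: continuous_cvg => //; exact: Lc.
by apply/funext => n; rewrite /series /= linear_sum.
Qed.

Lemma eq_sums Y (u v : nat -> Y) s : (forall n, u n = v n) -> sums u s -> sums v s.
Proof. by move=> /funext ->. Qed.

Lemma sums_fin Y (u : nat -> Y) N : (forall n, (N <= n)%N -> u n = 0) ->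
  sums u (\sum_(k < N) u k).
Proof.
move=> u0; apply: sumsP => e e0; near=> n.
have Nn : (N <= n)%N by near: n; exact: nbhs_infty_ge.
rewrite (big_ord_widen_cond n xpredT u Nn).
rewrite [X in _ - X](bigID (fun k : 'I_n => (k < N)%N)) /=.
by rewrite [X in _ - (_ + X)]big1 ?addr0 ?subrr ?normr0 // => i; rewrite -leqNgt => /u0.
Unshelve. all: by end_near. Qed.

Lemma sums_nonneg (c : nat -> R) C : (forall n, 0 <= c n) ->
  (forall N, \sum_(k < N) c k <= C) ->
  exists2 s, sums c s & s <= C /\ forall N, \sum_(k < N) c k <= s.
Proof.
move=> c0 cC.
have nd : nondecreasing_seq (series c).
  by apply: nondecreasing_series => n _ _; exact: c0.
have cv : cvgn (series c).
  apply: nondecreasing_is_cvgn => //; exists C => _ [n _ <-].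
  by rewrite series_ordE.
exists (limn (series c)); first exact: cv.
split; first by apply: limr_le => //; apply: nearW => n; rewrite series_ordE.
by move=> N; have := nondecreasing_cvgn_le nd cv N; rewrite series_ordE.
Qed.

(** Two partial sums differ by at most the corresponding terms of the dominating
    series, and C bounds the sum of the latter. *)
Lemma sums_tail Y (u : nat -> Y) s (c : nat -> R) C N : sums u s ->
  (forall n, `|u n| <= c n) -> (forall N, \sum_(k < N) c k <= C) ->
  `|s - \sum_(k < N) u k| <= C - \sum_(k < N) c k.
Proof.
move=> us uc cC; apply/ler_addgt0Pr => e e0.
near \oo => n.
have Nn : (N <= n)%N by near: n; exact: nbhs_infty_ge.
have h1 : `|s - \sum_(k < n) u k| < e by near: n; exact: sums_series.
have splitS (Z : zmodType) (w : nat -> Z) : \sum_(k < n) w k - \sum_(k < N) w k = \sum_(N <= k < n) w k.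
  apply/eqP; rewrite subr_eq addrC -!(big_mkord xpredT).
  by rewrite (big_cat_nat (leq0n N) Nn).
have h2 : `|\sum_(k < n) u k - \sum_(k < N) u k| <= C - \sum_(k < N) c k.
  rewrite splitS; apply: (@le_trans _ _ (\sum_(N <= k < n) c k)).
    by apply: (le_trans (ler_norm_sum _ _ _)); exact: ler_sum.
  by rewrite -splitS lerD2r.
rewrite -[s - _](subrKA (\sum_(k < n) u k)) addrC.
by apply: (le_trans (ler_normD _ _)); apply: lerD => //; exact: ltW.
Unshelve. all: by end_near. Qed.

Lemma sums_le Y (u : nat -> Y) s (c : nat -> R) C : sums u s ->
  (forall n, `|u n| <= c n) -> (forall N, \sum_(k < N) c k <= C) -> `|s| <= C.
Proof. by move=> us uc cC; have := sums_tail 0 us uc cC; rewrite !big_ord0 !subr0. Qed.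

Lemma sums_exists (Y : completeNormedModType R) (u : nat -> Y) (c : nat -> R) C :
  (forall n, `|u n| <= c n) -> (forall N, \sum_(k < N) c k <= C) ->
  exists s, sums u s.
Proof.
move=> uc cC; have c0 n : 0 <= c n by exact: le_trans (uc n).
suff cv : cvgn [normed series u] by exists (limn (series u)); exact: normed_cvg.
apply: (series_le_cvg _ c0 uc) => [n|]; first exact: normr_ge0.
by have [s cs _] := sums_nonneg c0 cC; apply/cvg_ex; exists s.
Qed.

(** Absolutely convergent double series: the rows beyond the K-th contribute
    little, uniformly in the number of columns, and finitely many rows can be
    added up term by term. *)
Lemma sums_exchange Y (u : nat -> nat -> Y) (f g : nat -> Y) F
    (e : nat -> nat -> R) (M : nat -> R) C :
  (forall k n, `|u k n| <= e k n) -> (forall k N, \sum_(n < N) e k n <= M k) ->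
  (forall N, \sum_(k < N) M k <= C) ->
  (forall k, sums (u k) (f k)) -> sums f F ->
  (forall n, sums (fun k => u k n) (g n)) -> sums g F.
Proof.
move=> ue eM MC uf fF ug.
have M0 k : 0 <= M k by have := eM k 0%N; rewrite big_ord0.
have [D MD [_ leD]] := sums_nonneg M0 MC.
apply: sumsP => r r0; have r3 : 0 < r / 3 by rewrite divr_gt0.
have [K _ /(_ K (leqnn _)) KD] := sums_series MD r3.
have {}KD : D - \sum_(k < K) M k < r / 3.
  by apply: le_lt_trans KD; exact: ler_norm.
have h1 : `|F - \sum_(k < K) f k| <= D - \sum_(k < K) M k.
  by apply: (sums_tail K fF _ leD) => k; exact: (sums_le (uf k) (ue k) (eM k)).
have := sums_add_fin (fun k (_ : (k < K)%N) => uf k).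
move=> /sums_series/(_ r3); apply: filterS => N h2.
have h3 : `|\sum_(n < N) g n - \sum_(k < K) \sum_(n < N) u k n|
    <= D - \sum_(k < K) M k.
  have gN : sums (fun k => \sum_(n < N) u k n) (\sum_(n < N) g n).
    by apply: (sums_add_fin (u := fun n k => u k n)) => n _; exact: ug.
  apply: (sums_tail K gN _ leD) => k; apply: (le_trans (ler_norm_sum _ _ _)); apply: le_trans (eM k N).
  by apply: ler_sum => n _; exact: ue.
rewrite exchange_big /= in h2.
have -> : F - \sum_(n < N) g n = (F - \sum_(k < K) f k)
    + (\sum_(k < K) f k - \sum_(k < K) \sum_(n < N) u k n)
    - (\sum_(n < N) g n - \sum_(k < K) \sum_(n < N) u k n).
  by module.
apply: le_lt_trans (ler_normB _ _) _.
apply: le_lt_trans (lerD (ler_normD _ _) (lexx _)) _.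
lra.
Qed.

End Sums.

(** * Multilinear forms *)

(** Multilinear maps are taken on sequences, of which a form of degree n reads
    the first n terms: with this convention blocks of arguments are just shifted
    sequences, and a form can be substituted in another without casts. *)

Definition upd (T : Type) (v : nat -> T) i t : nat -> T :=
  fun j => if j == i then t else v j.

Lemma upd_id (T : Type) (v : nat -> T) i : upd v i (v i) = v.
Proof. by apply/funext => j; rewrite /upd; case: eqP => [->|]. Qed.

Lemma upd_upd (T : Type) (v : nat -> T) i s t : upd (upd v i s) i t = upd v i t.
Proof. by apply/funext => j; rewrite /upd; case: eqP. Qed.

Lemma updC (T : Type) (v : nat -> T) i j s t : i != j ->
  upd (upd v i s) j t = upd (upd v j t) i s.
Proof.
move=> ij; apply/funext => k; rewrite /upd.
by case: eqP => [->|//]; case: eqP => // ji; rewrite ji eqxx in ij.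
Qed.

Lemma upd_same (T : Type) (v : nat -> T) i t : upd v i t i = t.
Proof. by rewrite /upd eqxx. Qed.

Record form (R : realType) (X Y : normedModType R) (n : nat) (c : R)
    (a : (nat -> X) -> Y) : Prop := Form {
  form_ge0 : 0 <= c;
  form_ext : forall v w, (forall i, (i < n)%N -> v i = w i) -> a v = a w;
  form_lin : forall v i, (i < n)%N -> linear (fun t => a (upd v i t));
  form_bd : forall v, `|a v| <= c * \prod_(i < n) `|v i|
}.

Section Forms.
Context (R : realType).
Implicit Types X Y Z : normedModType R.

Lemma form_lin0 X Y n c (a : (nat -> X) -> Y) v i : form n c a -> (i < n)%N ->
  a (upd v i 0) = 0.
Proof.
move=> fa iN; have := form_lin fa v iN (-1) 0 0; rewrite scaler0 addr0 => {1}->.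
by rewrite scaleN1r addNr.
Qed.

Lemma form_linD X Y n c (a : (nat -> X) -> Y) v i s t : form n c a -> (i < n)%N ->
  a (upd v i (s + t)) = a (upd v i s) + a (upd v i t).
Proof. by move=> fa iN; have := form_lin fa v iN 1 s t; rewrite !scale1r. Qed.

Lemma form_linZ X Y n c (a : (nat -> X) -> Y) v i k t : form n c a -> (i < n)%N ->
  a (upd v i (k *: t)) = k *: a (upd v i t).
Proof.
move=> fa iN; have := form_lin fa v iN k t 0.
by rewrite addr0 (form_lin0 _ fa iN) addr0.
Qed.

Lemma form_linB X Y n c (a : (nat -> X) -> Y) v i s t : form n c a -> (i < n)%N ->
  a (upd v i (s - t)) = a (upd v i s) - a (upd v i t).
Proof.
by move=> fa iN; rewrite (form_linD _ _ _ fa iN) -scaleN1r (form_linZ _ _ _ fa iN) scaleN1r.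
Qed.

Lemma form_const X Y (y : Y) : form 0 `|y| (fun _ : nat -> X => y).
Proof. by split => // v; rewrite big_ord0 mulr1. Qed.

Lemma form_linear X Y (L : {linear X -> Y}) k : 0 <= k ->
  (forall x, `|L x| <= k * `|x|) -> form 1 k (fun v => L (v 0%N)).
Proof.
move=> k0 Lk; split => // [v w vw|v [|//] _ r s t|v]; first by rewrite vw.
  by rewrite !upd_same linearP.
by rewrite big_ord1.
Qed.

Lemma form0 X Y n : form n 0 (fun _ : nat -> X => 0 : Y).
Proof. by split=> // [v i _ k s t|v]; rewrite ?scaler0 ?addr0 // normr0 mul0r. Qed.

Lemma formD X Y n c d (a b : (nat -> X) -> Y) : form n c a -> form n d b ->
  form n (c + d) (fun v => a v + b v).
Proof.
move=> fa fb; split=> [|v w vw|v i iN k s t|v].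
- by rewrite addr_ge0 // ?(form_ge0 fa) ?(form_ge0 fb).
- by rewrite (form_ext fa vw) (form_ext fb vw).
- by rewrite (form_lin fa) // (form_lin fb) // scalerDr addrACA.
- rewrite mulrDl; apply: (le_trans (ler_normD _ _)).
  by apply: lerD; [exact: form_bd fa _|exact: form_bd fb _].
Qed.

Lemma form_comp_lin X Y Z n c k (a : (nat -> X) -> Y) (L : {linear Y -> Z}) :
  0 <= k -> (forall y, `|L y| <= k * `|y|) -> form n c a ->
  form n (k * c) (fun v => L (a v)).
Proof.
move=> k0 Lk fa; split=> [|v w vw|v i iN r s t|v].
- by rewrite mulr_ge0 // (form_ge0 fa).
- by rewrite (form_ext fa vw).
- by rewrite (form_lin fa) // linearP.
- apply: (le_trans (Lk _)); rewrite -mulrA; apply: ler_wpM2l => //.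
  exact: form_bd fa _.
Qed.

(** The start of the i-th of consecutive blocks of lengths m 0, m 1, and so on.
    *)
Definition offset (m : nat -> nat) i : nat := \sum_(l < i) m l.

Lemma offsetS m i : offset m i.+1 = (offset m i + m i)%N.
Proof. by rewrite /offset big_ord_recr. Qed.

Lemma offset_le m i j : (i <= j)%N -> (offset m i <= offset m j)%N.
Proof.
elim: j => [|j IH]; first by rewrite leqn0 => /eqP ->.
rewrite leq_eqVlt => /orP[/eqP -> //|]; rewrite ltnS => /IH h.
by rewrite offsetS; exact: leq_trans (leq_addr _ _).
Qed.

Lemma offset_block m n k : (k < offset m n)%N ->
  exists i j, [/\ (i < n)%N, (j < m i)%N & k = (offset m i + j)%N].
Proof.
elim: n => [|n IH]; first by rewrite /offset big_ord0.
rewrite offsetS => kn; have [/IH[i [j [iN jm kE]]]|nk] := ltnP k (offset m n).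
  by exists i, j; split => //; exact: ltnW.
by exists n, (k - offset m n)%N; split => //; lia.
Qed.

Lemma offset_inj m i j i' j' : (j < m i)%N -> (j' < m i')%N ->
  (offset m i + j = offset m i' + j')%N -> i = i'.
Proof.
move=> jm jm' e; case: (ltngtP i i') => // /(offset_le m);
  rewrite offsetS; lia.
Qed.

(** The q i read consecutive blocks of the arguments, so that the result is a
    form in the arguments of all of them. *)
Lemma form_subst X Y Z n c (A : (nat -> Y) -> Z) (m : nat -> nat) (d : nat -> R)
    (q : nat -> (nat -> X) -> Y) :
  form n c A -> (forall i, (i < n)%N -> form (m i) (d i) (q i)) ->
  form (offset m n) (c * \prod_(i < n) d i)
    (fun v => A (fun i => q i (fun j => v (offset m i + j)%N))).
Proof.
move=> fA fq; split=> [|v w vw|v k kn|v].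
- by rewrite mulr_ge0 ?(form_ge0 fA) // prodr_ge0 // => i _; exact: form_ge0 (fq i _).
- apply: (form_ext fA) => i iN; apply: (form_ext (fq i iN)) => j jm.
  apply: vw; apply: leq_trans (offset_le m iN); rewrite offsetS; lia.
- have [i [j [iN jm kE]]] := offset_block kn.
  have updE t : A (fun i' => q i' (fun j' => upd v k t (offset m i' + j')%N)) =
      A (upd (fun i' => q i' (fun j' => v (offset m i' + j')%N)) i
             (q i (upd (fun j' => v (offset m i + j')%N) j t))).
    apply: (form_ext fA) => i' iN'; rewrite {2}/upd; case: eqP => [->|ii'].
      congr (q i _); apply/funext => j'; rewrite /upd kE.
      by rewrite eqn_add2l.
    apply: (form_ext (fq i' iN')) => j' jm'; rewrite /upd; case: eqP => // e.
    by case: ii'; apply: (offset_inj jm' jm); rewrite e.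
  move=> r s t; rewrite !updE.
  by rewrite (form_lin (fq i iN)) // (form_lin fA).
- apply: (le_trans (form_bd fA _)); rewrite -mulrA; apply: ler_wpM2l.
    exact: form_ge0 fA.
  have -> : \prod_(i < offset m n) `|v i| =
      \prod_(i < n) \prod_(j < m i) `|v (offset m i + j)%N|.
    elim: n {c A fA fq} => [|n IH]; first by rewrite /offset !big_ord0.
    by rewrite offsetS big_split_ord /= IH big_ord_recr.
  rewrite -big_split /=; apply: ler_prod => i _; rewrite normr_ge0 /=.
  exact: form_bd (fq i _) _.
Qed.

Definition mix (T : Type) (w x : nat -> T) i : nat -> T :=
  fun j => if (j < i)%N then w j else x j.

(** The arguments are replaced one at a time. *)
Lemma form_telescope X Y n c (a : (nat -> X) -> Y) (w x : nat -> X) :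
  form n c a ->
  a w - a x = \sum_(i < n) a (upd (mix w x i) i (w i - x i)).
Proof.
move=> fa.
have -> : a w = a (mix w x n).
  by apply: (form_ext fa) => i iN; rewrite /mix iN.
have -> : a x = a (mix w x 0) by apply: (form_ext fa).
rewrite -(big_mkord xpredT (fun i => a (upd (mix w x i) i (w i - x i)))).
rewrite -(telescope_sumr (fun i => a (mix w x i)))//; apply: eq_big_nat => i iN.
rewrite (form_linB _ _ _ fa iN); congr (a _ - a _); apply/funext => j.
  by rewrite /mix /upd ltnS leq_eqVlt; case: eqP => [->|].
by rewrite /mix /upd; case: eqP => [->|//]; rewrite ltnn.
Qed.

End Forms.

(** * Convergent power series *)

(** A power series that converges normally on the closed ball of radius rho,
    with sum of norms at most M.  For fixed rho these functions form a normed
    space whose norm is submultiplicative under multilinear maps; being complete,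
    it allows compositions, inverses and Lie series to be built as normally
    convergent series, and M to be followed through the construction. *)
Definition pser (R : realType) (X Y : normedModType R) (rho M : R) (f : X -> Y)
    : Prop :=
  0 < rho /\ exists (a : nat -> (nat -> X) -> Y) (c : nat -> R),
    [/\ forall n, form n (c n) (a n),
        forall N, \sum_(n < N) c n * rho ^+ n <= M
      & forall h, `|h| <= rho -> sums (fun n => a n (fun=> h)) (f h)].

Section PowerSeries.
Context (R : realType).
Implicit Types X Y Z : normedModType R.

Lemma pser_gt0 X Y rho M (f : X -> Y) : pser rho M f -> 0 < rho.
Proof. by case. Qed.

Lemma pser_ge0 X Y rho M (f : X -> Y) : pser rho M f -> 0 <= M.
Proof. by move=> [_ [a [c [_ cM _]]]]; have := cM 0%N; rewrite big_ord0. Qed.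

Lemma pser_le X Y rho rho' M M' (f : X -> Y) : 0 < rho' -> rho' <= rho ->
  M <= M' -> pser rho M f -> pser rho' M' f.
Proof.
move=> r0 rr MM [_ [a [c [fa cM af]]]]; split=> //; exists a, c; split=> // [N|h hr].
  apply: le_trans MM; apply: le_trans (cM N); apply: ler_sum => n _.
  apply: ler_wpM2l; first exact: form_ge0 (fa n).
  by apply: lerXn2r => //; rewrite nnegrE ltW // (lt_le_trans r0).
by apply: af; exact: le_trans rr.
Qed.

Lemma pser_ext X Y rho M (f g : X -> Y) :
  (forall h, `|h| <= rho -> f h = g h) -> pser rho M f -> pser rho M g.
Proof.
move=> fg [r0 [a [c [fa cM af]]]]; split=> //; exists a, c; split=> // h hr.
by rewrite -fg //; exact: af.
Qed.

Lemma form_cst_bd X Y n c (a : (nat -> X) -> Y) h : form n c a ->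
  `|a (fun=> h)| <= c * `|h| ^+ n.
Proof.
by move=> fa; have := form_bd fa (fun=> h); rewrite prodr_const card_ord.
Qed.

Lemma pser_monomial X Y rho n c (a : (nat -> X) -> Y) : 0 < rho -> form n c a ->
  pser rho (c * rho ^+ n) (fun x => a (fun=> x)).
Proof.
move=> r0 fa; split=> //.
exists (fun k => if k == n then a else fun=> 0), (fun k => if k == n then c else 0).
split=> [k|N|h _].
- by case: eqP => [->//|_]; exact: form0.
- rewrite -(big_mkord xpredT (fun k => (if k == n then c else 0) * rho ^+ k)).
  rewrite (eq_bigr (fun k => if k == n then c * rho ^+ k else 0)); last first.
    by move=> k _; case: eqP; rewrite ?mul0r.
  rewrite -big_mkcond /= big_nat1_eq; case: ifP => // _.
  by rewrite mulr_ge0 ?(form_ge0 fa) // exprn_ge0 // ltW.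
- have := @sums_fin R Y (fun k => (if k == n then a else fun=> 0) (fun=> h)) n.+1.
  rewrite big_ord_recr /= eqxx big1 ?add0r; last first.
    by move=> i _; rewrite (ltn_eqF (ltn_ord i)).
  by apply=> k nk; rewrite (gtn_eqF nk).
Qed.

Lemma pser_const X Y rho (y : Y) : 0 < rho -> pser rho `|y| (fun _ : X => y).
Proof.
by move=> r0; have := pser_monomial r0 (form_const X y); rewrite expr0 mulr1.
Qed.

Lemma pser_linear X Y rho k (L : {linear X -> Y}) : 0 < rho -> 0 <= k ->
  (forall x, `|L x| <= k * `|x|) -> pser rho (k * rho) L.
Proof.
by move=> r0 k0 Lk; have := pser_monomial r0 (form_linear k0 Lk); rewrite expr1.
Qed.

Lemma pserD X Y rho M N (f g : X -> Y) : pser rho M f -> pser rho N g ->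
  pser rho (M + N) (fun x => f x + g x).
Proof.
move=> [r0 [a [c [fa cM af]]]] [_ [b [d [fb dN bg]]]]; split=> //.
exists (fun n v => a n v + b n v), (fun n => c n + d n); split=> [n|K|h hr].
- exact: formD.
- under eq_bigr do rewrite mulrDl.
  by rewrite big_split; exact: lerD.
- by apply: sumsD; [exact: af|exact: bg].
Qed.

Lemma bounded_continuous X Y (L : {linear X -> Y}) k :
  (forall v, `|L v| <= k * `|v|) -> continuous L.
Proof.
move=> Lk x; apply/cvgrPdist_lt => e e0.
have k1 : 0 < `|k| + 1 by rewrite ltr_wpDl.
near=> z; rewrite -linearB; apply: (le_lt_trans (Lk _)).
apply: (@le_lt_trans _ _ ((`|k| + 1) * `|x - z|)).
  by apply: ler_wpM2r => //; rewrite (le_trans (ler_norm k)) // lerDl.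
rewrite -ltr_pdivlMl // mulrC; near: z; apply: cvgr_dist_lt => //.
by rewrite divr_gt0.
Unshelve. all: by end_near. Qed.

Lemma pser_comp_linear X Y Z rho M k (f : X -> Y) (L : {linear Y -> Z}) :
  0 <= k -> (forall y, `|L y| <= k * `|y|) -> pser rho M f ->
  pser rho (k * M) (fun x => L (f x)).
Proof.
move=> k0 Lk [r0 [a [c [fa cM af]]]]; split=> //.
exists (fun n v => L (a n v)), (fun n => k * c n); split=> [n|K|h hr].
- exact: form_comp_lin.
- under eq_bigr do rewrite -mulrA.
  by rewrite -mulr_sumr; apply: ler_wpM2l.
- apply: sums_comp; [exact: bounded_continuous Lk|exact: af].
Qed.

Lemma pserN X Y rho M (f : X -> Y) : pser rho M f -> pser rho M (fun x => - f x).
Proof.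
move=> [r0 [a [c [fa cM af]]]]; split=> //.
exists (fun n v => - a n v), c; split=> // [n|h hr].
  have [c0 e l b] := fa n; split=> // [v w /e -> //|v i iN k s t|v].
    by rewrite l // opprD scalerN.
  by rewrite normrN.
have := sumsZ (k := -1) (af h hr); rewrite scaleN1r.
by apply: eq_sums => n; rewrite scaleN1r.
Qed.

Lemma pserB X Y rho M N (f g : X -> Y) : pser rho M f -> pser rho N g ->
  pser rho (M + N) (fun x => f x - g x).
Proof. by move=> pf /pserN; exact: pserD. Qed.

Lemma pser_bd X Y rho M (f : X -> Y) h : pser rho M f -> `|h| <= rho -> `|f h| <= M.
Proof.
move=> [r0 [a [c [fa cM af]]]] hr.
apply: (@sums_le _ _ _ _ (fun n => c n * rho ^+ n) _ (af h hr) _ cM) => n.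
apply: (le_trans (form_cst_bd h (fa n))).
apply: ler_wpM2l; first exact: form_ge0 (fa n).
by apply: lerXn2r => //; rewrite nnegrE // ltW.
Qed.

Lemma form_slot X Y n c (a : (nat -> X) -> Y) v i t : form n c a -> (i < n)%N ->
  `|a (upd v i t)| <= c * (\prod_(j < n | (j : nat) != i) `|v j|) * `|t|.
Proof.
move=> fa iN; apply: (le_trans (form_bd fa _)); rewrite -mulrA.
apply: ler_wpM2l; first exact: form_ge0 fa.
rewrite (bigD1 (Ordinal iN)) //= upd_same mulrC; apply: ler_wpM2r => //.
apply: ler_prod => j ji; rewrite normr_ge0 /=.
by rewrite /upd (negbTE (_ : (j : nat) != i)).
Qed.

Lemma form_sums X Y n c (a : (nat -> X) -> Y) v i u s : form n c a -> (i < n)%N ->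
  sums u s -> sums (fun k => a (upd v i (u k))) (a (upd v i s)).
Proof.
move=> fa iN us; set K := c * (\prod_(j < n | (j : nat) != i) `|v j|).
have K0 : 0 <= K.
  by rewrite mulr_ge0 ?(form_ge0 fa) // prodr_ge0 // => *.
have K1 : 0 < K + 1 by rewrite ltr_wpDl.
apply: sumsP => e e0; have e1 : 0 < e / (K + 1) by rewrite divr_gt0.
have := sums_series us e1; apply: filterS => N h.
have -> : \sum_(k < N) a (upd v i (u k)) = a (upd v i (\sum_(k < N) u k)).
  elim: {h} N => [|N IH]; first by rewrite !big_ord0 (form_lin0 v fa).
  by rewrite !big_ord_recr /= (form_linD _ _ _ fa) // IH.
rewrite -(form_linB _ _ _ fa) //; apply: (le_lt_trans (form_slot _ _ fa iN)).
apply: (@le_lt_trans _ _ ((K + 1) * `|s - \sum_(k < N) u k|)).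
  by apply: ler_wpM2r => //; rewrite lerDl.
by rewrite -ltr_pdivlMl // mulrC.
Qed.

(** Completeness of the normed space of power series on a fixed ball. *)
Lemma pser_series X (Y : completeNormedModType R) rho C (M : nat -> R)
    (f : nat -> X -> Y) (F : X -> Y) : 0 < rho ->
  (forall k, pser rho (M k) (f k)) -> (forall K, \sum_(k < K) M k <= C) ->
  (forall h, `|h| <= rho -> sums (fun k => f k h) (F h)) -> pser rho C F.
Proof.
move=> r0 pf MC fF.
have /choice[a /choice[c H]] : forall k, exists a, exists c,
    [/\ forall n, form n (c n) (a n),
        forall N, \sum_(n < N) c n * rho ^+ n <= M k
      & forall h, `|h| <= rho -> sums (fun n => a n (fun=> h)) (f k h)].
  by move=> k; have [_] := pf k.
have fa k n : form n (c k n) (a k n) by have [] := H k.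
have cM k N : \sum_(n < N) c k n * rho ^+ n <= M k by have [] := H k.
have af k h : `|h| <= rho -> sums (fun n => a k n (fun=> h)) (f k h).
  by have [_ _] := H k; exact.
have c0 k n : 0 <= c k n := form_ge0 (fa k n).
have M0 k : 0 <= M k by exact: pser_ge0 (pf k).
have cn k n : c k n * rho ^+ n <= M k.
  apply: le_trans (cM k n.+1); rewrite big_ord_recr /= lerDr.
  by apply: sumr_ge0 => i _; rewrite mulr_ge0 // exprn_ge0 // ltW.
have cC n K : \sum_(k < K) c k n <= C / rho ^+ n.
  rewrite ler_pdivlMr ?exprn_gt0 // mulr_suml; apply: le_trans (MC K).
  exact: ler_sum.
have /choice[d Hd] : forall n, exists d, sums (fun k => c k n) d.
  by move=> n; have [s cs _] := sums_nonneg (fun k => c0 k n) (cC n); exists s.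
have dP n K : \sum_(k < K) c k n <= d n.
  have [s cs [_ sK]] := sums_nonneg (fun k => c0 k n) (cC n).
  by rewrite (sums_unique (Hd n) cs).
have /choice[b Hb] : forall n, exists b, forall v, sums (fun k => a k n v) (b v).
  move=> n; suff /choice[b] : forall v, exists s, sums (fun k => a k n v) s by exists b.
  move=> v; apply: (@sums_exists _ _ _ (fun k => c k n * \prod_(i < n) `|v i|)).
    by move=> k; exact: form_bd (fa k n) v.
  move=> K; rewrite -mulr_suml; apply: ler_wpM2r (dP n K).
  by rewrite prodr_ge0.
split=> //; exists b, d; split=> [n|N|h hr].
- split=> [|v w vw|v i iN k s t|v].
  + by have := dP n 0%N; rewrite big_ord0.
  + apply: (sums_unique (Hb n v)); move: (Hb n w); apply: eq_sums => k.
    by rewrite (form_ext (fa k n) vw).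
  + apply: (sums_unique (Hb n _)).
    have := sumsD (sumsZ (k := k) (Hb n (upd v i s))) (Hb n (upd v i t)).
    by apply: eq_sums => l; rewrite (form_lin (fa l n)).
  + apply: (sums_le (Hb n v) (fun k => form_bd (fa k n) v)) => K.
    rewrite -mulr_suml; apply: ler_wpM2r (dP n K).
    by rewrite prodr_ge0.
- have S : sums (fun k => \sum_(n < N) c k n * rho ^+ n) (\sum_(n < N) d n * rho ^+ n).
    apply: (@sums_add_fin R R N (fun n k => c k n * rho ^+ n)
      (fun n => d n * rho ^+ n)) => n _.
    have := sumsZ (k := rho ^+ n) (Hd n); rewrite -[d n * _]mulrC.
    by apply: eq_sums => k; exact: mulrC.
  apply: le_trans (ler_norm _) _.
  apply: (sums_le S _ MC) => k; rewrite ger0_norm // sumr_ge0 // => i _.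
  by rewrite mulr_ge0 // exprn_ge0 // ltW.
- apply: (@sums_exchange _ _ (fun k n => a k n (fun=> h)) (fun k => f k h) _ _
    (fun k n => c k n * rho ^+ n) M C) => // [k n|k|].
  + apply: (le_trans (form_cst_bd h (fa k n))); apply: ler_wpM2l => //.
    by apply: lerXn2r => //; rewrite nnegrE // ltW.
  + exact: af.
  + exact: fF.
Qed.

(** The norm of power series is submultiplicative.  The arguments are replaced
    one at a time by their monomials, so that a multiple series never occurs. *)
Lemma pser_form X Y (Z : completeNormedModType R) rho n c (A : (nat -> Y) -> Z)
    (M : nat -> R) (g : nat -> X -> Y) : 0 < rho -> form n c A ->
  (forall i, (i < n)%N -> pser rho (M i) (g i)) ->
  pser rho (c * \prod_(i < n) M i) (fun x => A (fun i => g i x)).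
Proof.
move=> r0 fA pg.
have c0 := form_ge0 fA.
pose mon (C : R) (h : X -> Y) := exists m d q,
  [/\ form m d q, C = d * rho ^+ m & h = fun x => q (fun=> x)].
suff : forall k, (k <= n)%N -> forall (M : nat -> R) (g : nat -> X -> Y),
    (forall i, (i < k)%N -> pser rho (M i) (g i)) ->
    (forall i, (k <= i)%N -> (i < n)%N -> mon (M i) (g i)) ->
    pser rho (c * \prod_(i < n) M i) (fun x => A (fun i => g i x)).
  apply; first exact: leqnn; first exact: pg.
  by move=> i ni iN; move: (leq_trans iN ni); rewrite ltnn.
move=> {M g pg} k; elim: k => [_|k IH kn] M g pg mg.
  have /choice[m /choice[d /choice[q H]]] : forall i, exists m, exists d, exists q,
      (i < n)%N -> [/\ form m d q, M i = d * rho ^+ m & g i = fun x => q (fun=> x)].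
    move=> i; have [iN|ni] := ltnP i n; last by exists 0%N, 0, (fun=> 0).
    by have [m [d [q H]]] := mg i isT iN; exists m, d, q.
  have fq i : (i < n)%N -> form (m i) (d i) (q i) by move=> /H[].
  have := pser_monomial r0 (form_subst fA fq).
  have -> : c * \prod_(i < n) d i * rho ^+ offset m n = c * \prod_(i < n) M i.
    rewrite -mulrA; congr (_ * _); rewrite /offset expr_sum -big_split /=.
    by apply: eq_bigr => i _; have [_ ->] := H i (ltn_ord i).
  apply: pser_ext => x _; apply: (form_ext fA) => i iN.
  by have [_ _ ->] := H i iN.
have [_ [a [d [fa dM ag]]]] := pg k (ltnSn k).
pose P := \prod_(i < n | (i : nat) != k) M i.
have MP t : \prod_(i < n) upd M k t i = t * P.
  rewrite (bigD1 (Ordinal kn)) //= upd_same; congr (_ * _).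
  by apply: eq_bigr => i ik; rewrite /upd (negbTE (_ : (i : nat) != k)).
have MP' : \prod_(i < n) M i = M k * P by rewrite -MP upd_id.
have M0 i : (i < n)%N -> 0 <= M i.
  move=> iN; have [ik|ki] := ltnP i k.+1; first exact: pser_ge0 (pg i ik).
  have [m [e [q [fq -> _]]]] := mg i ki iN.
  by rewrite mulr_ge0 ?(form_ge0 fq) // exprn_ge0 // ltW.
have P0 : 0 <= P by rewrite prodr_ge0 // => i _; exact: M0.
apply: (@pser_series _ _ _ _ (fun l => c * \prod_(i < n) upd M k (d l * rho ^+ l) i)
   (fun l x => A (fun i => upd g k (fun x => a l (fun=> x)) i x))) => // [l|K|h hr].
- apply: IH; first exact: ltnW.
    move=> i ik; rewrite /upd (ltn_eqF ik).
    by apply: pg; exact: ltnW.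
  move=> i ki iN; rewrite /upd; case: eqP => [_|ik].
    by exists l, (d l), (a l).
  by apply: mg => //; rewrite ltn_neqAle ki andbT; apply/eqP => e; exact: ik.
- under eq_bigr do rewrite MP.
  rewrite -mulr_sumr -mulr_suml MP'; apply: ler_wpM2l => //.
  by apply: ler_wpM2r.
- have := form_sums (v := fun i => g i h) fA kn (ag h hr).
  rewrite upd_id; apply: eq_sums => l; congr A; apply/funext => i.
  by rewrite /upd; case: eqP.
Qed.

(** Of the inner series only the bound sigma matters: it is the radius at which
    the outer one is summed. *)
Lemma pser_comp X Y (Z : completeNormedModType R) rho sigma M (f : Y -> Z)
    (g : X -> Y) : pser sigma M f -> pser rho sigma g ->
  pser rho M (fun x => f (g x)).
Proof.
move=> [s0 [a [c [fa cM af]]]] pg; have r0 := pser_gt0 pg.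
apply: (@pser_series _ _ _ _ (fun n => c n * sigma ^+ n)
   (fun n x => a n (fun=> g x))) => // [n|h hr].
  have := pser_form r0 (fa n) (fun i _ => pg).
  by rewrite prodr_const card_ord.
by apply: af; exact: pser_bd pg hr.
Qed.

Lemma pser_id X rho : 0 < rho -> pser rho rho (fun x : X => x).
Proof.
move=> r0; rewrite -{2}[rho]mul1r; apply: (@pser_linear _ _ _ 1 idfun) => // x.
by rewrite mul1r.
Qed.

(** Recentering is composition with a translation, a power series of norm |x| +
    rho' on the ball of radius rho'. *)
Lemma pser_shift X (Y : completeNormedModType R) rho rho' M (f : X -> Y) x :
  pser rho M f -> 0 < rho' -> `|x| + rho' <= rho ->
  pser rho' M (fun h => f (x + h)).
Proof.
move=> pf r0 xr; have := pserD (pser_const X x r0) (pser_id X r0).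
by move=> /(pser_le r0 (lexx _) xr); exact: pser_comp pf.
Qed.

End PowerSeries.

(** * Differentiation of power series *)

(** A name of its own for the differential at x in the direction v, which keeps
    the filters and the scaling law of 'd out of the terms. *)
Definition D (R : realType) (X Y : normedModType R) (f : X -> Y) (x v : X) : Y :=
  'd f x v.

Section Differentiation.
Context (R : realType).
Implicit Types W X Y Z : normedModType R.

(** The remainders of power series are quadratic, which is more than the
    definition of the differential asks for. *)
Lemma quad_diff X Y (f : X -> Y) x (L : {linear X -> Y}) k C d : 0 < d ->
  (forall v, `|L v| <= k * `|v|) ->
  (forall h, `|h| <= d -> `|f (x + h) - f x - L h| <= C * `|h| ^+ 2) ->
  differentiable f x /\ forall v, D f x v = L v.
Proof.
move=> d0 Lk q; have Lc := bounded_continuous Lk.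
have o : f \o shift x = cst (f x) + L +o_ 0 id.
  apply/eqaddoP => e e0.
  have C1 : 0 < `|C| + 1 by rewrite ltr_wpDl.
  near=> h; rewrite /= -[X in `|X|]/(f (h + x) - (f x + L h)) opprD addrA addrC.
  rewrite [h + x]addrC addrC; apply: (le_trans (q h _)).
    by near: h; apply: nbhs0_le.
  apply: (@le_trans _ _ ((`|C| + 1) * `|h| ^+ 2)).
    by apply: ler_wpM2r; rewrite ?exprn_ge0 // (le_trans (ler_norm C)) // lerDl.
  rewrite expr2 mulrA; apply: ler_wpM2r => //.
  by rewrite -ler_pdivlMl // mulrC; near: h; apply: nbhs0_le; rewrite divr_gt0.
have dE := diff_unique Lc o; split=> [|v]; last by rewrite /D dE.
by apply/diff_locallyP; rewrite dE.
Unshelve. all: by end_near. Qed.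

Lemma DZ X Y (f : X -> Y) x k v : D f x (k *: v) = k *: D f x v.
Proof. exact: linearZ. Qed.

Lemma sums_shift Y (u : nat -> Y) s m : sums u s ->
  sums (fun k => u (m + k)%N) (s - \sum_(k < m) u k).
Proof.
move=> us; apply: sumsP => e e0; have := sums_series us e0.
move=> [N _ NP]; exists N => // n /= Nn.
have := NP (m + n)%N (leq_trans Nn (leq_addl _ _)).
by rewrite big_split_ord /= opprD addrA.
Qed.

(** On the ball of radius |h| the terms of degree at least 2 gain a factor (|h|
    / rho)^2. *)
Lemma pser_quad X Y rho M (f : X -> Y) : pser rho M f ->
  exists L : {linear X -> Y}, (forall v, `|L v| <= M / rho * `|v|) /\
    forall h, `|h| <= rho -> `|f h - f 0 - L h| <= M / rho ^+ 2 * `|h| ^+ 2.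
Proof.
move=> [r0 [a [c [fa cM af]]]].
have c0 n : 0 <= c n := form_ge0 (fa n).
have aE v w : a 1%N (fun=> v) = a 1%N (upd w 0 v).
  by apply: (form_ext (fa 1%N)) => -[|//] _.
have Ll : linear (fun v => a 1%N (fun=> v)).
  by move=> k s t; rewrite !(aE _ (fun=> 0)) (form_lin (fa 1%N)).
pose L : {linear X -> Y} := HB.pack (fun v => a 1%N (fun=> v))
  (GRing.isLinear.Build _ _ _ _ _ Ll).
have cn n : c n * rho ^+ n <= M.
  apply: le_trans (cM n.+1); rewrite big_ord_recr /= lerDr.
  by apply: sumr_ge0 => i _; rewrite mulr_ge0 // exprn_ge0 // ltW.
exists L; split=> [v|h hr].
  apply: (le_trans (form_cst_bd v (fa 1%N))); rewrite expr1; apply: ler_wpM2r => //.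
  by rewrite ler_pdivlMr //; have := cn 1%N; rewrite expr1.
have f0 : f 0 = a 0%N (fun=> h).
  have h0 : sums (fun n => a n (fun=> 0)) (f 0) by apply: af; rewrite normr0 ltW.
  apply: (sums_unique h0).
  rewrite (_ : a 0%N _ = \sum_(k < 1) a k (fun=> 0)); last first.
    by rewrite big_ord1; apply: (form_ext (fa 0%N)).
  apply: sums_fin => -[//|n _].
  by rewrite -(upd_id (fun=> 0) 0) (form_lin0 _ (fa n.+1)).
have := sums_shift (m := 2) (af h hr).
rewrite !big_ord_recr big_ord0 /= add0r opprD addrA -f0 => S.
apply: (@sums_le _ _ _ _ (fun n => c (2 + n)%N * rho ^+ (2 + n) * (`|h| / rho) ^+ 2) _ S) => [n|N].
  apply: (le_trans (form_cst_bd h (fa _))); rewrite -mulrA; apply: ler_wpM2l => //.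
  have -> : rho ^+ (2 + n) * (`|h| / rho) ^+ 2 = `|h| ^+ 2 * rho ^+ n.
    by rewrite exprD; field; rewrite gt_eqF.
  rewrite exprD; apply: ler_wpM2l; first by rewrite exprn_ge0.
  by apply: lerXn2r => //; rewrite nnegrE // ltW.
rewrite -mulr_suml (_ : M / _ * _ = M * (`|h| / rho) ^+ 2); last first.
  by field; rewrite gt_eqF.
apply: ler_wpM2r; first by rewrite exprn_ge0 // divr_ge0 // ltW.
apply: le_trans (cM (2 + N)%N); rewrite big_split_ord /= lerDr.
by apply: sumr_ge0 => j _; rewrite mulr_ge0 // exprn_ge0 // ltW.
Qed.

Lemma pser_diff0 X Y rho M (f : X -> Y) : pser rho M f ->
  [/\ differentiable f 0, forall v, `|D f 0 v| <= M / rho * `|v|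
    & forall h, `|h| <= rho ->
        `|f h - f 0 - D f 0 h| <= M / rho ^+ 2 * `|h| ^+ 2].
Proof.
move=> pf; have r0 := pser_gt0 pf; have [L [Lb q]] := pser_quad pf.
have [df dE] : differentiable f 0 /\ forall v, D f 0 v = L v.
  apply: (quad_diff (C := M / rho ^+ 2) r0 Lb) => h hr.
  by rewrite add0r; exact: q.
by split=> // [v|h hr]; rewrite dE //; exact: q.
Qed.

Lemma pser_diff X (Y : completeNormedModType R) rho r M (f : X -> Y) x :
  pser rho M f -> 0 < r -> `|x| + r <= rho ->
  [/\ differentiable f x, forall v, `|D f x v| <= M / r * `|v|
    & forall h, `|h| <= r ->
        `|f (x + h) - f x - D f x h| <= M / r ^+ 2 * `|h| ^+ 2].
Proof.
move=> pf r0 xr; have pg := pser_shift pf r0 xr.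
have [L [Lb q]] := pser_quad pg.
have [df dE] : differentiable f x /\ forall v, D f x v = L v.
  apply: (quad_diff (C := M / r ^+ 2) r0 Lb) => h hr.
  by have := q h hr; rewrite addr0.
by split=> // [v|h hr]; rewrite dE //; have := q h hr; rewrite addr0.
Qed.

Lemma eq_of_quad Y (u : Y) d C : 0 < d ->
  (forall s : R, 0 < s -> s <= d -> `|s *: u| <= C * s ^+ 2) -> u = 0.
Proof.
move=> d0 H; apply/eqP; rewrite -normr_eq0 eq_le normr_ge0 andbT.
apply/ler_addgt0Pr => e e0; rewrite add0r.
have C1 : 0 < `|C| + 1 by rewrite ltr_wpDl.
pose s := Num.min d (e / (`|C| + 1)).
have s0 : 0 < s by rewrite lt_min d0 divr_gt0.
have sd : s <= d by rewrite ge_min lexx.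
have := H s s0 sd; rewrite normrZ gtr0_norm // expr2 mulrA mulrC.
rewrite ler_pM2r // => /le_trans; apply.
apply: (@le_trans _ _ ((`|C| + 1) * s)).
  by apply: ler_wpM2r; [exact: ltW|rewrite (le_trans (ler_norm C)) // lerDl].
by rewrite -ler_pdivlMl // mulrC ge_min lexx orbT.
Qed.

(** Once a map is known to be differentiable, one line with a quadratic error
    determines a directional derivative. *)
Lemma pser_dir X (Y : completeNormedModType R) rho M (f : X -> Y) x v w d C :
  pser rho M f -> `|x| < rho -> 0 < d ->
  (forall s : R, 0 < s -> s <= d -> `|f (x + s *: v) - f x - s *: w| <= C * s ^+ 2) ->
  D f x v = w.
Proof.
move=> pf xr d0 H.
have r0 : 0 < rho - `|x| by rewrite subr_gt0.
have xr' : `|x| + (rho - `|x|) <= rho by rewrite addrC subrK.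
have [df _ q] := pser_diff pf r0 xr'.
set r := rho - `|x| in r0 q.
have v1 : 0 < `|v| + 1 by rewrite ltr_wpDl.
pose d' := Num.min d (r / (`|v| + 1)).
have d'0 : 0 < d' by rewrite lt_min d0 divr_gt0.
apply/eqP; rewrite -subr_eq0; apply/eqP.
apply: (eq_of_quad (C := M / r ^+ 2 * `|v| ^+ 2 + C) d'0) => s s0.
rewrite le_min => /andP[sd sr].
have svr : `|s *: v| <= r.
  rewrite normrZ gtr0_norm //; apply: (@le_trans _ _ (s * (`|v| + 1))).
    by apply: ler_wpM2l; [exact: ltW|rewrite lerDl].
  by rewrite -ler_pdivlMr.
have := lerD (q _ svr) (H s s0 sd); rewrite normrZ gtr0_norm // exprMn.
rewrite [s ^+ 2 * _]mulrC mulrA -mulrDl; apply: le_trans.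
rewrite scalerBr -DZ; apply: le_trans (ler_normB _ _).
rewrite -[leLHS]normrN; set A := (X in `|X| <= _); set B := (X in _ <= `|X|).
by rewrite (_ : A = B) // /A /B; module.
Qed.

(** Cauchy's estimate makes the series of the derivatives normally convergent,
    and the quadratic remainders of the terms add up to a quadratic remainder of
    the sum. *)
Lemma pser_series_diff X (Y : completeNormedModType R) rho C (M : nat -> R)
    (f : nat -> X -> Y) (F : X -> Y) x v : 0 < rho ->
  (forall k, pser rho (M k) (f k)) -> (forall K, \sum_(k < K) M k <= C) ->
  (forall h, `|h| <= rho -> sums (fun k => f k h) (F h)) -> `|x| < rho ->
  sums (fun k => D (f k) x v) (D F x v).
Proof.
move=> r0 pf MC fF xr; have pF := pser_series r0 pf MC fF.
have r0' : 0 < rho - `|x| by rewrite subr_gt0.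
have xr' : `|x| + (rho - `|x|) <= rho by rewrite addrC subrK.
set r := rho - `|x| in r0' xr'.
have M0 k : 0 <= M k := pser_ge0 (pf k).
have bd k : `|D (f k) x v| <= M k / r * `|v| by have [_ + _] := pser_diff (pf k) r0' xr'.
have [w dw] : exists w, sums (fun k => D (f k) x v) w.
  apply: (sums_exists (C := C / r * `|v|) bd) => K.
  rewrite -!mulr_suml; apply: ler_wpM2r => //; apply: ler_wpM2r => //.
  by rewrite invr_ge0 ltW.
suff -> : D F x v = w by [].
have v1 : 0 < `|v| + 1 by rewrite ltr_wpDl.
apply: (pser_dir (C := C / r ^+ 2 * `|v| ^+ 2) pF xr (divr_gt0 r0' v1)) => s s0 sr.
have svr : `|s *: v| <= r.
  rewrite normrZ gtr0_norm //; apply: (@le_trans _ _ (s * (`|v| + 1))).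
    by apply: ler_wpM2l; [exact: ltW|rewrite lerDl].
  by rewrite -ler_pdivlMr.
have xsr : `|x + s *: v| <= rho.
  apply: (le_trans (ler_normD _ _)); apply: le_trans xr'.
  by rewrite lerD2l.
have S := sumsD (sumsD (fF _ xsr) (sumsZ (k := -1) (fF _ (ltW xr)))) (sumsZ (k := - s) dw).
rewrite scaleN1r scaleNr in S.
apply: (@sums_le _ _ _ _ (fun k => M k / r ^+ 2 * (`|v| ^+ 2 * s ^+ 2)) _ S) => [k|K].
  rewrite scaleN1r scaleNr -DZ; have [_ _ q] := pser_diff (pf k) r0' xr'.
  by have := q _ svr; rewrite normrZ gtr0_norm // exprMn [s ^+ 2 * _]mulrC.
rewrite -!mulr_suml mulrA; apply: ler_wpM2r; first by rewrite exprn_ge0 // ltW.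
apply: ler_wpM2r; first by rewrite exprn_ge0.
by apply: ler_wpM2r => //; rewrite invr_ge0 exprn_ge0 // ltW.
Qed.

Lemma pser_line X rho (x v : X) : 0 < rho ->
  pser rho (`|x| + rho * `|v|) (fun s : R => x + s *: v).
Proof.
move=> r0; apply: pserD; first exact: pser_const.
rewrite mulrC; have vl : linear (fun s : R => s *: v).
  by move=> k s t; rewrite scalerDl scalerA.
pose L : {linear R -> X} := HB.pack (fun s : R => s *: v)
  (GRing.isLinear.Build _ _ _ _ _ vl).
by apply: (@pser_linear _ _ _ _ _ L) => // s; rewrite normrZ mulrC.
Qed.

Definition plug X (S : pred nat) (w : nat -> X) (x : X) : nat -> X :=
  fun i => if S i then w i else x.

Lemma pser_plug X (Z : completeNormedModType R) rho n c (a : (nat -> X) -> Z)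
    (S : pred nat) (w : nat -> X) :
  0 < rho -> form n c a ->
  pser rho (c * \prod_(i < n) (if S i then `|w i| else rho))
    (fun x => a (plug S w x)).
Proof.
move=> r0 fa.
apply: (pser_form (M := fun i => if S i then `|w i| else rho)
  (g := fun i x => plug S w x i)) => // i _.
by rewrite /plug; case: (S i); [exact: pser_const|exact: pser_id].
Qed.

(** Leibniz rule: the increment of the form telescopes over the arguments, and
    each term is, up to a quadratic error, linear in the increment of one
    argument. *)
Lemma diff_plug X (Z : completeNormedModType R) n c (a : (nat -> X) -> Z) S w x v :
  form n c a ->
  D (fun x => a (plug S w x)) x v =
    \sum_(i < n | ~~ S i) a (upd (plug S w x) i v).
Proof.
move=> fa; have x1 : 0 < `|x| + 1 by rewrite ltr_wpDl.
pose phi i (s : R) := a (upd (mix (plug S w (x + s *: v)) (plug S w x) i) i v).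
have phi0 i : phi i 0 = a (upd (plug S w x) i v).
  congr a; rewrite scale0r addr0; apply/funext => j.
  by rewrite /upd /mix; case: ifP => // _; case: ifP.
have /choice[M HM] : forall i, exists M, pser 1 M (phi i).
  move=> i; pose g j (s : R) := upd (mix (plug S w (x + s *: v)) (plug S w x) i) i v j.
  suff /choice[M HM] : forall j, exists M, pser 1 M (g j).
    by eexists; exact: (pser_form ltr01 fa (fun j _ => HM j)).
  move=> j; rewrite /g /upd /mix /plug.
  case: (j == i); first by eexists; exact: pser_const.
  case: (j < i)%N; last by eexists; exact: pser_const.
  case: (S j); first by eexists; exact: pser_const.
  by eexists; exact: pser_line.
apply: (pser_dir (C := \sum_(i < n | ~~ S i) 2 * M i)
  (pser_plug S w x1 fa) _ ltr01) => [|s s0 s1]; first by rewrite ltrDl.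
rewrite (form_telescope _ _ fa).
have -> : \sum_(i < n) a (upd (mix (plug S w (x + s *: v)) (plug S w x) i) i
    (plug S w (x + s *: v) i - plug S w x i)) = \sum_(i < n | ~~ S i) s *: phi i s.
  rewrite [RHS]big_mkcond; apply: eq_bigr => i _; rewrite /plug; case: (S i) => /=.
    by rewrite subrr (form_lin0 _ fa).
  have -> : x + s *: v - x = s *: v by rewrite addrC addKr.
  by rewrite (form_linZ _ _ _ fa (ltn_ord i)).
rewrite scaler_sumr -sumrB mulr_suml; apply: (le_trans (ler_norm_sum _ _ _)).
apply: ler_sum => i _; rewrite -phi0 -scalerBr normrZ gtr0_norm // expr2 mulrA mulrC.
apply: ler_wpM2r; first exact: ltW.
have [_ b q] := pser_diff0 (HM i).
have s1' : `|s| <= 1 by rewrite gtr0_norm.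
have := q s s1'; have := b s; rewrite expr1n !divr1 gtr0_norm // => b1 q1.
have -> : phi i s - phi i 0 = (phi i s - phi i 0 - D (phi i) 0 s) + D (phi i) 0 s by rewrite subrK.
apply: (le_trans (ler_normD _ _)); rewrite mulr2n mulrDl mulrDl mul1r; apply: lerD => //.
apply: (le_trans q1); apply: ler_wpM2l; first exact: pser_ge0 (HM i).
by rewrite expr2 -[leRHS]mulr1; apply: ler_wpM2l => //; exact: ltW.
Qed.

(** The factor n lost by differentiating a term of degree n is absorbed by the
    passage from the radius r to s. *)
Lemma geom_deriv_bd n (s r : R) : 0 <= s -> s < r ->
  n%:R * s ^+ n.-1 * (r - s) <= r ^+ n.
Proof.
move=> s0 sr; case: n => [|n] /=; first by rewrite mul0r expr0 mul0r.
have := subrXX r s n.+1; move=> e.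
suff : n.+1%:R * s ^+ n * (r - s) <= r ^+ n.+1 - s ^+ n.+1.
  by move=> /le_trans; apply; rewrite gerBl exprn_ge0.
rewrite e [leRHS]mulrC; apply: ler_wpM2r; first by rewrite subr_ge0 ltW.
rewrite mulr_natl -{1}[n.+1]card_ord -sumr_const; apply: ler_sum => i _.
rewrite /= -{1}(subnK (ltnSE (ltn_ord i))) exprD; apply: ler_wpM2r.
  exact: exprn_ge0.
by apply: lerXn2r; rewrite ?nnegrE // ltW // (le_lt_trans s0).
Qed.

(** The n-th term of the derivative at x in the direction v of the power series
    with coefficients a. *)
Definition dterm X Y (a : nat -> (nat -> X) -> Y) n (x v : X) : Y :=
  \sum_(i < n) a n (upd (fun=> x) i v).

Lemma pser_sums_diff X (Y : completeNormedModType R) rho C (f : X -> Y)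
    (a : nat -> (nat -> X) -> Y) (c : nat -> R) x v : 0 < rho ->
  (forall n, form n (c n) (a n)) -> (forall N, \sum_(n < N) c n * rho ^+ n <= C) ->
  (forall h, `|h| <= rho -> sums (fun n => a n (fun=> h)) (f h)) ->
  `|x| < rho -> sums (fun n => dterm a n x v) (D f x v).
Proof.
move=> r0 fa cC af xr.
have := pser_series_diff (v := v) r0 (fun n => pser_monomial r0 (fa n)) cC af xr.
apply: eq_sums => n.
exact: (diff_plug pred0 (fun=> 0) x v (fa n)).
Qed.

Lemma pser_sum W Y rho n (M : nat -> R) (f : nat -> W -> Y) : 0 < rho ->
  (forall i, (i < n)%N -> pser rho (M i) (f i)) ->
  pser rho (\sum_(i < n) M i) (fun x => \sum_(i < n) f i x).
Proof.
move=> r0; elim: n => [_|n IH H].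
  rewrite big_ord0 -(normr0 Y); apply: pser_ext (pser_const W 0 r0) => h _.
  by rewrite big_ord0.
rewrite big_ord_recr /=.
apply: (@pser_ext _ _ _ _ _ (fun x => \sum_(i < n) f i x + f n x)).
  by move=> h _; rewrite big_ord_recr.
by apply: pserD; [apply: IH => i /ltnW|]; exact: H.
Qed.

Lemma pser_dterm W X (Y : completeNormedModType R) n c s K tau
    (a : nat -> (nat -> X) -> Y) (g G : W -> X) :
  form n c (a n) -> pser tau s g -> pser tau K G ->
  pser tau (c * (n%:R * s ^+ n.-1 * K)) (fun w => dterm a n (g w) (G w)).
Proof.
move=> fa pg pG; have t0 := pser_gt0 pg.
have -> : n%:R * s ^+ n.-1 * K = \sum_(i < n) \prod_(j < n) upd (fun=> s) i K j.
  rewrite -mulrA -[in LHS](card_ord n) mulr_natl -sumr_const.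
  apply: eq_bigr => i _; rewrite (bigD1 i) //= upd_same mulrC; congr (_ * _).
  rewrite (eq_bigr (fun=> s)); first by rewrite prodr_const cardC1 card_ord.
  by move=> j ji; rewrite /upd (negbTE (_ : (j : nat) != i)).
rewrite mulr_sumr.
apply: (@pser_sum _ _ _ _ (fun i => c * \prod_(j < n) upd (fun=> s) i K j)
  (fun i w => a n (upd (fun=> g w) i (G w)))) => // i iN.
apply: (pser_form (M := upd (fun=> s) i K) (g := fun j w => upd (fun=> g w) i (G w) j)) => // j _.
by rewrite /upd; case: (j == i).
Qed.

Lemma dterm_bd (c : nat -> R) M rho s K : (forall n, 0 <= c n) ->
  (forall N, \sum_(n < N) c n * rho ^+ n <= M) -> 0 <= s -> s < rho -> 0 <= K ->
  forall N, \sum_(n < N) c n * (n%:R * s ^+ n.-1 * K) <= M * K / (rho - s).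
Proof.
move=> c0 cM s0 sr K0 N; have rs : 0 < rho - s by rewrite subr_gt0.
apply: (@le_trans _ _ (\sum_(n < N) c n * rho ^+ n * (K / (rho - s)))); last first.
  rewrite -mulr_suml -mulrA; apply: ler_wpM2r => //.
  by rewrite divr_ge0 // ltW.
apply: ler_sum => n _; rewrite -[leRHS]mulrA; apply: ler_wpM2l => //.
rewrite mulrA ler_pdivlMr // mulrAC; apply: ler_wpM2r => //.
exact: geom_deriv_bd.
Qed.

(** Cauchy's estimate: differentiation costs a factor 1 / (rho - s). *)
Lemma pser_deriv W X (Y : completeNormedModType R) rho M s K tau (f : X -> Y)
    (g G : W -> X) : pser rho M f -> s < rho -> pser tau s g -> pser tau K G ->
  pser tau (M * K / (rho - s)) (fun w => D f (g w) (G w)).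
Proof.
move=> [r0 [a [c [fa cM af]]]] sr pg pG.
apply: (@pser_series _ _ _ _ _ (fun n => c n * (n%:R * s ^+ n.-1 * K))
  (fun n w => dterm a n (g w) (G w))) => [|n|N|h ht].
- exact: pser_gt0 pg.
- exact: pser_dterm.
- apply: dterm_bd => // [n||]; first exact: form_ge0 (fa n).
    exact: pser_ge0 pg.
  exact: pser_ge0 pG.
- apply: (pser_sums_diff r0 fa cM af); apply: le_lt_trans sr.
  exact: pser_bd pg ht.
Qed.

Lemma diff_bigsum X Y n (f : nat -> X -> Y) x v :
  (forall i, (i < n)%N -> differentiable (f i) x) ->
  differentiable (fun y => \sum_(i < n) f i y) x /\
  D (fun y => \sum_(i < n) f i y) x v = \sum_(i < n) D (f i) x v.
Proof.
elim: n => [_|n IH H].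
  rewrite big_ord0 (_ : (fun y => _) = cst 0); last first.
    by apply/funext => y; rewrite big_ord0.
  by split; [exact: differentiable_cst|rewrite /D diff_cst].
rewrite (_ : (fun y => _) = (fun y => \sum_(i < n) f i y) + f n); last first.
  by apply/funext => y; rewrite big_ord_recr.
have [d1 e1] := IH (fun i iN => H i (ltnW iN)).
by split; [exact: differentiableD (H n _)|have d2 := H n (ltnSn n); rewrite big_ord_recr -e1 /D diffD].
Qed.

(** Differentiating the terms twice replaces two of their arguments by u and v,
    in all possible ways; exchanging the two arguments exchanges u and v. *)
Lemma pser_diff2C X (Y : completeNormedModType R) rho M (f : X -> Y) x u v :
  pser rho M f -> `|x| < rho ->
  D (fun y => D f y u) x v = D (fun y => D f y v) x u.
Proof.
move=> [r0 [a [c [fa cM af]]]] xr.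
pose s := (`|x| + rho) / 2.
have [xs sr] : `|x| < s /\ s < rho by rewrite /s; split; lra.
have s0 : 0 < s by exact: le_lt_trans xs.
have rs : 0 < rho - s by rewrite subr_gt0.
have c0 n : 0 <= c n := form_ge0 (fa n).
pose E2 u v n : Y := \sum_(i < n) \sum_(j < n | (j : nat) != i) a n (upd (upd (fun=> x) i u) j v).
have EC n : E2 u v n = E2 v u n.
  rewrite /E2; under eq_bigr do rewrite big_mkcond; rewrite exchange_big /=.
  apply: eq_bigr => i _; rewrite [RHS]big_mkcond; apply: eq_bigr => j _.
  by rewrite eq_sym; case: eqP => //= /eqP ji; rewrite updC // eq_sym.
suff key w w' : sums (E2 w w') (D (fun y => D f y w) x w').
  by apply: (sums_unique (key u v)); have := key v u; apply: eq_sums => n.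
have plugE y i : upd (fun=> y) i w = plug (pred1 i) (fun=> w) y.
  by apply/funext => j; rewrite /upd /plug.
have pt n : pser s (c n * (n%:R * s ^+ n.-1 * `|w|)) (fun y => dterm a n y w).
  by apply: pser_dterm => //; [exact: pser_id|exact: pser_const].
have bd := dterm_bd c0 cM (ltW s0) sr (normr_ge0 w).
have sm h : `|h| <= s -> sums (fun n => dterm a n h w) (D f h w).
  by move=> hs; apply: (pser_sums_diff r0 fa cM af); exact: le_lt_trans sr.
have := pser_series_diff (v := w') s0 pt bd sm xs; apply: eq_sums => n.
have pi i : (i < n)%N -> differentiable (fun y => a n (upd (fun=> y) i w)) x.
  move=> iN; under eq_fun do rewrite plugE.
  have xr0 : 0 < rho - `|x| by rewrite subr_gt0.
  have xr1 : `|x| + (rho - `|x|) <= rho by rewrite addrC subrK.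
  by have [] := pser_diff (pser_plug (pred1 i) (fun=> w) r0 (fa n)) xr0 xr1.
have [_ ->] := diff_bigsum w' pi; apply: eq_bigr => i _.
under eq_fun do rewrite plugE.
by rewrite (diff_plug _ _ _ _ (fa n)) /=; under eq_bigr do rewrite -plugE.
Qed.

End Differentiation.

(** * Analytic maps *)

HB.saturate prod.

Section CompletePair.
Context (R : realType) (X Y : completeNormedModType R).

Let pair_complete (F : set_system (X * Y)%type) :
  ProperFilter F -> cauchy F -> [cvg F in (X * Y)%type].
Proof.
move=> FF /cauchy_ballP Fc.
have F1 : cvg (fst @ F).
  apply: cauchy_cvg; apply/cauchy_ballP => e e0.
  have [[A B] [/= FA FB] AB] := Fc e e0; exists (fst @` A, fst @` B).
    by split; [move: FA|move: FB]; apply: filterS => p Ap; exists p.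
  by move=> [_ _] [/= [p Ap <-] [q Bq <-]]; have [] := AB (p, q) (conj Ap Bq).
have F2 : cvg (snd @ F).
  apply: cauchy_cvg; apply/cauchy_ballP => e e0.
  have [[A B] [/= FA FB] AB] := Fc e e0; exists (snd @` A, snd @` B).
    by split; [move: FA|move: FB]; apply: filterS => p Ap; exists p.
  by move=> [_ _] [/= [p Ap <-] [q Bq <-]]; have [] := AB (p, q) (conj Ap Bq).
apply/cvg_ex; exists (lim (fst @ F), lim (snd @ F)).
apply/cvg_ballP => e e0.
have /cvg_ballP/(_ e e0) h1 := F1; have /cvg_ballP/(_ e e0) h2 := F2.
have {}h1 : \forall p \near F, ball (lim (fst @ F)) e p.1 by exact: h1.
have {}h2 : \forall p \near F, ball (lim (snd @ F)) e p.2 by exact: h2.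
by near=> p; split; [near: p; exact: h1|near: p; exact: h2].
Unshelve. all: by end_near. Qed.

HB.instance Definition _ := Uniform_isComplete.Build (X * Y)%type pair_complete.
End CompletePair.

Section Analytic.
Context (R : realType).
Implicit Types U V W X Y Z : normedModType R.

Lemma near_near (T : topologicalType) (x : T) (P : T -> Prop) :
  (\forall y \near x, P y) -> \forall z \near x, \forall y \near z, P y.
Proof. by move=> /nbhs_interior. Qed.

(** The bounds M / r^n on the coefficients are summable on every smaller ball;
    conversely, the terms of a convergent series of nonnegative numbers are
    bounded by its sum. *)
Lemma analytic_atP X Y (f : X -> Y) x :
  analytic_at f x <-> exists rho M, pser rho M (fun h => f (x + h)).
Proof.
split=> [[a [M [r [r0 aL aM ar]]]]|[rho [M [r0 [a [c [fa cM af]]]]]]].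
  move/nbhs_ballP: ar => [e /= e0 er].
  pose rho := Num.min (r / 2) (e / 2).
  have rho0 : 0 < rho by rewrite lt_min !divr_gt0.
  have M0 : 0 <= M.
    by have := aM 0%N (fun=> 0); rewrite expr0 mulr1 big_ord0 mulr1; exact: le_trans.
  exists rho, (2 * M); split=> //.
  exists (fun n v => a n (fun i : 'I_n => v i)), (fun n => M * r^-1 ^+ n).
  split=> [n|N|h hr].
  - split=> [|v w vw|v i iN|v].
    + by rewrite mulr_ge0 // exprn_ge0 // invr_ge0 ltW.
    + by congr (a n); apply/funext => i; exact: vw.
    + have H := aL n (fun j : 'I_n => v j) (Ordinal iN).
      move=> k s t; have := H k s t.
      by congr (_ = _ *: _ + _); congr (a n); apply/funext => j; rewrite /upd.
    + exact: aM.
  - apply: (@le_trans _ _ (\sum_(n < N) M * 2^-1 ^+ n)).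
      apply: ler_sum => n _; rewrite -mulrA -exprMn; apply: ler_wpM2l => //.
      have r1 : 0 <= r^-1 * rho by rewrite mulr_ge0 // ?invr_ge0 ltW.
      apply: lerXn2r; rewrite ?nnegrE ?invr_ge0 //.
      by rewrite ler_pdivrMl // ge_min lexx.
    rewrite -mulr_sumr mulrC; apply: ler_wpM2r => //.
    have half0 : 0 < (2^-1 : R) by rewrite invr_gt0.
    suff -> : \sum_(n < N) 2^-1 ^+ n = 2 - 2 * 2^-1 ^+ N :> R.
      by rewrite gerBl mulr_ge0 // exprn_ge0 // ltW.
    elim: N => [|N IH]; first by rewrite big_ord0 expr0 mulr1 subrr.
    by rewrite big_ord_recr /= IH exprS mulrA divff // mul1r; lra.
  - apply: er; rewrite -ball_normE /= sub0r normrN; apply: (le_lt_trans hr).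
    have e2 : e / 2 < e by lra.
    by rewrite gt_min e2 orbT.
exists (fun n (v : 'I_n -> X) => a n (fun k => if insub k is Some i then v i else 0)).
exists M, rho; split=> // [n v i|n v|].
- have E t : a n (fun k => if insub k is Some j then (if j == i then t else v j) else 0) =
     a n (upd (fun k => if insub k is Some j then v j else 0) i t).
    apply: (form_ext (fa n)) => k kn; rewrite /upd insubT /=.
    by rewrite -val_eqE.
  by move=> k s t; rewrite !E (form_lin (fa n)).
- apply: (le_trans (form_bd (fa n) _)).
  rewrite (eq_bigr (fun i => `|v i|)); last by move=> i _; rewrite valK.
  apply: ler_wpM2r; first by rewrite prodr_ge0.
  rewrite exprVn ler_pdivlMr ?exprn_gt0 //; apply: le_trans (cM n.+1).
  rewrite big_ord_recr /= lerDr; apply: sumr_ge0 => i _.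
  by rewrite mulr_ge0 ?(form_ge0 (fa _)) // exprn_ge0 // ltW.
- near=> h.
  have hr : `|h| <= rho by near: h; exact: nbhs0_le.
  have := af h hr; apply: eq_sums => n; apply: (form_ext (fa n)) => k kn.
  by rewrite insubT.
Unshelve. all: by end_near. Qed.

Lemma pser_analytic X Y rho M (f : X -> Y) : pser rho M f -> analytic_at f 0.
Proof.
move=> pf; apply/analytic_atP; exists rho, M; apply: pser_ext pf => h _.
by rewrite add0r.
Qed.

Lemma analytic_pser X Y (f : X -> Y) : analytic_at f 0 -> exists rho M, pser rho M f.
Proof.
move=> /analytic_atP[rho [M pf]]; exists rho, M; apply: pser_ext pf => h _.
by rewrite add0r.
Qed.

Lemma analytic_shift X Y (f : X -> Y) x :
  analytic_at f x <-> analytic_at (fun h => f (x + h)) 0.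
Proof.
split=> [/analytic_atP[r [M pf]]|/analytic_pser[r [M pf]]].
  exact: pser_analytic pf.
by apply/analytic_atP; exists r, M.
Qed.

Lemma analytic_ext X Y (f g : X -> Y) x : (\forall y \near x, f y = g y) ->
  analytic_at f x -> analytic_at g x.
Proof.
move=> /nbhs0P/nbhs_ballP[e /= e0 fg] /analytic_atP[r [M pf]].
have r0 := pser_gt0 pf.
apply/analytic_atP; exists (Num.min r (e / 2)), M.
have s0 : 0 < Num.min r (e / 2) by rewrite lt_min r0 divr_gt0.
apply: pser_ext (pser_le s0 _ (lexx _) pf) => [h hr|]; last by rewrite ge_min lexx.
apply: fg; rewrite -ball_normE /= sub0r normrN; apply: (le_lt_trans hr).
have e2 : e / 2 < e by lra.
    by rewrite gt_min e2 orbT.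
Qed.

Lemma pser_analytic_in X (Y : completeNormedModType R) rho M (f : X -> Y) x :
  pser rho M f -> `|x| < rho -> analytic_at f x.
Proof.
move=> pf xr; apply/analytic_atP; exists (rho - `|x|), M.
by apply: pser_shift pf _ _; rewrite ?subr_gt0 // addrC subrK.
Qed.

Lemma analytic_near X (Y : completeNormedModType R) (f : X -> Y) x :
  analytic_at f x -> \forall y \near x, analytic_at f y.
Proof.
move=> /analytic_atP[r [M pf]]; have r0 := pser_gt0 pf.
apply/nbhs0P; near=> h.
have hr : `|h| < r by near: h; exact: nbhs0_lt.
have /analytic_shift := pser_analytic_in pf hr; move=> Hh; apply/analytic_shift.
by move: Hh; apply: analytic_ext; apply: nearW => y; rewrite addrA.
Unshelve. all: by end_near. Qed.

Lemma D_shift_diff X Y (f : X -> Y) x h : differentiable (fun h => f (x + h)) h ->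
  differentiable f (x + h) /\ forall v, D f (x + h) v = D (fun h => f (x + h)) h v.
Proof.
move=> df; pose t := (fun y : X => y - x).
have tE : t (x + h) = h by rewrite /t addrC addKr.
have dt : is_diff (x + h) t (@idfun X).
  rewrite (_ : t = (@idfun X) + cst (- x)) //.
  by rewrite -[X in is_diff _ _ X]addr0; exact: is_diffD.
have fE : f = (fun h => f (x + h)) \o t by apply/funext => y; rewrite /t /= addrC subrK.
have df' : differentiable (fun h => f (x + h)) (t (x + h)) by rewrite tE.
have dt' := @ex_diff _ _ _ _ _ _ _ dt.
split=> [|v]; first by rewrite fE; exact: differentiable_comp.
by rewrite /D {1}fE diff_comp // tE (@diff_val _ _ _ _ _ _ _ dt).
Qed.

Lemma analytic_diff X Y (f : X -> Y) x : analytic_at f x -> differentiable f x.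
Proof.
move=> /analytic_atP[r [M pf]]; have [df _ _] := pser_diff0 pf.
by have [] := D_shift_diff df; rewrite addr0.
Qed.

Lemma analytic_continuous X Y (f : X -> Y) x : analytic_at f x -> {for x, continuous f}.
Proof. by move=> /analytic_diff/differentiable_continuous. Qed.

Lemma analytic_comp X Y (Z : completeNormedModType R) (f : X -> Y) (g : Y -> Z) x :
  analytic_at f x -> analytic_at g (f x) -> analytic_at (fun x => g (f x)) x.
Proof.
move=> af /analytic_atP[s [N pg]]; have s0 := pser_gt0 pg.
have fc := analytic_continuous af.
move/analytic_atP: (af) => [r [M pf]]; have r0 := pser_gt0 pf.
have M0 := pser_ge0 pf.
(* the increment of f vanishes at 0, so its norm is at most s on a small ball *)
have [t [t0 pf']] : exists t, 0 < t /\ pser t s (fun h => f (x + h) - f x).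
  have [_ [a [c [fa cM ca]]]] := pf.
  have M1 : 0 < M + 1 by rewrite ltr_wpDl.
  pose th := Num.min 1 (s / (M + 1)); pose t := th * r.
  have th0 : 0 < th by rewrite lt_min ltr01 divr_gt0.
  have th1 : th <= 1 by rewrite ge_min lexx.
  have t0 : 0 < t by rewrite mulr_gt0.
  exists t; split=> //; split=> //.
  exists (fun n => if n is 0 then fun=> 0 else a n), (fun n => if n is 0 then 0 else c n).
  split=> [[|n]|N'|h ht]; first exact: form0.
  - exact: fa.
  - apply: (@le_trans _ _ (th * \sum_(n < N') c n * r ^+ n)).
      rewrite mulr_sumr; apply: ler_sum => -[[|n] /= _] _.
        rewrite mul0r; apply: mulr_ge0; first exact: ltW.
        by apply: mulr_ge0; first exact: form_ge0 (fa _).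
      rewrite mulrCA; apply: ler_wpM2l; first exact: form_ge0 (fa _).
      rewrite /t exprMn; apply: ler_wpM2r; first by rewrite exprn_ge0 // ltW.
      by rewrite exprS ler_piMr ?(ltW th0) // exprn_ile1 // ltW.
    apply: (@le_trans _ _ (th * (M + 1))).
      apply: ler_wpM2l; first exact: ltW.
      by apply: (le_trans (cM _)); rewrite lerDl.
    by rewrite -ler_pdivlMr // ge_min lexx orbT.
  - have hr : `|h| <= r by apply: (le_trans ht); rewrite ler_piMl // ltW.
    have f0 : f x = a 0%N (fun=> h).
      have S0 : sums (fun n => a n (fun=> 0)) (f x).
        by have := ca 0; rewrite normr0 addr0; apply; exact: ltW.
      apply: (sums_unique S0).
      rewrite (_ : a 0%N _ = \sum_(k < 1) a k (fun=> 0)); last first.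
        by rewrite big_ord1; apply: (form_ext (fa 0%N)).
      apply: sums_fin => -[//|n _].
      by rewrite -(upd_id (fun=> 0) 0) (form_lin0 _ (fa n.+1)).
    have S1 : sums (fun n => if n is 0 then - f x else 0) (- f x).
      have := @sums_fin _ _ (fun n => if n is 0 then - f x else 0) 1%N.
      by rewrite big_ord1; apply=> -[].
    have := sumsD (ca h hr) S1; apply: eq_sums => -[|n]; last by rewrite addr0.
    by rewrite -f0 subrr.
apply/analytic_atP; exists t, N.
have := pser_comp pg pf'; apply: pser_ext => h _.
by rewrite addrC subrK.
Qed.

Lemma analytic_cst X Y (y : Y) (x : X) : analytic_at (fun=> y) x.
Proof. by apply/analytic_atP; exists 1, `|y|; exact: pser_const. Qed.

Lemma linear_analytic X Y (L : {linear X -> Y}) x : continuous L -> analytic_at L x.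
Proof.
move=> /linear_lipschitz[k k0 Lk]; apply/analytic_atP; exists 1, (`|L x| + k * 1).
under eq_fun do rewrite linearD.
by apply: pserD; [exact: pser_const|apply: pser_linear => //; exact: ltW].
Qed.

Lemma analytic_id X (x : X) : analytic_at id x.
Proof. by apply: (@linear_analytic X X idfun) => y; exact: cvg_id. Qed.

Lemma analyticD X Y (f g : X -> Y) x : analytic_at f x -> analytic_at g x ->
  analytic_at (fun x => f x + g x) x.
Proof.
move=> /analytic_atP[r [M pf]] /analytic_atP[s [N pg]]; apply/analytic_atP.
have r0 := pser_gt0 pf; have s0 := pser_gt0 pg.
have t0 : 0 < Num.min r s by rewrite lt_min r0.
exists (Num.min r s), (M + N); apply: pserD.
  by apply: (pser_le t0 _ _ pf); rewrite // ge_min lexx.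
by apply: (pser_le t0 _ _ pg); rewrite // ge_min lexx orbT.
Qed.

Lemma analytic_comp_linear X Y Z (f : X -> Y) (L : {linear Y -> Z}) x :
  continuous L -> analytic_at f x -> analytic_at (fun x => L (f x)) x.
Proof.
move=> /linear_lipschitz[k k0 Lk] /analytic_atP[r [M pf]]; apply/analytic_atP.
by exists r, (k * M); apply: pser_comp_linear => //; exact: ltW.
Qed.

Lemma analyticN X Y (f : X -> Y) x : analytic_at f x ->
  analytic_at (fun x => - f x) x.
Proof.
by move=> /analytic_atP[r [M pf]]; apply/analytic_atP; exists r, M; exact: pserN.
Qed.

Lemma analyticB X Y (f g : X -> Y) x : analytic_at f x -> analytic_at g x ->
  analytic_at (fun x => f x - g x) x.
Proof. by move=> af /analyticN; exact: analyticD. Qed.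

Lemma analyticZ X Y (k : R) (f : X -> Y) x : analytic_at f x ->
  analytic_at (fun x => k *: f x) x.
Proof.
apply: (@analytic_comp_linear _ _ _ f ( *:%R k)).
by move=> y; apply: cvgZl_tmp; exact: cvg_id.
Qed.

Lemma analytic_pair X Y Z (f : X -> Y) (g : X -> Z) x :
  analytic_at f x -> analytic_at g x -> analytic_at (fun x => (f x, g x)) x.
Proof.
move=> af ag.
have l1 : linear (fun y : Y => (y, 0) : (Y * Z)%type).
  by move=> k s t; congr (_, _) => /=; rewrite scaler0 addr0.
have l2 : linear (fun z : Z => (0, z) : (Y * Z)%type).
  by move=> k s t; congr (_, _) => /=; rewrite scaler0 addr0.
pose L1 : {linear Y -> (Y * Z)%type} := HB.pack (fun y : Y => (y, 0) : (Y * Z)%type)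
  (GRing.isLinear.Build _ _ _ _ _ l1).
pose L2 : {linear Z -> (Y * Z)%type} := HB.pack (fun z : Z => (0, z) : (Y * Z)%type)
  (GRing.isLinear.Build _ _ _ _ _ l2).
have c1 : continuous L1 by move=> y; apply: cvg_pair => //; exact: cvg_cst.
have c2 : continuous L2 by move=> y; apply: cvg_pair => //; exact: cvg_cst.
have := analyticD (analytic_comp_linear c1 af) (analytic_comp_linear c2 ag).
apply: analytic_ext; apply: nearW => y; congr (_, _) => /=; by rewrite ?addr0 ?add0r.
Qed.

Lemma analytic_fst X Y (p : X * Y) : analytic_at fst p.
Proof. by apply: (@linear_analytic _ _ fst) => q; exact: cvg_fst. Qed.

Lemma analytic_snd X Y (p : X * Y) : analytic_at snd p.
Proof. by apply: (@linear_analytic _ _ snd) => q; exact: cvg_snd. Qed.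

Lemma analytic_scale X (Y : completeNormedModType R) (t : X -> R) (f : X -> Y) x :
  analytic_at t x -> analytic_at f x -> analytic_at (fun x => t x *: f x) x.
Proof.
move=> at_ af.
have fb : form 2 1 (fun v : nat -> (R * Y)%type => (v 0%N).1 *: (v 1%N).2).
  split=> // [v w vw|v [|[|//]] _ k s u|v]; first by rewrite !vw.
  - by rewrite /upd /= scalerDl scalerA.
  - by rewrite /upd /= scalerDr !scalerA mulrC.
  - rewrite mul1r !big_ord_recr big_ord0 /= mul1r normrZ.
    by apply: ler_pM => //; rewrite prod_normE le_max lexx ?orbT.
have /analytic_atP[r [M pf]] := analytic_pair at_ af.
apply/analytic_atP; exists r, (1 * \prod_(i < 2) M).
exact: (pser_form (pser_gt0 pf) fb (fun _ _ => pf)).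
Qed.

Lemma DD X Y (f : X -> Y) x u v : D f x (u + v) = D f x u + D f x v.
Proof. exact: linearD. Qed.

Lemma DN X Y (f : X -> Y) x v : D f x (- v) = - D f x v.
Proof. exact: linearN. Qed.

Lemma DB X Y (f : X -> Y) x u v : D f x (u - v) = D f x u - D f x v.
Proof. exact: linearB. Qed.

Lemma D0 X Y (f : X -> Y) x : D f x 0 = 0.
Proof. exact: linear0. Qed.

Lemma D_shift X Y (f : X -> Y) x h v : analytic_at (fun h => f (x + h)) h ->
  D f (x + h) v = D (fun h => f (x + h)) h v.
Proof. by move=> /analytic_diff/D_shift_diff[]. Qed.

Lemma D_near_eq X Y (f g : X -> Y) x v : analytic_at f x ->
  (\forall y \near x, f y = g y) -> D f x v = D g x v.
Proof.
move=> /analytic_diff df fg; have fgx : f x = g x by exact: nbhs_singleton fg.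
have o := diff_locally df.
suff e : 'd g x = 'd f x :> (X -> Y) by exact: esym (congr1 (@^~ v) e).
apply/diff_unique; first exact: diff_continuous.
apply/eqaddoP => e e0; move/eqaddoP: o => /(_ e e0) H.
have fg0 : \forall h \near 0, f (h + x) = g (h + x).
  by move/nbhs0P: fg; apply: filterS => h; rewrite addrC.
near=> h; have E : f (h + x) = g (h + x) by near: h.
have : `|(f \o shift x - (cst (f x) + 'd f x)) h| <= e * `|h| by near: h; exact: H.
by rewrite -[X in `|X| <= _]/(f (h + x) - (f x + 'd f x h)) E fgx.
Unshelve. all: by end_near. Qed.

Lemma D_comp X Y Z (f : X -> Y) (g : Y -> Z) x v :
  analytic_at f x -> analytic_at g (f x) ->
  D (fun x => g (f x)) x v = D g (f x) (D f x v).
Proof.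
by move=> /analytic_diff df /analytic_diff dg; rewrite /D (diff_comp df dg).
Qed.

Lemma D_pair X Y Z (f : X -> Y) (g : X -> Z) x v :
  analytic_at f x -> analytic_at g x ->
  D (fun y => (f y, g y)) x v = (D f x v, D g x v).
Proof.
by move=> /analytic_diff df /analytic_diff dg; rewrite /D (diff_pair df dg).
Qed.

Lemma D_add X Y (f g : X -> Y) x v : analytic_at f x -> analytic_at g x ->
  D (fun y => f y + g y) x v = D f x v + D g x v.
Proof. by move=> /analytic_diff df /analytic_diff dg; rewrite /D (diffD df dg). Qed.

Lemma D_cst X Y (y : Y) (x v : X) : D (fun=> y) x v = 0.
Proof. by rewrite /D (diff_cst y x). Qed.

Lemma D_lin X Y (L : {linear X -> Y}) x v : continuous L -> D L x v = L v.
Proof. by move=> Lc; rewrite /D (diff_lin x Lc). Qed.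

Lemma D_id X (x v : X) : D id x v = v.
Proof. by apply: (@D_lin X X idfun) => y; exact: cvg_id. Qed.

Lemma D_comp_lin X Y Z (f : X -> Y) (L : {linear Y -> Z}) x v : continuous L ->
  analytic_at f x -> D (fun y => L (f y)) x v = L (D f x v).
Proof.
move=> Lc af; rewrite (D_comp (g := L)) ?D_lin //; exact: linear_analytic.
Qed.

Lemma D_opp X Y (f : X -> Y) x v : analytic_at f x ->
  D (fun y => - f y) x v = - D f x v.
Proof. by move=> /analytic_diff df; rewrite /D (diffN df). Qed.

Lemma D_sub X Y (f g : X -> Y) x v : analytic_at f x -> analytic_at g x ->
  D (fun y => f y - g y) x v = D f x v - D g x v.
Proof. by move=> af ag; rewrite D_add ?D_opp //; exact: analyticN. Qed.

Lemma D_scale X Y (k : R) (f : X -> Y) x v : analytic_at f x ->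
  D (fun y => k *: f y) x v = k *: D f x v.
Proof. by move=> /analytic_diff df; rewrite /D (diffZ k df). Qed.

Lemma D_fst X Y (p v : X * Y) : D fst p v = v.1.
Proof. by apply: (@D_lin _ _ fst) => q; exact: cvg_fst. Qed.

Lemma D_snd X Y (p v : X * Y) : D snd p v = v.2.
Proof. by apply: (@D_lin _ _ snd) => q; exact: cvg_snd. Qed.

Lemma D_partial X Y Z (F : X * Y -> Z) x y h k : analytic_at F (x, y) ->
  D F (x, y) (h, k) = D (fun x => F (x, y)) x h + D (fun y => F (x, y)) y k.
Proof.
move=> aF.
have e1 : D (fun x => F (x, y)) x h = D F (x, y) (h, 0).
  rewrite (D_comp (f := fun x => (x, y))) //; last first.
    exact: analytic_pair (analytic_id x) (analytic_cst y x).
  by rewrite (D_pair _ (analytic_id x) (analytic_cst y x)) D_id D_cst.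
have e2 : D (fun y => F (x, y)) y k = D F (x, y) (0, k).
  rewrite (D_comp (f := fun y => (x, y))) //; last first.
    exact: analytic_pair (analytic_cst x y) (analytic_id y).
  by rewrite (D_pair _ (analytic_cst x y) (analytic_id y)) D_id D_cst.
by rewrite e1 e2 -DD; congr (D F _ (_, _)) => /=; rewrite ?addr0 ?add0r.
Qed.

(** This is a case of Cauchy's estimate, for the base point z.1 and the
    direction v + z.2, both power series in z. *)
Lemma analytic_tangent X (Y : completeNormedModType R) (f : X -> Y) x v :
  analytic_at f x -> analytic_at (fun z : X * X => D f z.1 z.2) (x, v).
Proof.
move=> /analytic_atP[r [M pf]]; have r0 := pser_gt0 pf.
have s0 : 0 < r / 2 by rewrite divr_gt0.
have sr : r / 2 < r by lra.
have p1 : pser (r / 2) (r / 2) (fun z : X * X => z.1).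
  rewrite -[X in pser _ X _]mul1r; apply: (@pser_linear _ _ _ _ _ fst) => // z.
  by rewrite mul1r prod_normE le_max lexx.
have p2 : pser (r / 2) (`|v| + r / 2) (fun z : X * X => v + z.2).
  apply: pserD; first exact: pser_const.
  rewrite -[X in pser _ X _]mul1r; apply: (@pser_linear _ _ _ _ _ snd) => // z.
  by rewrite mul1r prod_normE le_max lexx orbT.
apply/analytic_atP; eexists _, _; have := pser_deriv pf sr p1 p2.
apply: pser_ext => z zr /=.
have zr' : `|z.1| < r.
  apply: le_lt_trans sr; apply: le_trans zr; by rewrite prod_normE le_max lexx.
by rewrite (D_shift _ (pser_analytic_in pf zr')).
Qed.

Lemma analytic_along W X (Y : completeNormedModType R) (f : X -> Y) (g G : W -> X) w :
  analytic_at f (g w) -> analytic_at g w -> analytic_at G w ->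
  analytic_at (fun w => D f (g w) (G w)) w.
Proof.
move=> af ag aG.
exact: (analytic_comp (analytic_pair ag aG) (analytic_tangent (G w) af)).
Qed.

Lemma analytic_dir X (Y : completeNormedModType R) (f : X -> Y) x v :
  analytic_at f x -> analytic_at (fun y => D f y v) x.
Proof.
by move=> af; apply: analytic_along => //; [exact: analytic_id|exact: analytic_cst].
Qed.

Lemma D2C X (Y : completeNormedModType R) (f : X -> Y) x u v :
  analytic_at f x -> D (fun y => D f y u) x v = D (fun y => D f y v) x u.
Proof.
move=> af; move/analytic_atP: (af) => [r [M pf]]; have r0 := pser_gt0 pf.
have d0 : `|0 : X| < r by rewrite normr0.
have E w w' : D (fun y => D f y w) x w' =
    D (fun h => D (fun h => f (x + h)) h w) 0 w'.
  have aw := analytic_dir w af; move/analytic_shift: (aw) => aw'.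
  rewrite -{1}[x]addr0 (D_shift _ aw'); apply: (D_near_eq _ aw'); near=> h.
  have hr : `|h| < r by near: h; exact: nbhs0_lt.
  exact: D_shift (pser_analytic_in pf hr).
by rewrite E (pser_diff2C u v pf d0) -E.
Unshelve. all: by end_near. Qed.

Lemma D_tangent X (Y : completeNormedModType R) (f : X -> Y) x v h k :
  analytic_at f x ->
  D (fun z : X * X => D f z.1 z.2) (x, v) (h, k) = D (fun y => D f y v) x h + D f x k.
Proof.
move=> af; rewrite D_partial /=; last exact: analytic_tangent.
congr (_ + _); apply: (@D_lin _ _ ('d f x)).
exact: diff_continuous (analytic_diff af).
Qed.

Lemma D_along X (Y : completeNormedModType R) W (f : X -> Y) (g G : W -> X) w h :
  analytic_at f (g w) -> analytic_at g w -> analytic_at G w ->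
  D (fun w => D f (g w) (G w)) w h =
  D (fun y => D f y (G w)) (g w) (D g w h) + D f (g w) (D G w h).
Proof.
move=> af ag aG.
rewrite (@D_comp _ _ _ (fun w => (g w, G w)) (fun z => D f z.1 z.2)).
- by rewrite D_pair // D_tangent.
- exact: analytic_pair.
- exact: analytic_tangent.
Qed.

Lemma D_bundle (V X Y : normedModType R) (f : V -> X -> Y) y u v w :
  (forall k u v, f y (k *: u + v) = k *: f y u + f y v) ->
  (forall u, analytic_at (fun p : V * X => f p.1 p.2) (y, u)) ->
  D (fun p : V * X => f p.1 p.2) (y, u) (v, w) = D (f^~ u) y v + f y w.
Proof.
move=> fl af; rewrite D_partial //=; congr (_ + _).
pose L : {linear X -> Y} := HB.pack (f y) (GRing.isLinear.Build _ _ _ _ _ fl).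
apply: (D_lin (L := L)) => z.
have /analytic_diff/differentiable_continuous /= fc := af z.
have pc : {for z, continuous (fun z : X => (y, z))}.
  by apply: cvg_pair; [exact: cvg_cst|exact: cvg_id].
exact: (@continuous_comp _ _ _ (fun z : X => (y, z)) (fun p => f p.1 p.2)).
Qed.

End Analytic.

(** * Holomorphic maps *)

Definition pair_lin (R : realType) (X X' Y Y' : normedModType R) (f : X -> X')
    (g : Y -> Y') (p : X * Y) : X' * Y' := (f p.1, g p.2).

Section PairLin.
Context (R : realType) (X X' Y Y' : normedModType R).
Context (f : {linear X -> X'}) (g : {linear Y -> Y'}).
Let pair_lin_linear : linear (pair_lin f g).
Proof. by move=> k s t; rewrite /pair_lin /= !linearP. Qed.
HB.instance Definition _ :=
  GRing.isLinear.Build R (X * Y)%type (X' * Y')%type _ (pair_lin f g) pair_lin_linear.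

Lemma pair_lin_continuous : continuous f -> continuous g -> continuous (pair_lin f g).
Proof.
move=> fc gc p; apply: cvg_pair.
  by apply: (@cvg_comp _ _ _ fst f); [exact: cvg_fst|exact: fc].
by apply: (@cvg_comp _ _ _ snd g); [exact: cvg_snd|exact: gc].
Qed.
End PairLin.

(** Complex spaces are represented by real ones with an operator I of
    multiplication by i, and complex analytic maps by real analytic maps whose
    differentials commute with these operators: on the same space several
    operators occur side by side, such as I and -I. *)
Definition holo (R : realType) (X Y : normedModType R) (I : X -> X) (J : Y -> Y)
    (f : X -> Y) (x : X) : Prop :=
  analytic_at f x /\ \forall y \near x, forall v, D f y (I v) = J (D f y v).

Section Holo.
Context (R : realType).
Implicit Types V W X Y Z : normedModType R.

(** If T is homogeneous in v, then a small multiple of v does as well as v; so a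
    neighbourhood of 0 that serves all small v serves all v. *)
Lemma near_homog (V X : normedModType R) (T : V -> X -> Prop) :
  (forall y (k : R) v, k != 0 -> T y (k *: v) -> T y v) ->
  (\forall p \near (0 : V * X), T p.1 p.2) ->
  \forall y \near 0, forall v, T y v.
Proof.
move=> TZ /nbhs_ballP[e /= e0 T0]; near=> y => v.
have v1 : 0 < `|v| + 1 by rewrite ltr_wpDl.
pose k := e / 2 / (`|v| + 1); have k0 : 0 < k by rewrite !divr_gt0.
apply: (TZ _ k); first by rewrite gt_eqF.
apply: (T0 (y, k *: v)); split; rewrite /= -ball_normE /= sub0r normrN.
  by near: y; exact: nbhs0_lt.
rewrite normrZ gtr0_norm //; apply: (@le_lt_trans _ _ (k * (`|v| + 1))).
  by apply: ler_wpM2l; [exact: ltW|rewrite lerDl].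
by rewrite /k divfK ?gt_eqF //; lra.
Unshelve. all: by end_near. Qed.

Lemma holo_near X (Y : completeNormedModType R) I J (f : X -> Y) x :
  holo I J f x -> \forall y \near x, holo I J f y.
Proof.
move=> [/analytic_near af /near_near hf].
by near=> y; split; near: y.
Unshelve. all: by end_near. Qed.

Lemma holo_lin X Y (I : X -> X) (J : Y -> Y) (L : {linear X -> Y}) x :
  continuous L -> (forall v, L (I v) = J (L v)) -> holo I J L x.
Proof.
move=> Lc LI; split; first exact: linear_analytic.
by apply: nearW => y v; rewrite !D_lin.
Qed.

Lemma holo_cst X Y (I : X -> X) (J : {linear Y -> Y}) y x : holo I J (fun _ : X => y) x.
Proof.
by split; [exact: analytic_cst|apply: nearW => z v; rewrite !D_cst linear0].
Qed.

Lemma near_comp X Y (f : X -> Y) x (P : Y -> Prop) : analytic_at f x ->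
  (\forall y \near f x, P y) -> \forall y \near x, P (f y).
Proof. by move=> /analytic_continuous fc; exact: fc. Qed.

Lemma holo_comp X (Y Z : completeNormedModType R) I J K (f : X -> Y) (g : Y -> Z) x :
  holo I J f x -> holo J K g (f x) -> holo I K (fun x => g (f x)) x.
Proof.
move=> [af hf] [ag hg]; split; first exact: analytic_comp.
have afn := analytic_near af.
have agn := near_comp af (analytic_near ag).
have hgn := near_comp af hg.
near=> y => v.
have a1 : analytic_at f y by near: y.
have a2 : analytic_at g (f y) by near: y.
have a3 : forall v, D f y (I v) = J (D f y v) by near: y.
have a4 : forall v, D g (f y) (J v) = K (D g (f y) v) by near: y.
by rewrite !(D_comp _ a1 a2) a3 a4.
Unshelve. all: by end_near. Qed.

Lemma holo_pair X (Y Z : completeNormedModType R) I J K (f : X -> Y) (g : X -> Z) x :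
  holo I J f x -> holo I K g x -> holo I (pair_lin J K) (fun x => (f x, g x)) x.
Proof.
move=> [af hf] [ag hg]; split; first exact: analytic_pair.
have afn := analytic_near af; have agn := analytic_near ag.
near=> y => v.
have a1 : analytic_at f y by near: y.
have a2 : analytic_at g y by near: y.
rewrite !(D_pair _ a1 a2) /pair_lin /=; congr (_, _).
  by move: v; near: y.
by move: v; near: y.
Unshelve. all: by end_near. Qed.

Lemma holoD X (Y : completeNormedModType R) I (J : {linear Y -> Y}) (f g : X -> Y) x :
  holo I J f x -> holo I J g x -> holo I J (fun x => f x + g x) x.
Proof.
move=> [af hf] [ag hg]; split; first exact: analyticD.
have afn := analytic_near af; have agn := analytic_near ag.
near=> y => v.
have a1 : analytic_at f y by near: y.
have a2 : analytic_at g y by near: y.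
rewrite !(D_add _ a1 a2) linearD; congr (_ + _); by move: v; near: y.
Unshelve. all: by end_near. Qed.

Lemma holo_comp_lin X (Y Z : completeNormedModType R) I J K (f : X -> Y)
    (L : {linear Y -> Z}) x :
  continuous L -> (forall v, L (J v) = K (L v)) -> holo I J f x ->
  holo I K (fun x => L (f x)) x.
Proof. by move=> Lc LI hf; apply: (holo_comp (g := L)) hf _; exact: holo_lin. Qed.

Lemma holoN X (Y : completeNormedModType R) I (J : {linear Y -> Y}) (f : X -> Y) x :
  holo I J f x -> holo I J (fun x => - f x) x.
Proof.
move=> [af hf]; split; first exact: analyticN.
have afn := analytic_near af.
near=> y => v.
have a1 : analytic_at f y by near: y.
rewrite !(D_opp _ a1) linearN; congr (- _); by move: v; near: y.
Unshelve. all: by end_near. Qed.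

Lemma holoZ X (Y : completeNormedModType R) I (J : {linear Y -> Y}) k (f : X -> Y) x :
  holo I J f x -> holo I J (fun x => k *: f x) x.
Proof.
move=> [af hf]; split; first exact: analyticZ.
have afn := analytic_near af.
near=> y => v.
have a1 : analytic_at f y by near: y.
rewrite !(D_scale _ _ a1) linearZ; congr (_ *: _); by move: v; near: y.
Unshelve. all: by end_near. Qed.

Lemma holoB X (Y : completeNormedModType R) I (J : {linear Y -> Y}) (f g : X -> Y) x :
  holo I J f x -> holo I J g x -> holo I J (fun x => f x - g x) x.
Proof. by move=> hf /holoN; exact: holoD. Qed.

Lemma holo_id X (I : {linear X -> X}) x : holo I I (fun x : X => x) x.
Proof. by split; [exact: analytic_id|apply: nearW => y v; rewrite !D_id]. Qed.

Lemma holo_fst (X Y : normedModType R) I J (p : X * Y) : holo (pair_lin I J) I fst p.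
Proof. by apply: (@holo_lin _ _ _ _ fst) => // q; exact: cvg_fst. Qed.

Lemma holo_snd (X Y : normedModType R) I J (p : X * Y) : holo (pair_lin I J) J snd p.
Proof. by apply: (@holo_lin _ _ _ _ snd) => // q; exact: cvg_snd. Qed.

(** By the symmetry of the second differential, differentiation of D f in the
    direction v can be done first, where f is known to be complex linear. *)
Lemma holo_dir X (Y : completeNormedModType R) I (J : {linear Y -> Y}) (f : X -> Y) x h :
  continuous J -> holo I J f x -> holo I J (fun y => D f y h) x.
Proof.
move=> Jc [af hf]; split; first exact: analytic_dir.
have afn := analytic_near af; have hfn := near_near hf.
near=> y => v.
have a1 : analytic_at f y by near: y.
rewrite (D2C _ _ a1) (D_near_eq (g := fun y => J (D f y v))).
- by rewrite D_comp_lin //; [rewrite D2C|exact: analytic_dir].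
- exact: analytic_dir.
- by near=> z; move: v; near: z; near: y.
Unshelve. all: by end_near. Qed.

Lemma holo_tangent X (Y : completeNormedModType R) I (J : {linear Y -> Y}) (f : X -> Y) x v :
  continuous J -> holo I J f x ->
  holo (pair_lin I I) J (fun z : X * X => D f z.1 z.2) (x, v).
Proof.
move=> Jc hf; have [af _] := hf; split; first exact: analytic_tangent.
have h1 : \forall z \near (x, v), holo I J f z.1.
  exact: (near_comp (analytic_fst (x, v)) (holo_near hf)).
apply: filterS h1 => -[y w] /= hfy [h k]; have [ay /nbhs_singleton ty] := hfy.
have [_ /nbhs_singleton ty2] := holo_dir w Jc hfy.
by rewrite !D_tangent // /pair_lin /= ty ty2 linearD.
Qed.

Lemma holo_along W (X Y : completeNormedModType R) I (I' : {linear X -> X})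
    (J : {linear Y -> Y}) (f : X -> Y) (g G : W -> X) w :
  continuous J -> holo I' J f (g w) -> holo I I' g w -> holo I I' G w ->
  holo I J (fun w => D f (g w) (G w)) w.
Proof.
move=> Jc hf hg hG.
exact: (holo_comp (holo_pair hg hG) (holo_tangent (G w) Jc hf)).
Qed.

End Holo.

(** * Identity theorems *)

Definition line (R : realType) (X : normedModType R) (h : X) (t : R) : X := t *: h.

Section Line.
Context (R : realType) (X : normedModType R) (h : X).
Let line_linear : linear (line h).
Proof. by move=> k s t; rewrite /line scalerDl [in RHS]scalerA. Qed.
HB.instance Definition _ := GRing.isLinear.Build R R X _ (line h) line_linear.

Lemma line_continuous : continuous (line h).
Proof. by move=> t; apply: cvgZr_tmp; exact: cvg_id. Qed.
End Line.

Section Identity.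
Context (R : realType).
Implicit Types V X Y Z : normedModType R.

Lemma form_homog X Y n c (a : (nat -> X) -> Y) (t : R) h : form n c a ->
  a (fun=> t *: h) = t ^+ n *: a (fun=> h).
Proof.
move=> fa; have : forall k, (k <= n)%N ->
    a (fun j => if (j < k)%N then t *: h else h) = t ^+ k *: a (fun=> h).
  elim=> [_|k IH km]; first by rewrite scale1r.
  rewrite exprS -scalerA -IH ?(ltnW km) //.
  rewrite -[in RHS](upd_id (fun j => if (j < k)%N then t *: h else h) k).
  rewrite ltnn -(form_linZ _ _ _ fa km); congr (a _); apply/funext => j.
  by rewrite /upd ltnS leq_eqVlt; case: eqP => [->|].
move=> /(_ n (leqnn n)) <-; apply: (form_ext fa) => i im.
by rewrite im.
Qed.

(** A map vanishes if all its iterated directional derivatives vanish at the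
    origin.  The derivatives are presented by a property Q that is stable under
    differentiation; the proof reads them along lines. *)
Lemma zero_of_derivs V (Y : completeNormedModType R) (Q : (V -> Y) -> Prop) :
  (forall G, Q G -> analytic_at G 0 /\ G 0 = 0) ->
  (forall G h, Q G -> Q (fun y => D G y h)) ->
  forall G, Q G -> \forall y \near 0, G y = 0.
Proof.
move=> Q0 QD.
have key n : forall (G : V -> Y) h r C (c : nat -> Y), Q G -> 0 < r ->
    (forall N, \sum_(k < N) `|c k| * r ^+ k <= C) ->
    (forall t : R, `|t| <= r -> sums (fun k => t ^+ k *: c k) (G (t *: h))) -> c n = 0.
  elim: n => [|n IH] G h r C c QG r0 cC cG.
    have [_ G0] := Q0 G QG; have := cG 0; rewrite normr0 scale0r G0 => /(_ (ltW r0)) S.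
    rewrite (sums_unique S (t := c 0%N)) //.
    have := @sums_fin _ _ (fun k => (0 : R) ^+ k *: c k) 1%N.
    rewrite big_ord1 expr0 scale1r; apply=> -[//|k _].
    by rewrite expr0n scale0r.
  pose a k (w : nat -> R) := (\prod_(i < k) w i) *: c k.
  have fa k : form k `|c k| (a k).
    split=> // [v w vw|v i ik s t u|v].
    - by rewrite /a (eq_bigr (fun i : 'I_k => w i)) // => i _; exact: vw.
    - have E t' : a k (upd v i t') = t' *: ((\prod_(j < k | (j : nat) != i) v j) *: c k).
        rewrite /a (bigD1 (Ordinal ik)) //= upd_same scalerA; congr (_ * _ *: _).
        by apply: eq_bigr => j ji; rewrite /upd (negbTE (_ : (j : nat) != i)).
      by rewrite !E -[s *: t]/(s * t) scalerDl !scalerA mulrA.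
    - by rewrite /a normrZ normr_prod mulrC.
  have aE k t : a k (fun=> t) = t ^+ k *: c k by rewrite /a prodr_const card_ord.
  have pg : pser r C (fun t : R => G (t *: h)).
    split=> //; exists a, (fun k => `|c k|); split=> // t tr.
    by have := cG t tr; apply: eq_sums => k; rewrite aE.
  have [aG _] := Q0 G QG.
  have al t : analytic_at (line h) t := linear_analytic t (@line_continuous _ _ h).
  have aGh : \forall t \near (0 : R), analytic_at G (line h t).
    by apply: (near_comp (al 0)); rewrite linear0; exact: analytic_near.
  have /nbhs_ballP[d /= d0 ad] := aGh.
  pose r' := Num.min (r / 2) (d / 2).
  have r'0 : 0 < r' by rewrite lt_min !divr_gt0.
  have [r's r'd] : r' <= r / 2 /\ r' <= d / 2.
    by rewrite /r' !ge_min !lexx orbT.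
  have s0 : 0 < r / 2 by rewrite divr_gt0.
  have sr : r / 2 < r by lra.
  have dE k t : dterm a k t 1 = (k%:R * t ^+ k.-1) *: c k.
    rewrite /dterm -scaler_suml; congr (_ *: _).
    rewrite mulr_natl -[in RHS](card_ord k) -sumr_const; apply: eq_bigr => i _.
    rewrite (bigD1 i) //= upd_same mul1r (eq_bigr (fun=> t)).
      by rewrite prodr_const cardC1 card_ord.
    by move=> j ji; rewrite /upd (negbTE (_ : (j : nat) != i)).
  have := IH (fun y => D G y h) h r' (C * 1 / (r - r / 2)) (fun k => k.+1%:R *: c k.+1).
  move=> /(_ (QD _ _ QG) r'0) H; apply/eqP.
  suff /eqP : n.+1%:R *: c n.+1 = 0 by rewrite scaler_eq0 pnatr_eq0.
  apply: H => [N|t tr].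
    have := dterm_bd (fun k => normr_ge0 (c k)) cC (ltW s0) sr ler01 N.+1.
    apply: le_trans; rewrite big_ord_recl /= mul0r mul0r mulr0 add0r.
    apply: ler_sum => k _; rewrite normrZ mulr1 /bump /= add1n ger0_norm //.
    rewrite mulrCA mulrAC -mulrA; apply: ler_wpM2l => //.
    rewrite mulrC; apply: ler_wpM2l => //.
    by apply: lerXn2r => //; rewrite nnegrE ltW.
  have tr' : `|t| < r by apply: (le_lt_trans tr); exact: le_lt_trans r's sr.
  have cG' u : `|u| <= r -> sums (fun k => a k (fun=> u)) (G (line h u)).
    by move=> ur; have := cG u ur; apply: eq_sums => k; rewrite aE.
  have S : sums (fun k => dterm a k t 1) (D (fun t => G (line h t)) t 1).
    exact: pser_sums_diff r0 fa cC cG' tr'.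
  have := sums_shift (m := 1) S; rewrite big_ord1 dE mul0r scale0r subr0.
  have at0 : analytic_at G (line h t).
    by apply: ad; rewrite -ball_normE /= sub0r normrN; apply: (le_lt_trans tr); lra.
  rewrite (D_comp _ (al t) at0) (D_lin _ _ (@line_continuous _ _ h)) /=.
  rewrite /line scale1r.
  by apply: eq_sums => k; rewrite dE add1n /= mulrC -scalerA.
move=> G QG; have [/analytic_pser[r [C [r0 [a [c [fa cC aG]]]]]] _] := Q0 G QG.
near=> h; have hr : `|h| <= r by near: h; exact: nbhs0_le.
have h1 : `|h| <= 1 by near: h; exact: nbhs0_le.
apply: (sums_unique (aG h hr)).
have a0 n : a n (fun=> h) = 0.
  apply: (key n G h r C (fun n => a n (fun=> h)) QG r0) => [N|t tr].
    apply: le_trans (cC N); apply: ler_sum => k _; apply: ler_wpM2r.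
      by rewrite exprn_ge0 // ltW.
    apply: (le_trans (form_cst_bd h (fa k))); rewrite ler_piMr ?(form_ge0 (fa k)) //.
    exact: exprn_ile1.
  have thr : `|t *: h| <= r.
    by rewrite normrZ; apply: le_trans tr; rewrite ler_piMr.
  by have := aG _ thr; apply: eq_sums => k; rewrite (form_homog _ _ (fa k)).
have := @sums_fin _ _ (fun n => a n (fun=> h)) 0%N; rewrite big_ord0.
by apply=> n _; exact: a0.
Unshelve. all: by end_near. Qed.

(** Principle of permanence: a holomorphic map that vanishes on a totally real
    subspace spanning the whole space over the complex numbers is zero. *)
Lemma holo_identity (E V : normedModType R) (Y : completeNormedModType R) (I : {linear V -> V})
    (J : {linear Y -> Y}) (iota : {linear E -> V}) (G : V -> Y) :
  continuous J -> continuous iota ->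
  (forall y, exists a b, y = iota a + I (iota b)) ->
  holo I J G 0 -> (\forall x \near 0, G (iota x) = 0) ->
  \forall y \near 0, G y = 0.
Proof.
move=> Jc ic span hG G0.
pose Q (G : V -> Y) := holo I J G 0 /\ \forall x \near 0, G (iota x) = 0.
apply: (@zero_of_derivs _ _ Q) => [{G0 hG}G [hG G0]|{G0 hG}G h [hG G0]|//].
  by split; [case: hG|have := nbhs_singleton G0; rewrite linear0].
split; first exact: holo_dir.
have [a [b ->]] := span h.
have hGn : \forall x \near 0, holo I J G (iota x).
  apply: (near_comp (linear_analytic 0 ic)); rewrite linear0; exact: holo_near.
have G0n := near_near G0.
near=> x; have hx : holo I J G (iota x) by near: x.
have ax : analytic_at iota x by exact: linear_analytic.
have [aGx /nbhs_singleton gx] := hx.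
have D0c c : D G (iota x) (iota c) = 0.
  rewrite -(D_lin x c ic) -(D_comp c ax aGx) -(D_cst (0 : Y) x c).
  by apply: D_near_eq; [exact: analytic_comp|near: x].
by rewrite DD gx !D0c linear0 addr0.
Unshelve. all: by end_near. Qed.

End Identity.

(** * The analytic inverse function theorem *)

Section Inverse.
Context (R : realType).

(** Power series are Lipschitz maps on the algebra of power series; the
    constant is a majorant of the derivative. *)
Lemma pser_lipschitz (X Y : normedModType R) (Z : completeNormedModType R)
    tau s d L (r : Y -> Z) (a : nat -> (nat -> Y) -> Z) (c : nat -> R)
    (g h : X -> Y) :
  (forall n, form n (c n) (a n)) ->
  (forall N, \sum_(n < N) c n * (n%:R * s ^+ n.-1) <= L) ->
  (forall y, `|y| <= s -> sums (fun n => a n (fun=> y)) (r y)) ->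
  pser tau s g -> pser tau s h -> pser tau d (fun x => g x - h x) ->
  pser tau (L * d) (fun x => r (g x) - r (h x)).
Proof.
move=> fa cL ar pg ph pd; have t0 := pser_gt0 pg; have d0 := pser_ge0 pd.
apply: (@pser_series _ _ _ _ _ (fun n => c n * (n%:R * s ^+ n.-1) * d)
  (fun n x => a n (fun=> g x) - a n (fun=> h x))) => // [n|N|x xt].
- have -> : c n * (n%:R * s ^+ n.-1) * d =
      \sum_(i < n) c n * \prod_(j < n) upd (fun=> s) i d j.
    rewrite -mulr_sumr -mulrA; congr (_ * _).
    rewrite -mulrA -[in LHS](card_ord n) mulr_natl -sumr_const.
    apply: eq_bigr => i _; rewrite (bigD1 i) //= upd_same mulrC; congr (_ * _).
    rewrite (eq_bigr (fun=> s)); first by rewrite prodr_const cardC1 card_ord.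
    by move=> j ji; rewrite /upd (negbTE (_ : (j : nat) != i)).
  apply: (@pser_ext _ _ _ _ _ (fun x => \sum_(i < n)
      a n (upd (mix (fun=> g x) (fun=> h x) i) i (g x - h x)))).
    by move=> x _; rewrite (form_telescope _ _ (fa n)).
  apply: (@pser_sum _ _ _ _ _ (fun i => c n * \prod_(j < n) upd (fun=> s) i d j)
    (fun i x => a n (upd (mix (fun=> g x) (fun=> h x) i) i (g x - h x)))) => // i iN.
  apply: (pser_form (M := upd (fun=> s) i d)
    (g := fun j x => upd (mix (fun=> g x) (fun=> h x) i) i (g x - h x) j)) => // j _.
  by rewrite /upd /mix; case: (j == i) => //; case: (j < i)%N.
- by rewrite -mulr_suml; apply: ler_wpM2r.
- by apply: sumsB; apply: ar; [exact: pser_bd pg xt|exact: pser_bd ph xt].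
Qed.

(** A power series of order at least 2 has a representation without terms of
    degree 0 and 1, hence a small Lipschitz constant near the origin. *)
Lemma pser_order2 (X : normedModType R) (Y : completeNormedModType R) rho M (r : X -> Y) :
  pser rho M r -> r 0 = 0 -> (forall v, D r 0 v = 0) ->
  exists a c, [/\ forall n, form n (c n) (a n),
    forall s, 0 <= s -> s <= rho / 2 -> forall N,
      \sum_(n < N) c n * (n%:R * s ^+ n.-1) <= s / (rho / 2) * (M / (rho / 2))
    & forall h, `|h| <= rho -> sums (fun n => a n (fun=> h)) (r h)].
Proof.
move=> [r0 [a [c [fa cM ar]]]] rz Dz.
have a0 h : a 0%N (fun=> h) = 0.
  have S0 : sums (fun n => a n (fun=> 0)) (r 0) by apply: ar; rewrite normr0 ltW.
  rewrite -rz (sums_unique S0 (t := a 0%N (fun=> h))) //.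
  rewrite (_ : a 0%N _ = \sum_(k < 1) a k (fun=> 0)); last first.
    by rewrite big_ord1; apply: (form_ext (fa 0%N)).
  apply: sums_fin => -[//|n _].
  by rewrite -(upd_id (fun=> 0) 0) (form_lin0 _ (fa n.+1)).
have a1 h : a 1%N (fun=> h) = 0.
  have z0 : `|0 : X| < rho by rewrite normr0.
  have S1 : sums (fun n => dterm a n 0 h) (D r 0 h) by exact: pser_sums_diff cM ar z0.
  rewrite -(Dz h) (sums_unique S1 (t := a 1%N (fun=> h))) //.
  rewrite (_ : a 1%N _ = \sum_(k < 2) dterm a k 0 h); last first.
    rewrite /dterm !big_ord_recr !big_ord0 /= !add0r.
    by apply: (form_ext (fa 1%N)) => -[].
  apply: sums_fin => -[|[|n]] // _; rewrite /dterm big1 // => i _.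
  have [j [jn ji]] : exists j, (j < n.+2)%N /\ (j != i :> nat).
    by case: i => -[|i] /= _; [exists 1%N|exists 0%N].
  by rewrite -(upd_id (upd _ i h) j) {3}/upd (negbTE ji) (form_lin0 _ (fa _) jn).
exists (fun n => if (n < 2)%N then fun=> 0 else a n), (fun n => if (n < 2)%N then 0 else c n).
split=> [n|s s0 sr N|h hr].
- by case: ifP => // _; exact: form0.
- have h0 : 0 < rho / 2 by rewrite divr_gt0.
  have hr : rho / 2 < rho by lra.
  have := dterm_bd (fun n => form_ge0 (fa n)) cM (ltW h0) hr ler01 N.
  rewrite mulr1 (_ : rho - rho / 2 = rho / 2); last by field.
  move=> H; apply: (@le_trans _ _ (s / (rho / 2) *
    \sum_(n < N) c n * (n%:R * (rho / 2) ^+ n.-1 * 1))); last first.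
    by apply: ler_wpM2l => //; rewrite divr_ge0 // ltW.
  rewrite mulr_sumr; apply: ler_sum => -[n /= _] _; case: ifP => [_|/negbT].
    rewrite mul0r; apply: mulr_ge0; first by rewrite divr_ge0 // ltW.
    apply: mulr_ge0; first exact: form_ge0 (fa n).
    by rewrite mulr1 mulr_ge0 // exprn_ge0 // ltW.
  rewrite -leqNgt; case: n => [|[|n]] // _.
  rewrite mulr1 [leRHS]mulrCA; apply: ler_wpM2l; first exact: form_ge0 (fa _).
  rewrite [leRHS]mulrCA; apply: ler_wpM2l => //=; rewrite !exprS mulrA.
  rewrite divfK ?gt_eqF //; apply: ler_wpM2l => //.
  by apply: lerXn2r => //; rewrite nnegrE // ltW.
- have := ar h hr; apply: eq_sums => -[|[|n]] //=; by rewrite ?a0 ?a1.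
Qed.

Lemma sums_geometric (C : R) : 0 <= C ->
  forall N, \sum_(k < N) C * 2^-1 ^+ k <= 2 * C.
Proof.
move=> C0 N; have half0 : 0 <= (2^-1 : R) by rewrite invr_ge0.
suff -> : \sum_(k < N) C * 2^-1 ^+ k = 2 * C - 2 * C * 2^-1 ^+ N.
  by rewrite gerBl !mulr_ge0 // exprn_ge0.
elim: N => [|N IH]; first by rewrite big_ord0 expr0 mulr1 subrr.
by rewrite big_ord_recr /= IH exprS; field.
Qed.

(** With r := id - f, the inverse is the fixed point of g |-> id + r o g. This
    map is a contraction of a ball of the normed space of power series, so its
    fixed point is a power series and needs no separate proof of analyticity. *)
Lemma local_inverse (E : completeNormedModType R) (f : E -> E) :
  analytic_at f 0 -> f 0 = 0 -> (forall v, D f 0 v = v) ->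
  exists tau s g, [/\ 0 < tau, 0 < s, exists M, pser tau M g &
    [/\ forall x, `|x| <= tau -> `|g x| < s /\ f (g x) = x,
        forall x y, `|x| <= s -> `|y| <= s -> f x = f y -> x = y
      & forall x, `|x| <= s -> analytic_at f x]].
Proof.
move=> af f0 Df.
pose r x := x - f x.
have ar : analytic_at r 0 by apply: analyticB => //; exact: analytic_id.
have r0 : r 0 = 0 by rewrite /r f0 subrr.
have Dr v : D r 0 v = 0 by rewrite D_sub ?D_id ?Df ?subrr //; exact: analytic_id.
have [rho [M pr]] := analytic_pser ar; have rho0 := pser_gt0 pr.
have M0 := pser_ge0 pr.
have [a [c [fa cL sa]]] := pser_order2 pr r0 Dr.
(* the ball of radius s on which r is a contraction with factor 1/2 *)
have [s [s0 sr sL]] : exists s, [/\ 0 < s, s <= rho / 2 &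
    s / (rho / 2) * (M / (rho / 2)) <= 2^-1].
  have h0 : 0 < rho / 2 by rewrite divr_gt0.
  pose K := M / (rho / 2); have K0 : 0 <= K by rewrite divr_ge0 // ltW.
  have K1 : 0 < 2 * (K + 1) by rewrite mulr_gt0 // ltr_wpDl.
  exists (rho / 2 * Num.min 1 (2 * (K + 1))^-1).
  have m0 : 0 < Num.min 1 (2 * (K + 1))^-1 by rewrite lt_min ltr01 invr_gt0.
  split; first by rewrite mulr_gt0.
    by rewrite ler_piMr ?(ltW h0) // ge_min lexx.
  rewrite [rho / 2 * _]mulrC mulfK ?gt_eqF // -/K.
  apply: (@le_trans _ _ ((2 * (K + 1))^-1 * K)).
    by apply: ler_wpM2r => //; rewrite ge_min lexx orbT.
  rewrite ler_pdivrMl // mulrC mulrA mulVf // mul1r.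
  by rewrite lerDl.
have srho : s < rho by apply: (le_lt_trans sr); lra.
have sa' y : `|y| <= s -> sums (fun n => a n (fun=> y)) (r y).
  by move=> ys; apply: sa; apply: (le_trans ys); exact: ltW.
have cL' N : \sum_(n < N) c n * (n%:R * s ^+ n.-1) <= 2^-1.
  by apply: le_trans sL; exact: cL (ltW s0) sr N.
have lip tau d (g h : E -> E) : pser tau s g -> pser tau s h ->
    pser tau d (fun x => g x - h x) -> pser tau (2^-1 * d) (fun x => r (g x) - r (h x)).
  exact: pser_lipschitz fa cL' sa'.
have rlip x y : `|x| <= s -> `|y| <= s -> `|r x - r y| <= 2^-1 * `|x - y|.
  move=> xs ys.
  have px (z : E) : `|z| <= s -> pser 1 s (fun _ : E => z).
    by move=> zs; exact: pser_le (ltr01) (lexx _) zs (pser_const _ _ ltr01).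
  have := lip 1 `|x - y| (fun=> x) (fun=> y) (px _ xs) (px _ ys)
    (pser_const E (x - y) ltr01).
  by move=> /pser_bd /(_ (_ : `|0| <= 1)); rewrite normr0; apply; exact: ler01.
pose tau := s / 4; have tau0 : 0 < tau by rewrite divr_gt0.
pose g := fix g k x := if k is k'.+1 then x + r (g k' x) else x.
have pid : pser tau tau (fun x : E => x) by exact: pser_id.
have s2 : 0 < s / 2 by rewrite divr_gt0.
have p0 : pser tau s (fun _ : E => 0 : E).
  by apply: (pser_le tau0 (lexx _) _ (pser_const E (0 : E) tau0)); rewrite normr0 ltW.
have pg k : pser tau (s / 2) (g k).
  elim: k => [|k IH].
    by apply: (pser_le tau0 (lexx _) _ pid); rewrite /tau; lra.
  have IH' : pser tau s (g k) by apply: (pser_le tau0 (lexx _) _ IH); lra.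
  have e0 : pser tau (s / 2) (fun x => g k x - 0).
    by apply: pser_ext IH => x _; rewrite subr0.
  have := pserD pid (lip _ _ _ _ IH' p0 e0).
  rewrite (_ : tau + 2^-1 * (s / 2) = s / 2); last by rewrite /tau; field.
  by apply: pser_ext => x _; rewrite r0 subr0.
have pg' k : pser tau s (g k) by apply: (pser_le tau0 (lexx _) _ (pg k)); lra.
have pd k : pser tau (s * 2^-1 ^+ k) (fun x => g k.+1 x - g k x).
  elim: k => [|k IH].
    by rewrite expr0 mulr1 [X in pser _ X _](splitr s); exact: pserB.
  have := lip _ _ _ _ (pg' k.+1) (pg' k) IH.
  rewrite mulrCA -exprS; apply: pser_ext => x _ /=.
  by module.
have /choice[G HG] : forall x, exists y, `|x| <= tau ->
    sums (fun k => g k.+1 x - g k x) y.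
  move=> x; have [xt|xt] := leP `|x| tau; last by exists 0.
  have [y yS] := sums_exists (fun k => pser_bd (pd k) xt) (sums_geometric (ltW s0)).
  by exists y.
have pG := pser_series tau0 pd (sums_geometric (ltW s0)) HG.
have gk x k : g k x = x + \sum_(i < k) (g i.+1 x - g i x).
  rewrite -(big_mkord xpredT (fun i => g i.+1 x - g i x)).
  by rewrite (telescope_sumr (fun i => g i x)) //; rewrite [g 0%N x]/=; module.
exists tau, s, (fun x => x + G x); split=> //.
  by exists (tau + 2 * s); exact: pserD.
split=> [x xt|x y xs ys fxy|x xs].
- have Gs : `|x + G x| <= s / 2.
    apply/ler_addgt0Pr => e e0; have [N _ /(_ N (leqnn N)) HN] := sums_series (HG x xt) e0.
    rewrite (_ : x + G x = g N x + (G x - \sum_(i < N) (g i.+1 x - g i x))); last first.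
      by rewrite gk; module.
    apply: (le_trans (ler_normD _ _)); apply: lerD; last exact: ltW.
    exact: pser_bd (pg N) xt.
  have Gs' : `|x + G x| < s by apply: (le_lt_trans Gs); lra.
  split=> //; apply/eqP; rewrite -subr_eq0 -normr_eq0 eq_le normr_ge0 andbT.
  apply/ler_addgt0Pr => e e0; rewrite add0r; have e2 : 0 < e / 2 by rewrite divr_gt0.
  have [N _ HN] := sums_series (HG x xt) e2.
  have d1 := HN N (leqnn N); have d2 := HN N.+1 (leqnSn N).
  have E1 : x + G x - g N x = G x - \sum_(i < N) (g i.+1 x - g i x).
    by rewrite gk; module.
  have E2 : x + G x - g N.+1 x = G x - \sum_(i < N.+1) (g i.+1 x - g i x).
    by rewrite gk; module.
  rewrite -E1 /= in d1; rewrite -E2 in d2.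
  have gN : `|g N x| <= s := pser_bd (pg' N) xt.
  have := rlip _ _ (ltW Gs') gN => d3.
  have -> : f (x + G x) - x = (x + G x - g N.+1 x) - (r (x + G x) - r (g N x)).
    by rewrite /= {2}/r; module.
  apply: (le_trans (ler_normB _ _)); lra.
- apply/eqP; rewrite -subr_eq0 -normr_eq0 eq_le normr_ge0 andbT.
  have := rlip _ _ xs ys; rewrite {1}/r /r fxy opprB addrA subrK.
  by move=> ?; lra.
- have -> : f = fun x => x - r x by apply/funext => y; rewrite /r; module.
  apply: analyticB; first exact: analytic_id.
  by apply: (pser_analytic_in pr); exact: le_lt_trans srho.
Qed.

End Inverse.

(** * Complexification of real power series *)

Section Complexification.
Context (R : realType).
Implicit Types V X Y Z : normedModType R.

Definition equivariant V Z (I : V -> V) (J : Z -> Z) i (a : (nat -> V) -> Z) :=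
  forall v t, a (upd v i (I t)) = J (a (upd v i t)).

(** Twice the projection, in the j-th argument, onto the forms that are complex
    linear in this argument. *)
Definition twist V Z (I : V -> V) (J : Z -> Z) j (a : (nat -> V) -> Z) v : Z :=
  a v + J (a (upd v j (- I (v j)))).

Fixpoint twists V Z (I : V -> V) (J : Z -> Z) k (a : (nat -> V) -> Z) :=
  if k is k'.+1 then twist I J k' (twists I J k' a) else a.

Section Twist.
Context V Z (I : {linear V -> V}) (J : {linear Z -> Z}) (k1 k2 : R).
Hypothesis I2 : forall v, I (I v) = - v.
Hypothesis J2 : forall z, J (J z) = - z.
Hypothesis k10 : 0 <= k1.
Hypothesis k20 : 0 <= k2.
Hypothesis Ib : forall v, `|I v| <= k1 * `|v|.
Hypothesis Jb : forall z, `|J z| <= k2 * `|z|.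

Lemma form_twist n c j (a : (nat -> V) -> Z) : (j < n)%N -> form n c a ->
  form n (c * (1 + k1 * k2)) (twist I J j a).
Proof.
move=> jn fa; have c0 := form_ge0 fa.
rewrite mulrDr mulr1 [c * _]mulrC; split=> [|v w vw|v i iN k s t|v].
- by rewrite addr_ge0 // !mulr_ge0.
- rewrite /twist (form_ext fa vw) (form_ext fa (v := upd v j _) (w := upd w j (- I (w j)))) //.
  by move=> i iN; rewrite /upd -(vw j jn); case: (i == j) => //; exact: vw.
- rewrite /twist; have [->|ij] := eqVneq i j.
    rewrite !upd_same !upd_upd linearP opprD -scalerN.
    by rewrite !(form_lin fa) // linearP scalerDr; module.
  have vj u : upd v i u j = v j by rewrite /upd eq_sym (negbTE ij).
  rewrite !vj !(updC _ _ _ ij) (form_lin fa v iN) (form_lin fa _ iN) linearP.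
  by module.
- rewrite mulrDl; apply: (le_trans (ler_normD _ _)); apply: lerD; first exact: form_bd fa _.
  apply: (le_trans (Jb _)); rewrite -[k1 * k2]mulrC -!mulrA; apply: ler_wpM2l => //.
  apply: (le_trans (form_bd fa _)); rewrite mulrCA; apply: ler_wpM2l => //.
  rewrite (bigD1 (Ordinal jn)) //= [in leRHS](bigD1 (Ordinal jn)) //=.
  rewrite upd_same normrN mulrA.
  rewrite (eq_bigr (fun i : 'I_n => `|v i|)); last first.
    by move=> i ij; rewrite /upd (negbTE (_ : (i : nat) != j)).
  by apply: ler_wpM2r => //; exact: prodr_ge0.
Qed.

Lemma form_twists n c k (a : (nat -> V) -> Z) : (k <= n)%N -> form n c a ->
  form n (c * (1 + k1 * k2) ^+ k) (twists I J k a).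
Proof.
move=> kn fa; elim: k kn => [|k IH] kn /=; first by rewrite expr0 mulr1.
by rewrite exprSr mulrA; apply: form_twist => //; apply: IH; exact: ltnW.
Qed.

Lemma equivariant_twist n c j (a : (nat -> V) -> Z) : (j < n)%N -> form n c a ->
  equivariant I J j (twist I J j a).
Proof.
move=> jn fa v t; rewrite /twist !upd_same !upd_upd I2 opprK.
rewrite linearD J2 addrC; congr (_ + _).
by rewrite -[- I t]scaleN1r (form_linZ _ _ _ fa jn) scaleN1r opprK.
Qed.

Lemma equivariant_twist_other i j (a : (nat -> V) -> Z) : i != j ->
  equivariant I J i a -> equivariant I J i (twist I J j a).
Proof.
move=> ij ea v t.
have vj u : upd v i u j = v j by rewrite /upd eq_sym (negbTE ij).
by rewrite /twist !vj !(updC _ _ _ ij) !ea linearD.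
Qed.

Lemma equivariant_twists n c k (a : (nat -> V) -> Z) i : (k <= n)%N -> form n c a ->
  (i < k)%N -> equivariant I J i (twists I J k a).
Proof.
move=> kn fa; elim: k kn i => [//|k IH] kn i; rewrite ltnS leq_eqVlt /=.
have fk := form_twists (ltnW kn) fa.
case/predU1P => [->|ik]; first exact: equivariant_twist fk.
by apply: equivariant_twist_other; [rewrite ltn_eqF|exact: IH (ltnW kn) i ik].
Qed.

(** On arguments in P the terms added by the twists vanish, because each of them
    has an argument -I t with t in P. *)
Lemma twists_real n c k (P : V -> Prop) (a : (nat -> V) -> Z) : form n c a ->
  (forall v t i, (i < n)%N -> P t -> a (upd v i (- I t)) = 0) -> (k <= n)%N ->
  (forall v t i, (k <= i)%N -> (i < n)%N -> P t ->
     twists I J k a (upd v i (- I t)) = 0) /\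
  (forall v, (forall i, (i < n)%N -> P (v i)) -> twists I J k a v = a v).
Proof.
move=> fa az; elim: k => [|k IH] kn; first by split=> // v t i _; exact: az.
have [z e] := IH (ltnW kn); split=> [v t i ki iN ret|v rev] /=.
  have ik : i != k by rewrite gtn_eqF.
  have vk u : upd v i u k = v k by rewrite /upd eq_sym (negbTE ik).
  rewrite /twist vk (updC _ _ _ ik) (z v t i (ltnW ki) iN ret).
  by rewrite (z _ t i (ltnW ki) iN ret) linear0 addr0.
by rewrite /twist (z v (v k) k (leqnn k) kn (rev k kn)) linear0 addr0 e.
Qed.

End Twist.

(** The coefficients of F, composed with the real part re, are made complex
    linear in each argument by twists; they converge on a smaller ball of V, and
    on iota X the twists do not change them. *)
Lemma complexification X V (Z : completeNormedModType R) (I : {linear V -> V})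
    (J : {linear Z -> Z}) (iota : X -> V) (re : {linear V -> X}) (F : X -> Z) :
  continuous I -> continuous J -> continuous re ->
  (forall v, I (I v) = - v) -> (forall z, J (J z) = - z) ->
  (forall x, re (iota x) = x) -> (forall x, re (I (iota x)) = 0) ->
  {for 0, continuous iota} -> iota 0 = 0 -> analytic_at F 0 ->
  exists r M (b : nat -> (nat -> V) -> Z) (d : nat -> R) (Ft : V -> Z),
  [/\ 0 < r,
      forall n, form n (d n) (b n) /\ forall i, (i < n)%N -> equivariant I J i (b n),
      forall N, \sum_(n < N) d n * r ^+ n <= M,
      forall h, `|h| <= r -> sums (fun n => b n (fun=> h)) (Ft h)
    & \forall x \near 0, Ft (iota x) = F x].
Proof.
move=> Ic Jc rec I2 J2 reK reI ic i0 /analytic_pser[rho [M [r0 [a [c [fa cM af]]]]]].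
have [k1 k10 Ib] := linear_lipschitz Ic.
have [k2 k20 Jb] := linear_lipschitz Jc.
have [k3 k30 rb] := linear_lipschitz rec.
pose a' n v := a n (fun i => re (v i)).
have fa' n : form n (c n * k3 ^+ n) (a' n).
  have [c0 e l b] := fa n; split=> [|v w vw|v i iN k s t|v].
  - by rewrite mulr_ge0 // exprn_ge0 // ltW.
  - by apply: e => i iN; rewrite vw.
  - have E u : a' n (upd v i u) = a n (upd (fun i => re (v i)) i (re u)).
      by congr (a n); apply/funext => j; rewrite /upd; case: (j == i).
    by rewrite !E linearP l.
  - apply: (le_trans (b _)); rewrite -mulrA; apply: ler_wpM2l => //.
    rewrite -[X in k3 ^+ X](card_ord n) -prodr_const -big_split /=.
    by apply: ler_prod => i _; rewrite normr_ge0 rb.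
pose K := k3 * (1 + k1 * k2); have K0 : 0 < K.
  by rewrite mulr_gt0 // (lt_le_trans ltr01) // lerDl mulr_ge0 // ltW.
pose b n := twists I J n (a' n); pose d n := c n * K ^+ n.
have fb n : form n (d n) (b n).
  rewrite /d exprMn mulrA.
  exact: (form_twists (ltW k10) (ltW k20) Ib Jb (leqnn n) (fa' n)).
have dM N : \sum_(n < N) d n * (rho / K) ^+ n <= M.
  apply: le_trans (cM N); apply: ler_sum => n _.
  by rewrite /d -mulrA -exprMn [K * _]mulrC divfK ?gt_eqF.
have rK : 0 < rho / K by rewrite divr_gt0.
have /choice[Ft HF] : forall h, exists y, `|h| <= rho / K ->
    sums (fun n => b n (fun=> h)) y.
  move=> h; have [hr|hr] := leP `|h| (rho / K); last by exists 0.
  suff [y ys] : exists y, sums (fun n => b n (fun=> h)) y by exists y.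
  apply: (sums_exists (c := fun n => d n * (rho / K) ^+ n) _ dM) => n.
  apply: (le_trans (form_cst_bd h (fb n))); apply: ler_wpM2l; first exact: form_ge0 (fb n).
  by apply: lerXn2r => //; rewrite nnegrE // ltW.
exists (rho / K), M, b, d, Ft; split=> // [n|].
  split=> // i iN.
  exact: (equivariant_twists I2 J2 (ltW k10) (ltW k20) Ib Jb (leqnn n) (fa' n) iN).
have near1 : \forall x \near (0 : X), `|iota x| <= rho / K.
  have : \forall v \near iota 0, `|v| <= rho / K by rewrite i0; exact: nbhs0_le.
  exact: ic.
near=> x; have ix : `|iota x| <= rho / K by near: x.
have xr : `|x| <= rho by near: x; exact: nbhs0_le.
apply: (sums_unique (HF _ ix)); have := af x xr; apply: eq_sums => n.
have az v t i : (i < n)%N -> re (I t) = 0 -> a' n (upd v i (- I t)) = 0.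
  move=> iN ret; rewrite -(upd_id (upd v i (- I t)) i) upd_same /a'.
  rewrite (_ : (fun j => re _) = upd (fun j => re (v j)) i 0).
    exact: (form_lin0 _ (fa n) iN).
  by apply/funext => j; rewrite /upd; case: (j == i) => //; rewrite linearN ret oppr0.
have [_ e] := twists_real J (P := fun t => re (I t) = 0) (fa' n) az (leqnn n).
by rewrite /b e // /a' reK.
Unshelve. all: by end_near. Qed.

(** The derivative of an equivariant form in any direction is equivariant, and
    term-by-term differentiation carries this over to the sum. *)
Lemma equivariant_holo V (Z : completeNormedModType R) (I : V -> V) (J : {linear Z -> Z})
    r M (b : nat -> (nat -> V) -> Z) (d : nat -> R) (Ft : V -> Z) :
  continuous J -> 0 < r -> (forall n, form n (d n) (b n)) ->
  (forall n i, (i < n)%N -> equivariant I J i (b n)) ->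
  (forall N, \sum_(n < N) d n * r ^+ n <= M) ->
  (forall h, `|h| <= r -> sums (fun n => b n (fun=> h)) (Ft h)) -> holo I J Ft 0.
Proof.
move=> Jc r0 fb eb dM bF.
have pF : pser r M Ft by split=> //; exists b, d.
split; first exact: pser_analytic pF.
near=> y => v; have yr : `|y| < r by near: y; exact: nbhs0_lt.
have S w : sums (fun n => dterm b n y w) (D Ft y w) by exact: pser_sums_diff dM bF yr.
apply: (sums_unique (S (I v))); have := sums_comp Jc (S v); apply: eq_sums => n.
by rewrite /dterm linear_sum; apply: eq_bigr => i _; rewrite eb.
Unshelve. all: by end_near. Qed.

(** * The complexification of a complex space *)

Section Doubling.
Context (E : completeNormedModType R) (I : {linear E -> E}).
Hypotheses (Ic : continuous I) (I2 : forall v, I (I v) = - v).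

Lemma linear_opp_continuous X Y (L : {linear X -> Y}) : continuous L ->
  continuous (\- L).
Proof. by move=> Lc x; apply: cvgN; exact: Lc. Qed.

(** The complexification of E as a real space is E * E with the conjugate complex
    structure on the second factor; E is its diagonal, which is totally real. *)
Definition dbl (I : E -> E) : E * E -> E * E := pair_lin I (\- I).
HB.instance Definition _ := GRing.Linear.copy (dbl I) (pair_lin I (\- I)).

Definition diag (x : E) : E * E := (x, x).
Let diag_linear : linear diag.
Proof. by []. Qed.
HB.instance Definition _ := GRing.isLinear.Build R E (E * E)%type _ diag diag_linear.

Lemma diag_continuous : continuous diag.
Proof. by move=> x; apply: cvg_pair; exact: cvg_id. Qed.

Definition mean (p : E * E) : E := 2^-1 *: (p.1 + p.2).
Let mean_linear : linear mean.
Proof. by move=> k s t; rewrite /mean /=; module. Qed.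
HB.instance Definition _ := GRing.isLinear.Build R (E * E)%type E _ mean mean_linear.

Lemma mean_continuous : continuous mean.
Proof. by move=> p; apply: cvgZl_tmp; apply: cvgD; [exact: cvg_fst|exact: cvg_snd]. Qed.

Lemma dbl_continuous : continuous (dbl I).
Proof. by apply: pair_lin_continuous => //; exact: linear_opp_continuous. Qed.

Lemma dbl2 p : dbl I (dbl I p) = - p.
Proof.
case: p => z w; rewrite /dbl /pair_lin /= linearN I2 opprK; congr (_, _).
by rewrite I2.
Qed.

Lemma mean_diag x : mean (diag x) = x.
Proof.
apply: (@scalerI _ _ (2 : R)); first by rewrite pnatr_eq0.
by rewrite /mean /diag scalerA divff ?pnatr_eq0 // scale1r scaler_nat.
Qed.

Lemma mean_dbl_diag x : mean (dbl I (diag x)) = 0.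
Proof. by rewrite /mean /dbl /pair_lin /diag /= subrr scaler0. Qed.

Lemma dbl_split v : v = diag (mean v) + dbl I (diag (mean (I v.2, - I v.1))).
Proof.
case: v => z w; rewrite /diag /mean /dbl /pair_lin /= linearZ linearB !I2.
rewrite opprK.
have h2 : (2 : R)^-1 + 2^-1 = 1 by field.
congr (_, _) => /=.
  by transitivity ((2^-1 + 2^-1 : R) *: z); [rewrite h2 scale1r|module].
by transitivity ((2^-1 + 2^-1 : R) *: w); [rewrite h2 scale1r|module].
Qed.

End Doubling.

(** * Real analytic maps with complex linear differentials *)

Section HoloForms.
Context (E F : completeNormedModType R) (I : {linear E -> E}) (J : {linear F -> F}).
Hypotheses (Ic : continuous I) (Jc : continuous J).
Hypotheses (I2 : forall v, I (I v) = - v) (J2 : forall z, J (J z) = - z).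
Local Notation II := (dbl I).

(** The forms of a real power series need not be complex linear even if its sum
    is. Those of the extension Ft of f to E * E are; since Ft does not depend on
    the antiholomorphic second variable, f is the restriction of Ft to the first
    one, and so are its forms. *)
Lemma holo_forms (f : E -> F) : holo I J f 0 ->
  exists r M (b : nat -> (nat -> E) -> F) (d : nat -> R),
  [/\ 0 < r,
      forall n, form n (d n) (b n) /\ forall i, (i < n)%N -> equivariant I J i (b n),
      forall N, \sum_(n < N) d n * r ^+ n <= M
    & \forall x \near 0, sums (fun n => b n (fun=> x)) (f x)].
Proof.
move=> hf; have [af _] := hf.
have dc0 : {for 0, continuous (@diag E)} := @diag_continuous E 0.
have [r [M [b [d [Ft [r0 fb dM bF FtE]]]]]] :=
  complexification (dbl_continuous Ic) Jc (@mean_continuous E) (dbl2 I2) J2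
    (@mean_diag E) (mean_dbl_diag I) dc0 (linear0 (@diag E)) af.
have hF : holo II J Ft 0.
  apply: (equivariant_holo Jc r0 _ _ dM bF) => n; first by have [] := fb n.
  by have [_] := fb n.
pose L2 (v : E) : E * E := (0, v).
have aL2 v : analytic_at L2 v by apply: analytic_pair; [exact: analytic_cst|exact: analytic_id].
(* the extension does not depend on the antiholomorphic variable *)
pose G (p : (E * E) * E) : F := D Ft p.1 (L2 p.2).
have hG : holo (pair_lin II (\- I)) J G 0.
  apply: (holo_along (I' := II)) => //.
  - exact: holo_fst.
  - apply: holo_pair; first exact: holo_cst.
    exact: holo_snd.
pose iota : {linear (E * E)%type -> ((E * E) * E)%type} := pair_lin (@diag E) idfun.
have iotac : continuous iota.
  by apply: pair_lin_continuous => v; [exact: diag_continuous|exact: cvg_id].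
have span (y : (E * E) * E) : exists a b, y = iota a + pair_lin II (\- I) (iota b).
  case: y => y v; exists (mean y, v), (mean (I y.2, - I y.1), 0).
  rewrite /iota /= /pair_lin /=; congr (_, _); first exact: dbl_split.
  by rewrite /= linear0 oppr0 addr0.
have Giota : \forall q \near 0, G (iota q) = 0.
  have h1 : \forall x \near 0, holo II J Ft (diag x).
    apply: (near_comp (linear_analytic 0 (@diag_continuous E))).
    by rewrite linear0; exact: holo_near.
  have h2 := holo_near hf; have h3 := near_near FtE.
  have : \forall x \near 0, forall v, D Ft (diag x) (L2 v) = 0.
    near=> x => v.
    have hx : holo II J Ft (diag x) by near: x.
    have fx : holo I J f x by near: x.
    have Fx : \forall y \near x, Ft (diag y) = f y by near: x.
    have [ax /nbhs_singleton Dx] := hx; have [afx /nbhs_singleton Dfx] := fx.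
    have ad : analytic_at (@diag E) x.
      by apply: linear_analytic; exact: diag_continuous.
    have E1 u : D Ft (diag x) (diag u) = D f x u.
      rewrite -(D_lin x u (@diag_continuous E)) -(D_comp u ad ax).
      by apply: D_near_eq => //; exact: analytic_comp.
    have -> : L2 v = 2^-1 *: (diag v + II (diag (I v))).
      rewrite /L2 /diag /dbl /pair_lin /= I2 opprK; congr (_, _) => /=.
        by rewrite subrr scaler0.
      apply: (@scalerI _ _ (2 : R)); first by rewrite pnatr_eq0.
      by rewrite scalerA divff ?pnatr_eq0 // scale1r scaler_nat.
    by rewrite DZ DD Dx !E1 Dfx J2 subrr scaler0.
  move=> H; have := near_comp (P := fun x => forall v, D Ft (diag x) (L2 v) = 0)
    (analytic_fst (0 : E * E)) H.
  by apply: filterS => q Hq; exact: Hq.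
have G0 := holo_identity Jc iotac span hG Giota.
have {G0} D2 : \forall y \near (0 : E * E), forall v, D Ft y (L2 v) = 0.
  apply: (near_homog (T := fun y v => D Ft y (L2 v) = 0)) G0 => y k v k0 H.
  apply: (scalerI k0); rewrite scaler0 -[RHS]H -DZ.
  by congr (D Ft y (_, _)) => /=; rewrite scaler0.
pose L1 (v : E) : E * E := (v, 0).
have aL1 v : analytic_at L1 v by apply: analytic_pair; [exact: analytic_id|exact: analytic_cst].
have Findep : \forall y \near (0 : E * E), Ft y - Ft (L1 y.1) = 0.
  pose Q (H : E * E -> F) := [/\ analytic_at H 0, \forall z \near 0, H (L1 z) = 0
    & \forall y \near 0, forall v, D H y (L2 v) = 0].
  have al1 y : analytic_at (fun y : E * E => L1 y.1) y.
    by apply: (analytic_comp (f := fst)); [exact: analytic_fst|exact: aL1].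
  have aF1 : analytic_at (fun y : E * E => Ft (L1 y.1)) 0.
    have a0 : analytic_at Ft (L1 (0 : E * E).1) by case: hF.
    exact: (analytic_comp (al1 0) a0).
  apply: (@zero_of_derivs _ _ _ Q) => [H [aH H0 _]|H h [aH H0 H2]|].
  - by split=> //; exact: nbhs_singleton H0.
  - split; first exact: analytic_dir.
      have aHn : \forall z \near 0, analytic_at H (L1 z).
        by apply: (near_comp (aL1 0)); exact: analytic_near.
      have H2n : \forall z \near 0, forall v, D H (L1 z) (L2 v) = 0.
        exact: (near_comp (P := fun y => forall v, D H y (L2 v) = 0) (aL1 0) H2).
      have H0n := near_near H0.
      near=> z; have a1 : analytic_at H (L1 z) by near: z.
      have -> : h = D L1 z h.1 + L2 h.2.
        rewrite /L1 D_pair; [|exact: analytic_id|exact: analytic_cst].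
        by rewrite D_id D_cst /L2; case: h => h1 h2; congr (_, _); rewrite /= ?addr0 ?add0r.
      rewrite DD -(D_comp _ (aL1 z) a1).
      have -> : D H (L1 z) (L2 h.2) = 0 by move: h.2; near: z.
      rewrite addr0 -(D_cst (0 : F) z h.1); apply: D_near_eq; last by near: z.
      exact: analytic_comp (aL1 z) a1.
    have aHn := analytic_near aH; have H2n := near_near H2.
    near=> y => v; have a1 : analytic_at H y by near: y.
    rewrite (D2C _ _ a1) -(D_cst (0 : F) y h); apply: D_near_eq; first exact: analytic_dir.
    by near=> y'; move: v; near: y'; near: y.
  - split; first by apply: analyticB => //; case: hF.
      by apply: nearW => z; rewrite subrr.
    have aFn : \forall y \near 0, analytic_at Ft y by apply: analytic_near; case: hF.
    have aFn1 := near_comp (al1 0) aFn.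
    near=> y => v; have a1 : analytic_at Ft y by near: y.
    have a2 : analytic_at Ft (L1 y.1) by near: y.
    rewrite D_sub //; last exact: analytic_comp (al1 y) a2.
    have -> : D Ft y (L2 v) = 0 by move: v; near: y.
    rewrite (D_comp (f := fun y : E * E => L1 y.1) _ (al1 y) a2).
    rewrite (D_comp (f := fst) (g := L1)); [|exact: analytic_fst|exact: aL1].
    by rewrite D_fst /= D0 D0 subrr.
exists r, M, (fun n v => b n (fun i => L1 (v i))), d; split=> // [n|].
  have [[c0 e l bd] eb] := fb n; split; last first.
    move=> i iN v t; have E1 u : (fun j => L1 (upd v i u j)) = upd (fun j => L1 (v j)) i (L1 u).
      by apply/funext => j; rewrite /upd; case: (j == i).
    rewrite !E1 -eb //; congr (b n (upd _ _ _)).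
    by rewrite /L1 /dbl /pair_lin /=; congr (_, _); exact: (esym (linear0 (\- I))).
  split=> // [v w vw|v i iN k s t|v].
  - by apply: e => i iN; rewrite vw.
  - have E1 u : (fun j => L1 (upd v i u j)) = upd (fun j => L1 (v j)) i (L1 u).
      by apply/funext => j; rewrite /upd; case: (j == i).
    rewrite !E1 -l //; congr (b n (upd _ _ _)).
    by rewrite /L1; congr (_, _) => /=; rewrite scaler0 addr0.
  - apply: (le_trans (bd _)); apply: ler_wpM2l => //; apply: ler_prod => i _.
    by rewrite normr_ge0 /= /L1 prod_normE /= normr0 ge_max lexx normr_ge0.
have Fd := near_comp (linear_analytic 0 (@diag_continuous E)) (P := fun y => Ft y - Ft (L1 y.1) = 0).
rewrite linear0 in Fd; have {}Fd := Fd Findep.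
have sm : \forall x \near (0 : E), `|L1 x| <= r.
  near=> x; rewrite /L1 prod_normE /= normr0 ge_max (ltW r0) andbT.
  by near: x; exact: nbhs0_le.
near=> x; have -> : f x = Ft (L1 x).
  have <- : Ft (diag x) = f x by near: x.
  by apply/eqP; rewrite -subr_eq0; apply/eqP; near: x.
by apply: bF; near: x.
Unshelve. all: by end_near. Qed.

End HoloForms.
End Complexification.

(** * Lie series *)

(** This weak form of Stirling's inequality makes the Lie series converge: its
    k-th term costs k derivatives, each at the price of k / rho. *)
Lemma expnn_le k : (k ^ k <= 4 ^ k * k`!)%N.
Proof.
have h1 : ('C(2 * k, k) <= 4 ^ k)%N.
  rewrite (_ : 4 = 2 ^ 2)%N // -expnM.
  have := Pascal 1 1 (2 * k); rewrite addn1 => ->.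
  have kk : (k < (2 * k).+1)%N by lia.
  by rewrite (bigD1 (Ordinal kk)) //= !exp1n !muln1 leq_addr.
apply: (@leq_trans ((2 * k) ^_ k)); last by rewrite -bin_ffact leq_mul2r h1 orbT.
rewrite ffact_prod -[X in (_ ^ X)%N](card_ord k) -prod_nat_const.
by apply: leq_prod => i _; have := ltn_ord i; lia.
Qed.

Section LieSeries.
Context (R : realType).
Implicit Types P : normedModType R.

Lemma pser_scale P (X : completeNormedModType R) rho M N (t : P -> R) (f : P -> X) :
  pser rho M t -> pser rho N f -> pser rho (M * N) (fun p => t p *: f p).
Proof.
move=> pt pf.
have fb : form 2 1 (fun v : nat -> (R * X)%type => (v 0%N).1 *: (v 1%N).2).
  split=> // [v w vw|v [|[|//]] _ k s u|v]; first by rewrite !vw.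
  - by rewrite /upd /= scalerDl scalerA.
  - by rewrite /upd /= scalerDr !scalerA mulrC.
  - rewrite mul1r !big_ord_recr big_ord0 /= mul1r normrZ.
    by apply: ler_pM => //; rewrite prod_normE le_max lexx ?orbT.
have l1 : linear (fun y : R => (y, 0) : (R * X)%type).
  by move=> k s u; congr (_, _) => /=; rewrite scaler0 addr0.
have l2 : linear (fun z : X => (0, z) : (R * X)%type).
  by move=> k s u; congr (_, _) => /=; rewrite scaler0 addr0.
pose L1 : {linear R -> (R * X)%type} := HB.pack (fun y : R => (y, 0) : (R * X)%type)
  (GRing.isLinear.Build _ _ _ _ _ l1).
pose L2 : {linear X -> (R * X)%type} := HB.pack (fun z : X => (0, z) : (R * X)%type)
  (GRing.isLinear.Build _ _ _ _ _ l2).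
have p1 : pser rho (1 * M) (fun p => L1 (t p)).
  apply: pser_comp_linear pt => // y.
  by rewrite mul1r prod_normE /= normr0 ge_max lexx normr_ge0.
have p2 : pser rho (1 * N) (fun p => L2 (f p)).
  apply: pser_comp_linear pf => // y.
  by rewrite mul1r prod_normE /= normr0 ge_max lexx normr_ge0.
have := pser_form (pser_gt0 pt) fb (M := fun i => if i is 0 then 1 * M else 1 * N)
  (g := fun i p => if i is 0 then L1 (t p) else L2 (f p)).
rewrite !big_ord_recr big_ord0 /= !mul1r; apply=> -[|[|//]] _.
  by rewrite -[M]mul1r.
by rewrite -[N]mul1r.
Qed.

Lemma D_scalef P (X : completeNormedModType R) (t : P -> R) (f : P -> X) p v :
  analytic_at t p -> analytic_at f p ->
  D (fun p => t p *: f p) p v = D t p v *: f p + t p *: D f p v.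
Proof.
move=> at_ af.
have aF : analytic_at (fun z : R * X => z.1 *: z.2) (t p, f p).
  by apply: analytic_scale; [exact: analytic_fst|exact: analytic_snd].
rewrite (D_comp (f := fun p => (t p, f p)) (g := fun z : R * X => z.1 *: z.2)) //.
- rewrite D_pair // D_partial //=; congr (_ + _).
    exact: (D_lin (L := line (f p)) _ _ (@line_continuous _ _ _)).
  rewrite D_scale; [by rewrite D_id|exact: analytic_id].
- exact: analytic_pair.
Qed.

Context (P : normedModType R) (X : completeNormedModType R).
Context (Y : P -> P) (tau : {linear P -> R}).
Hypothesis tauc : continuous tau.

Definition lie (Y : P -> P) (f : P -> X) : P -> X := fun p => D f p (Y p).

Definition lie_iter k f := iter k (lie Y) f.

Definition lie_coef k (t : R) : R := k`!%:R^-1 * (- t) ^+ k.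

(** The terms of the Lie series of f, that is of the composition of f with the
    time -tau flow of Y. *)
Definition lie_term f k p : X := lie_coef k (tau p) *: lie_iter k f p.

(** Each derivative along Y gives up d of the radius for a factor L / d. *)
Lemma lie_iter_pser rho M L f d k : pser rho M f -> pser rho L Y -> 0 < d ->
  0 < rho - k%:R * d ->
  pser (rho - k%:R * d) (M * (L / d) ^+ k) (lie_iter k f).
Proof.
move=> pf pY d0; elim: k => [|k IH] kd.
  by rewrite mul0r subr0 expr0 mulr1.
set s := rho - k.+1%:R * d in kd *.
have sE : rho - k%:R * d = s + d by rewrite /s -natr1; ring.
have {IH} : pser (s + d) (M * (L / d) ^+ k) (lie_iter k f).
  by rewrite -sE; apply: IH; rewrite sE addr_gt0.
move=> IH; have ss : s < s + d by rewrite ltrDl.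
have sr : s <= rho by rewrite /s gerBl mulr_ge0 // ltW.
have := pser_deriv IH ss (pser_id P kd) (pser_le kd sr (lexx _) pY).
rewrite [s + d]addrC addrK exprSr mulrA -[_ * L / d]mulrA; exact.
Qed.

Lemma lie_coef_pser rho kappa k : 0 < rho -> 0 <= kappa ->
  (forall p, `|tau p| <= kappa * `|p|) ->
  pser rho (k`!%:R^-1 * (kappa * rho) ^+ k) (fun p => lie_coef k (tau p)).
Proof.
move=> r0 k0 tb; have c0 : 0 <= k`!%:R^-1 :> R by rewrite invr_ge0.
have pt : pser rho (kappa * rho) (fun p => - tau p).
  exact: pserN (pser_linear r0 k0 tb).
suff H : pser rho ((kappa * rho) ^+ k) (fun p => (- tau p) ^+ k).
  have := pser_scale (pser_const P (k`!%:R^-1 : R) r0) H.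
  by rewrite ger0_norm.
elim: k {c0} => [|k IH].
  have := pser_const P (1 : R) r0; rewrite normr1 expr0.
  by apply: pser_ext => h _; rewrite expr0.
have := pser_scale pt IH; rewrite -exprS; apply: pser_ext => h _.
by rewrite exprS.
Qed.

(** With d = rho / (2 k), k derivatives use up half the radius and produce the
    factor (2 k L / rho)^k, which the 1 / k! of the coefficient reduces to a
    geometric one. The radius is then chosen for the ratio 1/2. *)
Lemma lie_term_pser f : analytic_at f 0 -> analytic_at Y 0 ->
  exists rho M, 0 < rho /\ forall k, pser rho (M * 2^-1 ^+ k) (lie_term f k).
Proof.
move=> /analytic_pser[r1 [M pf1]] /analytic_pser[r2 [L' pY2]].
have r10 := pser_gt0 pf1; have r20 := pser_gt0 pY2.
pose rho := Num.min r1 r2; pose L := L' + 1.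
have r0 : 0 < rho by rewrite lt_min r10.
have L0 : 0 < L by rewrite ltr_wpDl // (pser_ge0 pY2).
have pf : pser rho M f by apply: (pser_le r0 _ _ pf1); rewrite // ge_min lexx.
have pY : pser rho L Y.
  by apply: (pser_le r0 _ _ pY2); rewrite ?ge_min ?lexx ?orbT // lerDl.
have M0 := pser_ge0 pf.
have [kap kap0 tb] := linear_lipschitz tauc.
pose e := Num.min (rho / 2) (rho / (16 * kap * L)).
have e0 : 0 < e by rewrite lt_min !divr_gt0 // !mulr_gt0.
exists e, M; split=> // k.
have pc := lie_coef_pser k e0 (ltW kap0) tb.
have [->|k0] := posnP k.
  rewrite expr0 mulr1 -[M]mul1r; apply: pser_scale.
    by move: (lie_coef_pser 0 e0 (ltW kap0) tb); rewrite expr0 mulr1 fact0 invr1.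
  by apply: (pser_le e0 _ _ pf) => //; rewrite /e ge_min; apply/orP; left; lra.
have kR : 0 < (k%:R : R) by rewrite ltr0n.
pose d := rho / (2 * k%:R); have d0 : 0 < d by rewrite divr_gt0 // mulr_gt0.
have kd : rho - k%:R * d = rho / 2 by rewrite /d; field; rewrite gt_eqF.
have pl : pser (rho / 2) (M * (L / d) ^+ k) (lie_iter k f).
  by rewrite -kd; apply: lie_iter_pser => //; rewrite kd divr_gt0.
have {}pl : pser e (M * (L / d) ^+ k) (lie_iter k f).
  by apply: (pser_le e0 _ _ pl) => //; rewrite ge_min lexx.
apply: (pser_le e0 (lexx _) _ (pser_scale pc pl)).
have kk : (k%:R : R) ^+ k <= 4 ^+ k * k`!%:R by rewrite -!natrX -natrM ler_nat expnn_le.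
have f0 : 0 < (k`!%:R : R) by rewrite ltr0n fact_gt0.
have -> : k`!%:R^-1 * (kap * e) ^+ k * (M * (L / d) ^+ k) =
    M * (k`!%:R^-1 * k%:R ^+ k * (kap * e * (2 * L / rho)) ^+ k).
  rewrite [in RHS]exprMn /d (_ : L / (rho / (2 * k%:R)) = k%:R * (2 * L / rho)); last first.
    by field; rewrite !gt_eqF.
  by rewrite [in LHS](exprMn _ (k%:R)); ring.
apply: ler_wpM2l => //.
apply: (@le_trans _ _ (4 ^+ k * (kap * e * (2 * L / rho)) ^+ k)).
  apply: ler_wpM2r; first by rewrite exprn_ge0 // !mulr_ge0 ?invr_ge0 // ltW.
  by rewrite ler_pdivrMl // mulrC.
rewrite -exprMn; apply: lerXn2r; rewrite ?nnegrE.
- by rewrite !mulr_ge0 ?invr_ge0 // ltW.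
- by rewrite invr_ge0.
have : e <= rho / (16 * kap * L) by rewrite ge_min lexx orbT.
move=> eb; apply: (@le_trans _ _ (4 * (kap * (rho / (16 * kap * L)) * (2 * L / rho)))).
  do 1?[apply: ler_wpM2l => //]; apply: ler_wpM2r.
    by rewrite !mulr_ge0 ?invr_ge0 // ltW.
  by apply: ler_wpM2l => //; exact: ltW.
suff -> : 4 * (kap * (rho / (16 * kap * L)) * (2 * L / rho)) = 2^-1 by [].
by field; rewrite !gt_eqF.
Qed.

Context (U : set P).
Hypothesis Uo : open U.
Hypothesis aY : forall p, U p -> analytic_at Y p.

Lemma analytic_lie_iter f k : (forall p, U p -> analytic_at f p) ->
  forall p, U p -> analytic_at (lie_iter k f) p.
Proof.
move=> af; elim: k => [//|k IH] p Up.
by apply: analytic_along; [exact: IH|exact: analytic_id|exact: aY].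
Qed.

Lemma lie_ext (f g : P -> X) p : U p -> (forall q, U q -> f q = g q) ->
  analytic_at f p -> lie Y f p = lie Y g p.
Proof.
move=> Up fg af; apply: D_near_eq => //.
have : \forall q \near p, U q by exact: open_nbhs_nbhs.
by apply: filterS.
Qed.

(** Leibniz rule for tau * h, where tau has derivative 1 along Y. *)
Lemma lie_iter_tau h k : (forall p, U p -> analytic_at h p) ->
  (forall p, U p -> tau (Y p) = 1) ->
  forall p, U p -> lie_iter k (fun p => tau p *: h p) p =
    tau p *: lie_iter k h p + k%:R *: lie_iter k.-1 h p.
Proof.
move=> ah tY; have at_ p : analytic_at tau p by exact: linear_analytic.
elim: k => [|k IH] p Up; first by rewrite scale0r addr0.
have al j : analytic_at (lie_iter j h) p by exact: analytic_lie_iter.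
have a1 : analytic_at (fun p => tau p *: lie_iter k h p) p by exact: analytic_scale.
have a2 : analytic_at (fun p => k%:R *: lie_iter k.-1 h p) p by exact: analyticZ.
rewrite [LHS](_ : _ = lie Y (fun p => tau p *: lie_iter k h p
    + k%:R *: lie_iter k.-1 h p) p); last first.
  apply: lie_ext => //; apply: analytic_lie_iter => // q Uq.
  by apply: analytic_scale => //; exact: ah.
rewrite /lie D_add // D_scalef // D_scale // D_lin // tY // scale1r.
case: k {IH a1 a2} => [|k] /=; first by rewrite scale0r addr0 scale1r addrC.
rewrite -[D (lie_iter k h) p (Y p)]/(lie_iter k.+1 h p) -[in RHS]natr1.
by rewrite -[lie Y (lie_iter k.+1 h) p]/(D (lie_iter k.+1 h) p (Y p)); module.
Qed.

Lemma lie_iter_comm K f k : (forall p, U p -> analytic_at K p) ->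
  (forall p, U p -> analytic_at f p) ->
  (forall p, U p -> D K p (Y p) = D Y p (K p)) ->
  forall p, U p -> lie K (lie_iter k f) p = lie_iter k (lie K f) p.
Proof.
move=> aK af com; elim: k => [//|k IH] p Up.
have al : analytic_at (lie_iter k f) p by exact: analytic_lie_iter.
have ai : analytic_at (fun p : P => p) p by exact: analytic_id.
rewrite [RHS](_ : _ = lie Y (lie K (lie_iter k f)) p); last first.
  symmetry; apply: lie_ext => //; apply: analytic_along => //; exact: aK.
rewrite /lie /= (D_along (f := lie_iter k f) (g := fun p => p) (G := Y)) //; last exact: aY.
rewrite (D_along (f := lie_iter k f) (g := fun p => p) (G := K)) //; last exact: aK.
by rewrite !D_id com // D2C.
Qed.

Lemma lie_iter_ext (f g : P -> X) k : (forall p, U p -> analytic_at f p) ->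
  (forall p, U p -> f p = g p) -> forall p, U p -> lie_iter k f p = lie_iter k g p.
Proof.
move=> af fg; elim: k => [|k IH] p Up; first exact: fg.
by apply: lie_ext => //; exact: analytic_lie_iter.
Qed.

Lemma lie_coef_analytic k (t : R) : analytic_at (lie_coef k) t.
Proof.
suff H : analytic_at (fun t : R => (- t) ^+ k) t by exact: (analyticZ k`!%:R^-1 H).
have an : analytic_at (fun t : R => - t) t by apply: analyticN; exact: analytic_id.
elim: k => [|k IH]; first exact: analytic_cst.
suff -> : (fun s : R => (- s) ^+ k.+1) = fun s => - s *: ((- s) ^+ k : R).
  exact: analytic_scale an IH.
by apply/funext => s; exact: exprS.
Qed.

Lemma sums_delay (u : nat -> X) s : sums u s ->
  sums (fun k => if k is k'.+1 then u k' else 0) s.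
Proof.
move=> us; apply: sumsP => e e0; have [N _ HN] := sums_series us e0.
exists N.+1 => // -[//|n] /= Nn; rewrite big_ord_recl /= add0r.
exact: HN.
Qed.

(** The sum of the Lie series of f is constant along a field K that commutes
    with Y, provided that the derivative of f along K is divisible by tau:
    commuting, the series transforms K f into K F, and it annihilates tau
    because it is the pullback by a flow that ends on the hypersurface
    tau = 0. *)
Lemma lie_series_invariant (K : P -> P) (f h : P -> X) : U 0 ->
  (forall p, U p -> analytic_at K p) -> (forall p, U p -> analytic_at f p) ->
  (forall p, U p -> analytic_at h p) ->
  (forall p, U p -> tau (Y p) = 1) -> (forall p, U p -> tau (K p) = 0) ->
  (forall p, U p -> D K p (Y p) = D Y p (K p)) ->
  (forall p, U p -> D f p (K p) = tau p *: h p) ->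
  exists rho M F, [/\ 0 < rho, forall k, pser rho (M * 2^-1 ^+ k) (lie_term f k),
    forall p, `|p| <= rho -> sums (fun k => lie_term f k p) (F p)
    & \forall p \near 0, D F p (K p) = 0].
Proof.
move=> U0 aK af ah tY tK com fK.
have [rho [M [r0 pf]]] := lie_term_pser (af 0 U0) (aY U0).
have [rho' [M' [r'0 ph]]] := lie_term_pser (ah 0 U0) (aY U0).
have M0 : 0 <= M by have := pser_ge0 (pf 0%N); rewrite expr0 mulr1.
have M'0 : 0 <= M' by have := pser_ge0 (ph 0%N); rewrite expr0 mulr1.
have /choice[F HF] : forall p, exists y, `|p| <= rho -> sums (fun k => lie_term f k p) y.
  move=> p; have [pr|pr] := leP `|p| rho; last by exists 0.
  suff [y ys] : exists y, sums (fun k => lie_term f k p) y by exists y.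
  exact: (sums_exists (fun k => pser_bd (pf k) pr) (sums_geometric M0)).
exists rho, M, F; split=> //.
have Un : \forall p \near (0 : P), U p by exact: open_nbhs_nbhs.
near=> p.
have Up : U p by near: p.
have pr : `|p| < rho by near: p; exact: nbhs0_lt.
have pr' : `|p| <= rho' by near: p; exact: nbhs0_le.
have [S uS] : exists S, sums (fun k => lie_term h k p) S.
  exact: (sums_exists (fun k => pser_bd (ph k) pr') (sums_geometric M'0)).
have SD := pser_series_diff (v := K p) r0 pf (sums_geometric M0) HF pr.
apply: (sums_unique SD).
have := sumsZ (k := tau p) (sumsB uS (sums_delay uS)); rewrite subrr scaler0.
apply: eq_sums => k.
have at_ : analytic_at tau p by exact: linear_analytic.
have al : analytic_at (lie_iter k f) p by exact: analytic_lie_iter.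
have ac := lie_coef_analytic k (tau p).
rewrite /lie_term D_scalef //; last exact: analytic_comp at_ ac.
rewrite (D_comp _ at_ ac) D_lin // tK // D0 scale0r add0r.
rewrite -[D (lie_iter k f) p (K p)]/(lie K (lie_iter k f) p) lie_iter_comm //.
have aKf q : U q -> analytic_at (lie K f) q.
  by move=> Uq; exact: (analytic_along (af q Uq) (analytic_id q) (aK q Uq)).
rewrite (lie_iter_ext _ aKf (g := fun p => tau p *: h p)) //.
rewrite lie_iter_tau //; case: k {al ac} => [|k] /=.
  by rewrite scale0r addr0 subr0 !scalerA mulrC.
have cE : lie_coef k.+1 (tau p) * k.+1%:R = - tau p * lie_coef k (tau p).
  have f0 : (k`!%:R : R) != 0 by rewrite pnatr_eq0 -lt0n fact_gt0.
  have k0 : (k.+1%:R : R) != 0 by rewrite pnatr_eq0.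
  rewrite /lie_coef factS natrM exprS.
  by move: (k.+1%:R : R) k0 (k`!%:R : R) f0 => a a0 b b0; field; rewrite ?a0 ?b0.
have aux (t a b n : R) (A B : X) : a * n = - t * b ->
    t *: (a *: A - b *: B) = a *: (t *: A + n *: B).
  by move=> e; rewrite [in RHS]scalerDr (scalerA a n) e; module.
exact: aux cE.
Unshelve. all: by end_near. Qed.

End LieSeries.

(** * Straightening a complex distribution *)

Section Frobenius.
Context (R : realType).

Context (X : completeNormedModType R) (I : {linear X -> X}).
Hypothesis Ic : continuous I.
Context (m : X * X -> X -> X).

(** For y in a neighbourhood of 0, the vectors (m y eta, eta) span a complex
    distribution on X * X; it is a holomorphic and involutive one. *)
Definition involutive_at (y : X * X) := [/\
  forall eta, analytic_at (fun p : (X * X) * X => m p.1 p.2) (y, eta),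
  forall eta u, D (m^~ eta) y (dbl I u) = I (D (m^~ eta) y u),
  forall eta xi, D (m^~ eta) y (m y xi, xi) = D (m^~ xi) y (m y eta, eta)
  & forall eta, m y (- I eta) = I (m y eta)].

Hypothesis mlin : forall y k u v, m y (k *: u + v) = k *: m y u + m y v.
Hypothesis m00 : forall eta, m 0 eta = 0.
Hypothesis minv : \forall y \near 0, involutive_at y.

Let mL y : {linear X -> X} := HB.pack (m y) (GRing.isLinear.Build _ _ _ _ _ (mlin y)).

Let m_0 y : m y 0 = 0. Proof. exact: (linear0 (mL y)). Qed.
Let mZ y k u : m y (k *: u) = k *: m y u. Proof. by rewrite -[k *: u]addr0 mlin m_0 addr0. Qed.
Let mB y u v : m y (u - v) = m y u - m y v. Proof. exact: (linearB (mL y)). Qed.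

Let P : Type := ((X * X) * (X * R))%type.

(** The point p = ((z, w), (eta, t)) stands for the point (z, t w) of X * X: the
    variable t dilates the second factor. Y is the lift of the radial motion
    along the distribution; K, in which eta only serves as a parameter, is the
    lift of t times its section (m eta, eta). Involutivity says that Y and K
    commute, and K moves z by t times an analytic function, so the Lie series of
    z along Y is constant along K. *)
Let pi (p : P) : X * X := (p.1.1, p.2.2 *: p.1.2).
Let Y (p : P) : P := ((m (pi p) p.1.2, 0), (0, 1)).
Let K (p : P) : P := ((p.2.2 *: m (pi p) p.2.1, p.2.1), (0, 0)).

Let inj (v : X) : P := ((v, 0), (0, 0)).
Let kill_w (p : P) : P := ((p.1.1, 0), p.2).
Let kill_eta (p : P) : P := (p.1, (0, p.2.2)).
Let tau (p : P) : R := p.2.2.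

Let a1 (p : P) : analytic_at (fun p : P => p.1) p. Proof. exact: analytic_fst. Qed.
Let a2 (p : P) : analytic_at (fun p : P => p.2) p. Proof. exact: analytic_snd. Qed.
Let a11 (p : P) : analytic_at (fun p : P => p.1.1) p.
Proof. by apply: analytic_comp (a1 p) (analytic_fst p.1). Qed.
Let a12 (p : P) : analytic_at (fun p : P => p.1.2) p.
Proof. by apply: analytic_comp (a1 p) (analytic_snd p.1). Qed.
Let a21 (p : P) : analytic_at (fun p : P => p.2.1) p.
Proof. by apply: analytic_comp (a2 p) (analytic_fst p.2). Qed.
Let a22 (p : P) : analytic_at (fun p : P => p.2.2) p.
Proof. by apply: analytic_comp (a2 p) (analytic_snd p.2). Qed.

Let d1 (p v : P) : D (fun p : P => p.1) p v = v.1. Proof. exact: D_fst. Qed.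
Let d2 (p v : P) : D (fun p : P => p.2) p v = v.2. Proof. exact: D_snd. Qed.
Let d11 (p v : P) : D (fun p : P => p.1.1) p v = v.1.1.
Proof. by rewrite (D_comp (f := fst) _ (a1 p) (analytic_fst p.1)) D_fst D_fst. Qed.
Let d12 (p v : P) : D (fun p : P => p.1.2) p v = v.1.2.
Proof. by rewrite (D_comp (f := fst) _ (a1 p) (analytic_snd p.1)) D_snd D_fst. Qed.
Let d21 (p v : P) : D (fun p : P => p.2.1) p v = v.2.1.
Proof. by rewrite (D_comp (f := snd) _ (a2 p) (analytic_fst p.2)) D_fst D_snd. Qed.
Let d22 (p v : P) : D (fun p : P => p.2.2) p v = v.2.2.
Proof. by rewrite (D_comp (f := snd) _ (a2 p) (analytic_snd p.2)) D_snd D_snd. Qed.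

Let tau_linear : linear tau.
Proof. by []. Qed.
HB.instance Definition _ := GRing.isLinear.Build R P R _ tau tau_linear.
Let tauc : continuous tau.
Proof. by move=> p; apply: (analytic_continuous (a22 p)). Qed.

Let api p : analytic_at pi p.
Proof. by apply: analytic_pair => //; exact: analytic_scale. Qed.

Let dpi p v : D pi p v = (v.1.1, v.2.2 *: p.1.2 + p.2.2 *: v.1.2).
Proof.
rewrite D_pair //; last exact: analytic_scale.
by rewrite d11 D_scalef // d12 d22.
Qed.

Let akw p : analytic_at kill_w p.
Proof.
apply: analytic_pair => //.
by apply: analytic_pair => //; exact: analytic_cst.
Qed.

Let dkw p v : D kill_w p v = kill_w v.
Proof.
rewrite /kill_w D_pair //; last by apply: analytic_pair => //; exact: analytic_cst.
rewrite D_pair //; last exact: analytic_cst.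
by rewrite d11 d2 D_cst.
Qed.

Let ake p : analytic_at kill_eta p.
Proof.
apply: analytic_pair => //.
by apply: analytic_pair => //; exact: analytic_cst.
Qed.

Let dke p v : D kill_eta p v = kill_eta v.
Proof.
rewrite /kill_eta D_pair //; last by apply: analytic_pair => //; exact: analytic_cst.
rewrite D_pair //; last exact: analytic_cst.
by rewrite d22 d1 D_cst.
Qed.

Let G : set (X * X) := interior [set y | involutive_at y].
Let U : set P := pi @^-1` G.

Let Uo : open U.
Proof.
apply: open_comp; last exact: open_interior.
by move=> p _; exact: analytic_continuous (api p).
Qed.

Let Uinv p : U p -> involutive_at (pi p).
Proof. exact: interior_subset. Qed.

Let U0 : U 0.
Proof.
rewrite /U /preimage /= /G /interior /=.
have -> : pi 0 = 0 by rewrite /pi /= scaler0.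
exact: minv.
Qed.

Let am eta y : involutive_at y -> analytic_at (m^~ eta) y.
Proof.
move=> [aM _ _ _].
have ay : analytic_at (fun y : X * X => (y, eta)) y.
  by apply: analytic_pair; [exact: analytic_id|exact: analytic_cst].
exact: (analytic_comp ay (aM eta)).
Qed.

Let dmm y eta u k : involutive_at y ->
  D (fun p : (X * X) * X => m p.1 p.2) (y, eta) (u, k) = D (m^~ eta) y u + m y k.
Proof.
by move=> [aM _ _ _]; rewrite D_bundle.
Qed.

Let amg (g : P -> X) p : U p -> analytic_at g p -> analytic_at (fun p => m (pi p) (g p)) p.
Proof.
move=> Up ag; have [aM _ _ _] := Uinv Up.
exact: (analytic_comp (analytic_pair (api p) ag) (aM (g p))).
Qed.

Let dmg (g : P -> X) p v : U p -> analytic_at g p ->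
  D (fun p => m (pi p) (g p)) p v = D (m^~ (g p)) (pi p) (D pi p v) + m (pi p) (D g p v).
Proof.
move=> Up ag; have [aM _ _ _] := Uinv Up.
rewrite (D_comp (f := fun p => (pi p, g p)) (g := fun p => m p.1 p.2)) //.
- by rewrite D_pair // dmm //; exact: Uinv.
- exact: analytic_pair.
Qed.

Let aY p : U p -> analytic_at Y p.
Proof.
move=> Up; apply: analytic_pair; last exact: analytic_cst.
by apply: analytic_pair; [exact: amg|exact: analytic_cst].
Qed.

Let aK p : U p -> analytic_at K p.
Proof.
move=> Up; apply: analytic_pair; last exact: analytic_cst.
by apply: analytic_pair => //; apply: analytic_scale => //; exact: amg.
Qed.

Let dY p v : U p ->
  D Y p v = inj (D (m^~ p.1.2) (pi p) (D pi p v) + m (pi p) v.1.2).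
Proof.
move=> Up; have aw := amg Up (a12 p).
rewrite /Y D_pair; [|by apply: analytic_pair => //; exact: analytic_cst|exact: analytic_cst].
rewrite D_pair //; last exact: analytic_cst.
by rewrite !D_cst dmg // d12.
Qed.

Let dK p v : U p ->
  D K p v = ((v.2.2 *: m (pi p) p.2.1 +
    p.2.2 *: (D (m^~ p.2.1) (pi p) (D pi p v) + m (pi p) v.2.1), v.2.1), (0, 0)).
Proof.
move=> Up; have aw := amg Up (a21 p); have as_ := analytic_scale (a22 p) aw.
rewrite /K D_pair; [|exact: analytic_pair|exact: analytic_cst].
rewrite D_pair // !D_cst D_scalef // dmg // d21 d22.
by [].
Qed.

Let commute p : U p -> D K p (Y p) = D Y p (K p).
Proof.
move=> Up; have [_ _ inv _] := Uinv Up; rewrite dK // dY // !dpi /= m_0 addr0 !scale1r.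
rewrite !scaler0 scale0r addr0 add0r /inj; congr (((_ : X), _), _).
have -> : (p.2.2 *: m (pi p) p.2.1, p.2.2 *: p.2.1)
    = p.2.2 *: ((m (pi p) p.2.1, p.2.1) : X * X) by [].
by rewrite addrC DZ inv.
Qed.

Local Notation f := (fun p : P => p.1.1).
Local Notation F_ := (lie_iter Y).

Let aF k p : U p -> analytic_at (F_ k f) p.
Proof. by move=> Up; apply: (analytic_lie_iter aY) => // q _. Qed.

Let norm_kill_eta (p : P) : `|kill_eta p| <= `|p|.
Proof.
have le2 : `|((0, p.2.2) : X * R)| <= `|p.2|.
  by rewrite !prod_normE /= normr0 ge_max !le_max lexx normr_ge0 orbT.
rewrite /kill_eta [leLHS]prod_normE [leRHS]prod_normE /= ge_max le_max lexx /=.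
by rewrite le_max le2 orbT.
Qed.

(** No component of Y depends on eta, and Y does not move it. *)
Let iter_kill_eta k p : U p -> F_ k f (kill_eta p) = F_ k f p.
Proof.
elim: k p => [//|k IH] p Up.
have ap := aF k Up; have ap' := @aF k (kill_eta p) Up.
change (D (F_ k f) (kill_eta p) (Y (kill_eta p)) = D (F_ k f) p (Y p)).
have -> : Y (kill_eta p) = D kill_eta p (Y p) by rewrite dke.
rewrite -(D_comp _ (ake p) ap'); apply: D_near_eq; first exact: analytic_comp (ake p) ap'.
have : \forall q \near p, U q by exact: open_nbhs_nbhs.
by apply: filterS.
Qed.

(** At w = 0 the field Y moves t only, so that the Lie series of z ends with z.
    *)
Let iter_w0 k p : U p -> p.1.2 = 0 -> F_ k.+1 f p = 0.
Proof.
elim: k p => [|k IH] p Up pw.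
  by rewrite -[LHS]/(D f p (Y p)) d11 /= pw m_0.
change (D (F_ k.+1 f) p (Y p) = 0).
have kp : kill_w p = p by case: p pw {Up} => [[? ?] ?] /= ->.
have -> : Y p = D kill_w p (Y p) by rewrite dkw.
have ap := aF k.+1 Up; have akp : analytic_at (F_ k.+1 f) (kill_w p) by rewrite kp.
rewrite -{1}kp -(D_comp _ (akw p) akp) -(D_cst (0 : X) p (Y p)).
apply: D_near_eq; first exact: (analytic_comp (akw p) akp).
have : \forall q \near p, U (kill_w q).
  apply: (near_comp (akw p)); rewrite kp; exact: open_nbhs_nbhs.
by apply: filterS => q Uq; exact: IH.
Qed.

(** The second derivative may be taken first in the direction of v, where it is
    complex linear by assumption; the contribution of D Y is complex linear
    because m is holomorphic in its base point. *)
Let lie_I (g : P -> X) : (forall p, U p -> analytic_at g p) ->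
  (forall p v, U p -> D g p (inj (I v)) = I (D g p (inj v))) ->
  forall p v, U p -> D (lie Y g) p (inj (I v)) = I (D (lie Y g) p (inj v)).
Proof.
move=> ag gI p v Up; have ap := ag p Up; have aYp := aY Up.
have ai : analytic_at (fun p : P => p) p by exact: analytic_id.
have E u : D (lie Y g) p (inj u) = D (fun y => D g y (Y p)) p (inj u)
    + D g p (inj (D (m^~ p.1.2) (pi p) (u, 0))).
  have := D_along (f := g) (g := fun p => p) (G := Y) (inj u) ap ai aYp.
  by rewrite D_id dY // dpi /= m_0 addr0 scaler0 scale0r addr0.
have [_ hol _ _] := Uinv Up.
have Iv : (I v, 0) = dbl I (v, 0).
  rewrite /dbl /pair_lin /=; congr (_, _); exact: (esym (linear0 (\- I))).
rewrite !E linearD Iv hol gI //; congr (_ + _).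
rewrite (D2C _ _ ap) (D_near_eq (g := fun y => I (D g y (inj v)))).
- by rewrite D_comp_lin; [rewrite (D2C _ _ ap)|exact: Ic|exact: analytic_dir].
- exact: analytic_dir.
have : \forall q \near p, U q by exact: open_nbhs_nbhs.
by apply: filterS => q Uq; exact: gI.
Qed.

Let iter_I k p v : U p -> D (F_ k f) p (inj (I v)) = I (D (F_ k f) p (inj v)).
Proof.
elim: k p v => [|k IH] p v Up; first by rewrite !d11.
exact: (lie_I (fun q Uq => @aF k q Uq) IH).
Qed.

Hypothesis I2 : forall v, I (I v) = - v.

(** The Lie series Psi of the first coordinate along Y is constant along the
    fields K, that is, along the distribution dilated by t; its restriction to
    the slice t = eps, undilated, is constant along the distribution itself. *)
Lemma frobenius : exists Phi : X -> X,
  [/\ analytic_at Phi 0, Phi 0 = 0, forall v, D Phi 0 v = v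
    & \forall x \near 0, forall v v', v + I v' = m (x, x) (v - I v') ->
        D Phi x v' = I (D Phi x v)].
Proof.
have [||||||rho [M [Psi [r0 pT sT KPsi]]]] := @lie_series_invariant R P X Y tau
  tauc U Uo aY K f (fun p => m (pi p) p.2.1) U0 aK.
- by move=> p _.
- by move=> p Up; exact: amg.
- by [].
- by [].
- by move=> p Up; exact: commute.
- by move=> p _; rewrite d11.
have M0 : 0 <= M by have := pser_ge0 (pT 0%N); rewrite expr0 mulr1.
have pPsi := pser_series r0 pT (sums_geometric M0) sT.
have aPsi p : `|p| < rho -> analytic_at Psi p by exact: pser_analytic_in pPsi.
have Psi_eta p : `|p| <= rho -> U p -> Psi (kill_eta p) = Psi p.
  move=> pr Up; have kr : `|kill_eta p| <= rho.
    exact: le_trans (norm_kill_eta p) pr.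
  apply: (sums_unique (sT _ kr)); apply: eq_sums (sT _ pr) => k.
  by rewrite /lie_term iter_kill_eta.
have Psi_w0 p : `|p| <= rho -> U p -> p.1.2 = 0 -> Psi p = p.1.1.
  move=> pr Up pw; apply: (sums_unique (sT _ pr)).
  have := sums_fin (u := fun k => lie_term Y tau f k p) (N := 1%N).
  rewrite big_ord1 /lie_term /lie_coef fact0 invr1 expr0 mulr1 scale1r.
  by apply=> -[//|k] _; rewrite iter_w0 // scaler0.
have Psi_I p v : `|p| < rho -> U p -> D Psi p (inj (I v)) = I (D Psi p (inj v)).
  move=> pr Up.
  have S v' := pser_series_diff (v := inj v') r0 pT (sums_geometric M0) sT pr.
  have := sums_comp Ic (S v); move=> H; apply: (sums_unique (S (I v))).
  have E u k : D (lie_term Y tau f k) p (inj u) = lie_coef k (tau p) *: D (F_ k f) p (inj u).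
    have ac : analytic_at (fun p => lie_coef k (tau p)) p.
      by apply: (analytic_comp (a22 p)); exact: lie_coef_analytic.
    rewrite D_scalef //; last exact: aF.
    rewrite (D_comp (f := tau) _ (a22 p) (lie_coef_analytic k _)) d22 /= D0.
    by rewrite scale0r add0r.
  apply: eq_sums H => k; rewrite !E linearZ; congr (_ *: _).
  exact/esym/iter_I.
pose good q := [/\ D Psi q (K q) = 0, U q & `|q| < rho].
have goodn : \forall q \near (0 : P), good q.
  have Un : \forall p \near (0 : P), U p by exact: open_nbhs_nbhs.
  have rn : \forall p \near (0 : P), `|p| < rho.
    by apply/nbhs_ballP; exists rho => // p; rewrite -ball_normE /= sub0r normrN.
  near=> q; split; [near: q; exact: KPsi|by near: q|by near: q].
(* the slice t = eps inside the domain of Psi *)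
have [eps e0 egood] : exists2 eps : R, 0 < eps &
    \forall q \near (((0, 0), (0, eps)) : P), good q.
  have ac : analytic_at (fun t : R => ((0, 0), (0, t)) : P) 0.
    apply: analytic_pair; first exact: analytic_cst.
    by apply: analytic_pair; [exact: analytic_cst|exact: analytic_id].
  have /nbhs_ballP[e /= e0 H] := near_comp ac (near_near goodn).
  exists (e / 2); first by rewrite divr_gt0.
  apply: H; rewrite -ball_normE /= sub0r normrN gtr0_norm; lra.
have ee : eps * eps^-1 = 1 by rewrite divff // gt_eqF.
pose c (q : X * X) : P := ((q.1, eps^-1 *: q.1), (q.2, eps)).
have ac q : analytic_at c q.
  apply: analytic_pair; apply: analytic_pair; [exact: analytic_fst|
    by apply: analyticZ; exact: analytic_fst|exact: analytic_snd|exact: analytic_cst].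
have pic q : pi (c q) = (q.1, q.1) by rewrite /pi /= scalerA ee scale1r.
have c0 : c 0 = ((0, 0), (0, eps)) by rewrite /c /= scaler0.
have cgood : \forall q \near 0, \forall p \near c q, good p.
  apply: (near_comp (P := fun q => \forall p \near q, good p) (ac 0)).
  by rewrite c0; exact: near_near.
(* on the slice, K is tangent to the distribution, with the parameter xi
   *)
have along : \forall x \near 0, forall xi,
    D Psi (c (x, 0)) ((eps *: m (x, x) xi, xi), (0, 0)) = 0.
  apply: (near_homog (T := fun x xi =>
      D Psi (c (x, 0)) ((eps *: m (x, x) xi, xi), (0, 0)) = 0)) => [x k xi k0 H|].
    apply: (scalerI k0); rewrite scaler0 -DZ -[RHS]H mZ; congr (D Psi _ _).
    congr (_, _); first by congr (_, _) => /=; rewrite !scalerA mulrC.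
    by congr (_, _) => /=; rewrite scaler0.
  near=> q => /=; have gq : \forall p \near c q, good p by near: q.
  have [gK gU gr] := nbhs_singleton gq.
  have gr' : `|kill_eta (c q)| < rho.
    exact: le_lt_trans (norm_kill_eta _) gr.
  have -> : c (q.1, 0) = kill_eta (c q) by [].
  have -> : ((eps *: m (q.1, q.1) q.2, q.2), (0, 0)) = D kill_eta (c q) (K (c q)).
    by rewrite dke /K pic.
  rewrite -(D_comp _ (ake _) (aPsi _ gr')) -[RHS]gK; apply: D_near_eq.
    exact: analytic_comp (ake _) (aPsi _ gr').
  apply: filterS gq => p [_ Up pr]; apply: Psi_eta => //; exact: ltW.
pose Phi x := Psi (c (x, 0)).
pose c' x := c (x, 0).
have ac' x : analytic_at c' x.
  have ax : analytic_at (fun x : X => (x, 0 : X)) x.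
    by apply: analytic_pair; [exact: analytic_id|exact: analytic_cst].
  exact: (analytic_comp ax (ac (x, 0))).
have dc' x v : D c' x v = ((v, eps^-1 *: v), (0, 0)).
  have a3 : analytic_at (fun x : X => eps^-1 *: x) x by apply: analyticZ; exact: analytic_id.
  have a4 : analytic_at (fun x : X => (x, eps^-1 *: x)) x.
    by apply: analytic_pair => //; exact: analytic_id.
  rewrite /c' /c /= D_pair //; last exact: analytic_cst.
  by rewrite D_cst D_pair // ?D_scale ?D_id //; exact: analytic_id.
have gx : \forall x \near 0, good (c' x).
  apply: (near_comp (ac' 0)); rewrite /c' c0; exact: egood.
have dPhi x v : good (c' x) -> D Phi x v = D Psi (c' x) ((v, eps^-1 *: v), (0, 0)).
  by move=> [_ _ xr]; rewrite -(dc' x) -D_comp //; exact: aPsi.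
have [g0K g0U g0r] : good (c' 0) by exact: nbhs_singleton gx.
have split_ x (u w : X) : D Psi (c' x) ((u, w), (0, 0)) =
    D Psi (c' x) (inj u) + D Psi (c' x) ((0, w), (0, 0)).
  by rewrite -DD /inj; congr (D Psi _ _); congr ((_, _), (_, _)) => /=; rewrite ?addr0 ?add0r.
have along0 := nbhs_singleton along.
exists Phi; split.
- exact: analytic_comp (ac' 0) (aPsi _ g0r).
- by rewrite /Phi Psi_w0 //= ?scaler0 //; exact: ltW.
- move=> v; rewrite dPhi // split_.
  have := along0 (eps^-1 *: v); rewrite m00 scaler0 => ->; rewrite addr0.
  have kc : kill_w (c' 0) = c' 0 by rewrite /c' c0.
  have ap : analytic_at Psi (kill_w (c' 0)) by rewrite kc; exact: aPsi.
  have -> : inj v = D kill_w (c' 0) (inj v) by rewrite dkw.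
  rewrite -{1}kc -(D_comp _ (akw _) ap) -[RHS](d11 (c' 0) (inj v)).
  apply: D_near_eq; first exact: (analytic_comp (akw _) ap).
  have : \forall p \near c' 0, good (kill_w p).
    by apply: (near_comp (akw _)); rewrite kc /c' c0.
  by apply: filterS => p [_ Up pr]; rewrite Psi_w0 //; exact: ltW.
near=> x => v v' vv'.
have gx_ : good (c' x) by near: x.
have [_ Ux xr] := gx_.
have ax : forall xi, D Psi (c' x) ((eps *: m (x, x) xi, xi), (0, 0)) = 0 by near: x.
have ix : involutive_at (x, x) by rewrite -(pic (x, 0)); exact: Uinv.
have [_ _ _ mI] := ix.
have red w : D Phi x w = D Psi (c' x) (inj (w - m (x, x) w)).
  rewrite dPhi // split_; have := ax (eps^-1 *: w).
  rewrite mZ scalerA ee scale1r split_ => /eqP; rewrite addrC addr_eq0 => /eqP ->.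
  by rewrite -DB /inj; congr (D Psi _ ((_, _), (_, _))) => /=; rewrite subr0.
rewrite !red -Psi_I //; congr (D Psi _ (inj _)).
have := congr1 I vv'; rewrite linearD I2 -mI linearB I2 opprK opprD mB.
rewrite linearB -mI; move: (m (x, x) (- I v)) => w.
by move/eqP; rewrite subr_eq => /eqP ->; module.
Unshelve. all: try by end_near. Qed.
End Frobenius.

(** * Holomorphic families of linear maps *)

Section LocalMaps.
Context (R : realType).
Implicit Types V X Y : normedModType R.

(** The differentials of g are the inverses of complex linear maps. *)
Lemma inverse_holo (E : completeNormedModType R) (K : E -> E) (f g : E -> E) :
  holo K K f 0 -> f 0 = 0 -> analytic_at g 0 -> (\forall x \near 0, f (g x) = x) ->
  (\forall x \near 0, g (f x) = x) -> holo K K g 0.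
Proof.
move=> hf f0 ag fg gf; split=> //.
have g0 : g 0 = 0 by rewrite -{1}f0; exact: nbhs_singleton gf.
have hfn : \forall x \near 0, holo K K f (g x).
  by apply: (near_comp ag); rewrite g0; exact: holo_near.
have gfn : \forall x \near 0, \forall y \near g x, g (f y) = y.
  apply: (near_comp (P := fun x => \forall y \near x, g (f y) = y) ag).
  by rewrite g0; exact: near_near.
have fgn := near_near fg; have agn := analytic_near ag.
near=> x => v.
have [afx /nbhs_singleton Kf] : holo K K f (g x) by near: x.
have gfx : \forall y \near g x, g (f y) = y by near: x.
have fgx : \forall y \near x, f (g y) = y by near: x.
have fgx0 : f (g x) = x by exact: nbhs_singleton fgx.
have agx : analytic_at g x by near: x.
have Dfg w : D f (g x) (D g x w) = w.
  rewrite -(D_comp _ agx afx) -[RHS](D_id x); apply: D_near_eq fgx.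
  exact: analytic_comp agx afx.
have agx' : analytic_at g (f (g x)) by rewrite fgx0.
have Dgf w : D g x (D f (g x) w) = w.
  have gE : D g (f (g x)) (D f (g x) w) = w.
    rewrite -(D_comp _ afx agx') -[RHS](D_id (g x)); apply: D_near_eq gfx.
    exact: analytic_comp afx agx'.
  by rewrite fgx0 in gE.
by rewrite -{1}(Dfg v) -Kf Dgf.
Unshelve. all: by end_near. Qed.

(** The map (y, b) |-> (y, b - E y b) is tangent to the identity at the origin,
    hence injective near it. For fixed y it is linear in b, so that small b
    suffice. *)
Lemma small_injective (V X : completeNormedModType R) (E : V -> X -> X) : (forall y k u v, E y (k *: u + v) = k *: E y u + E y v) ->
  (forall b, E 0 b = 0) -> (\forall y \near 0, forall b, analytic_at (fun p : V * X => E p.1 p.2) (y, b)) ->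
  \forall y \near 0, forall b, E y b = b -> b = 0.
Proof.
move=> El E0 aE.
pose EL y : {linear X -> X} := HB.pack (E y) (GRing.isLinear.Build _ _ _ _ _ (El y)).
have E_0 y : E y 0 = 0 by exact: (linear0 (EL y)).
have E_Z y k b : E y (k *: b) = k *: E y b by rewrite -[k *: b]addr0 El E_0 addr0.
have aE0 : forall b, analytic_at (fun p : V * X => E p.1 p.2) (0, b) by exact: nbhs_singleton aE.
pose f (p : V * X) := (p.1, p.2 - E p.1 p.2).
have a2 : analytic_at (fun p : V * X => p.2 - E p.1 p.2) (0, 0).
  by apply: analyticB => //; exact: analytic_snd.
have af : analytic_at f 0.
  by apply: analytic_pair a2; exact: analytic_fst.
have [|v|tau [s [g [t0 s0 _ [_ inj_ _]]]]] := local_inverse af.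
- by rewrite /f /= E_0 subrr.
- case: v => h k; rewrite /f D_pair //; last exact: analytic_fst.
  rewrite D_fst (D_sub _ (analytic_snd _) (aE0 0)).
  rewrite D_snd D_bundle //= E0.
  have -> : (fun y => E y 0) = fun=> 0 by apply/funext.
  by rewrite D_cst !addr0 subr0.
apply/near_homog => [y k b k0 H e|].
  by apply: (scalerI k0); rewrite scaler0 H // E_Z e.
have sn : \forall p \near (0 : V * X), `|p| <= s.
  apply/nbhs_ballP; exists s => // p; rewrite -ball_normE /= sub0r normrN.
  exact: ltW.
near=> p => e.
have ps : `|p| <= s by near: p.
have [p1s p2s] : `|p.1| <= s /\ `|p.2| <= s.
  by move: ps; rewrite prod_normE ge_max => /andP.
have p1s' : `|(p.1, 0) : V * X| <= s by rewrite prod_normE /= normr0 ge_max p1s ltW.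
have := inj_ p (p.1, 0) ps p1s'; rewrite /f /= e E_0 !subrr => /(_ (erefl _)).
by case: (p) => a b /= [].
Unshelve. all: by end_near. Qed.

End LocalMaps.

(** The inverse of a holomorphic family of linear maps close to the identity is
    read off the inverse of the local isomorphism (y, eta) |-> (y, q y eta). *)
Section InverseFamily.
Context (R : realType) (V X : completeNormedModType R).
Context (KV : {linear V -> V}) (KX : {linear X -> X}).
Hypothesis KXc : continuous KX.
Context (q : V -> X -> X).
Hypothesis qlin : forall y k u v, q y (k *: u + v) = k *: q y u + q y v.
Hypothesis q0 : forall eta, q 0 eta = eta.
Local Notation KK := (pair_lin KV KX).
Hypothesis hq : \forall y \near 0, forall eta,
  holo KK KX (fun p : V * X => q p.1 p.2) (y, eta).

Let A (p : V * X) : V * X := (p.1, q p.1 p.2).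

Let q_0 y : q y 0 = 0.
Proof.
pose L : {linear X -> X} := HB.pack (q y) (GRing.isLinear.Build _ _ _ _ _ (qlin y)).
exact: (linear0 L).
Qed.

Let aq : \forall y \near 0, forall eta, analytic_at (fun p : V * X => q p.1 p.2) (y, eta).
Proof. by apply: filterS hq => y hy eta; have [] := hy eta. Qed.

Let hA : holo KK KK A 0.
Proof.
apply: holo_pair; first exact: holo_fst.
exact: (nbhs_singleton hq).
Qed.

Let dA : \forall y \near 0, forall eta h,
  D A (y, eta) h = (h.1, D (q^~ eta) y h.1 + q y h.2).
Proof.
apply: filterS aq => y ay eta [h k]; rewrite D_pair //; last exact: analytic_fst.
by rewrite D_fst D_bundle.
Qed.

Lemma inverse_family : exists S : V -> X -> X,
  [/\ forall y k u v, S y (k *: u + v) = k *: S y u + S y v,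
      \forall y \near 0, forall eta, holo KK KX (fun p : V * X => S p.1 p.2) (y, eta)
    & \forall y \near 0, forall eta, q y (S y eta) = eta].
Proof.
have A0 : A 0 = 0 by rewrite /A /= q_0.
have [aA _] := hA.
have [|tau [s [g [t0 s0 [M pg] [fg inj_ _]]]]] := local_inverse aA A0.
  case=> h k; rewrite (nbhs_singleton dA) /= q0.
  have -> : q^~ 0 = fun=> 0 by apply/funext => y; rewrite q_0.
  by rewrite D_cst add0r.
have ag : analytic_at g 0 := pser_analytic pg.
have near_le (r : R) : 0 < r -> \forall p \near (0 : V * X), `|p| <= r.
  move=> r0; apply/nbhs_ballP; exists r => // p; rewrite -ball_normE /= sub0r normrN.
  exact: ltW.
have Ag : \forall x \near 0, A (g x) = x.
  by apply: filterS (near_le _ t0) => x /fg[].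
have gA : \forall x \near 0, g (A x) = x.
  have h : \forall x \near 0, `|A x| <= tau.
    by apply: (near_comp (P := fun x => `|x| <= tau) aA); rewrite A0; exact: near_le.
  have h' := near_le _ s0; near=> x; have xt : `|A x| <= tau by near: x.
  have [gs e] := fg _ xt.
  have xs : `|x| <= s by near: x.
  exact: (inj_ _ _ (ltW gs) xs e).
have hg := inverse_holo hA A0 ag Ag gA.
pose g2 p := (g p).2.
have hg2 : holo KK KX g2 0 by exact: (holo_comp hg (holo_snd _ _ _)).
pose S y eta := D g2 (y, 0) (0, eta).
have ain : analytic_at (fun y : V => (y, 0 : X)) 0.
  by apply: analytic_pair; [exact: analytic_id|exact: analytic_cst].
exists S; split=> [y k u v||].
- rewrite /S -DZ -DD; congr (D g2 _ _).
  by congr (_, _) => /=; rewrite scaler0 addr0.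
- have hg2n : \forall y \near (0 : V), holo KK KX g2 (y, 0).
    by apply: (near_comp (P := fun p => holo KK KX g2 p) ain); exact: holo_near.
  apply: filterS hg2n => y hy eta.
  apply: (holo_along (I' := KK) (f := g2) (g := fun p : V * X => (p.1, 0))
     (G := fun p : V * X => (0, p.2))).
  - exact: KXc.
  - exact: hy.
  - exact: (holo_pair (holo_fst _ _ _) (holo_cst KK KX 0 _)).
  - exact: (holo_pair (holo_cst KK KV 0 _) (holo_snd _ _ _)).
pose good p := [/\ A (g p) = p, \forall p' \near p, A (g p') = p', g (A p) = p,
  analytic_at g p & analytic_at A p].
have goodn : \forall p \near 0, good p.
  have Agn := near_near Ag; have agn := analytic_near ag; have aAn := analytic_near aA.
  by near=> p; split; near: p.
have H := near_comp (P := good) ain goodn.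
near=> y => eta.
have [_ Agy gAy agy aAy] : good (y, 0) by near: y.
have gy : g (y, 0) = (y, 0) by rewrite -{2}gAy /A /= q_0.
have aAg : analytic_at A (g (y, 0)) by rewrite gy.
have e : D A (y, 0) (D g (y, 0) (0, eta)) = (0, eta).
  rewrite -{1}gy -(D_comp _ agy aAg) -[RHS](D_id (y, 0 : X)); apply: D_near_eq Agy.
  exact: (analytic_comp agy aAg).
have dAy : forall eta h, D A (y, eta) h = (h.1, D (q^~ eta) y h.1 + q y h.2) by near: y.
move: e; rewrite dAy => -[e1]; rewrite e1 D0 add0r => e2; rewrite -[RHS]e2.
by rewrite /S /g2 (D_comp (g := snd) _ agy (analytic_snd _)) D_snd.
Unshelve. all: by end_near. Qed.

End InverseFamily.

(** * The antiholomorphic distribution *)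

(** The complexification of the space X with an almost complex structure J is V
    = X * X, where X is the diagonal. J extends to a holomorphic family JJ of
    complex linear maps with JJ * JJ = -1. Its eigenvectors for -II are the
    antiholomorphic directions of J: the functions constant along them restrict
    on the diagonal to the functions f with D f (J v) = I (D f v). They form a
    distribution, the graph of m, which is involutive because J has no torsion.
    *)
Section Antiholomorphic.
Context (R : realType) (X : completeNormedModType R) (I : {linear X -> X}).
Hypotheses (Ic : continuous I) (I2 : forall v, I (I v) = - v).
Context (J : X -> X -> X).
Local Notation II := (dbl I).

Let V : Type := (X * X)%type.
Context (JJ : V -> V -> V).
Hypothesis hJJ : \forall y \near 0, forall u,
  holo (pair_lin II II) II (fun p : V * V => JJ p.1 p.2) (y, u).
Hypothesis JJlin : forall y k u v, JJ y (k *: u + v) = k *: JJ y u + JJ y v.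
Hypothesis JJdiag : \forall x \near 0, forall v, JJ (diag x) (diag v) = diag (J x v).
Hypothesis J2 : \forall x \near 0, forall v, J x (J x v) = - v.
Hypothesis J0 : forall v, J 0 v = I v.
Hypothesis JN : \forall x \near 0, forall u v,
  J x (D (J^~ u) x v) - J x (D (J^~ v) x u)
  - D (J^~ u) x (J x v) + D (J^~ v) x (J x u) = 0.

Let JL y : {linear V -> V} := HB.pack (JJ y) (GRing.isLinear.Build _ _ _ _ _ (JJlin y)).
Let JJ_0 y : JJ y 0 = 0. Proof. exact: (linear0 (JL y)). Qed.
Let JJD y u v : JJ y (u + v) = JJ y u + JJ y v. Proof. exact: (linearD (JL y)). Qed.
Let JJN y u : JJ y (- u) = - JJ y u. Proof. exact: (linearN (JL y)). Qed.
Let JJZ y k u : JJ y (k *: u) = k *: JJ y u.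
Proof. by rewrite -[k *: u]addr0 JJlin JJ_0 addr0. Qed.

Let IIc : continuous II. Proof. exact: dbl_continuous. Qed.
Let II2 u : II (II u) = - u. Proof. exact: dbl2. Qed.

Let IID u v : II (u + v) = II u + II v. Proof. exact: linearD. Qed.
Let IIN u : II (- u) = - II u. Proof. exact: linearN. Qed.
Let IIZ k u : II (k *: u) = k *: II u. Proof. exact: linearZ_LR. Qed.

Let iota2 : {linear (X * X)%type -> (V * V)%type} := pair_lin (@diag R X) (@diag R X).
Let iota3 : {linear ((X * X) * X)%type -> ((V * V) * V)%type} := pair_lin iota2 (@diag R X).
Let iota2c : continuous iota2.
Proof. by apply: pair_lin_continuous; exact: diag_continuous. Qed.
Let iota3c : continuous iota3.
Proof. by apply: pair_lin_continuous; [exact: iota2c|exact: diag_continuous]. Qed.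
Let span2 (y : V * V) : exists a b, y = iota2 a + pair_lin II II (iota2 b).
Proof.
case: y => y u; exists (mean y, mean u), (mean (I y.2, - I y.1), mean (I u.2, - I u.1)).
by rewrite /iota2 /= /pair_lin /=; congr (_, _); exact: dbl_split.
Qed.
Let span3 (y : (V * V) * V) :
  exists a b, y = iota3 a + pair_lin (pair_lin II II) II (iota3 b).
Proof.
case: y => y u; have [a [b ->]] := span2 y.
exists (a, mean u), (b, mean (I u.2, - I u.1)).
by rewrite /iota3 /= /pair_lin /=; congr (_, _); exact: dbl_split.
Qed.

Let hJJ0 u : holo (pair_lin II II) II (fun p : V * V => JJ p.1 p.2) (0, u).
Proof. by have := nbhs_singleton hJJ; apply. Qed.

(** Like every holomorphic identity below, it holds on the diagonal and hence
    everywhere near the origin. *)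
Let JJ2 : \forall y \near 0, forall u, JJ y (JJ y u) = - u.
Proof.
apply/near_homog => [y k u k0 H|].
  by apply: (scalerI k0); rewrite -!JJZ H scalerN.
have h1 : holo (pair_lin II II) II (fun p : V * V => JJ p.1 (JJ p.1 p.2) + p.2) 0.
  apply: holoD; last exact: holo_snd.
  apply: (holo_comp (f := fun p : V * V => (p.1, JJ p.1 p.2)) (g := fun p => JJ p.1 p.2)).
    by apply: holo_pair; [exact: holo_fst|exact: hJJ0].
  exact: hJJ0.
have h2 : \forall q \near 0, (fun p : V * V => JJ p.1 (JJ p.1 p.2) + p.2) (iota2 q) = 0.
  have h3 : \forall q \near (0 : X * X), (forall v, JJ (diag q.1) (diag v) = diag (J q.1 v))
      /\ forall v, J q.1 (J q.1 v) = - v.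
    apply: (near_comp (f := fst) (P := fun x => (forall v, JJ (diag x) (diag v) = diag (J x v))
      /\ forall v, J x (J x v) = - v)); first exact: analytic_fst.
    by near=> x; split; near: x.
  apply: filterS h3 => q [e1 e2] /=.
  by rewrite !e1 e2 linearN addNr.
have := holo_identity IIc iota2c span2 h1 h2.
by apply: filterS => p /eqP; rewrite addr_eq0 => /eqP.
Unshelve. all: by end_near. Qed.

Let JJD1 y u v w : (forall u, analytic_at (fun p : V * V => JJ p.1 p.2) (y, u)) ->
  D (fun p : V * V => JJ p.1 p.2) (y, u) (v, w) = D (JJ^~ u) y v + JJ y w.
Proof. by move=> aJ; rewrite D_bundle. Qed.

Let JJI : \forall y \near 0, forall u, JJ y (II u) = II (JJ y u).
Proof.
apply: filterS hJJ => y hy u; have [_ /nbhs_singleton/(_ (0, u))] := hy 0.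
rewrite /pair_lin /= !JJD1; try by move=> z; have [] := hy z.
by rewrite !D0 !add0r linear0 D0 add0r.
Qed.

Let JJ_dir : \forall y \near 0, forall u v,
  D (JJ^~ u) y (II v) = II (D (JJ^~ u) y v).
Proof.
apply: filterS hJJ => y hy u v; have [_ /nbhs_singleton/(_ (v, 0))] := hy u.
rewrite /pair_lin /= !JJD1; try by move=> z; have [] := hy z.
by rewrite linear0 JJ_0 !addr0.
Qed.

Let JJ0 u : JJ 0 u = (I u.1, I u.2).
Proof.
have e1 : forall v, JJ 0 (diag v) = diag (I v).
  by move=> v; have := nbhs_singleton JJdiag v; rewrite linear0 J0.
have e2 := nbhs_singleton JJI.
rewrite {1}(dbl_split I2 u) JJD e1 e2 e1.
set a := mean u; set b := mean _.
transitivity (I (diag a + II (diag b)).1, I (diag a + II (diag b)).2).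
  by rewrite /diag /dbl /pair_lin /= linearD linearB.
by rewrite -dbl_split.
Qed.

Let aJJ : \forall y \near 0, forall u, analytic_at (fun p : V * V => JJ p.1 p.2) (y, u).
Proof. by apply: filterS hJJ => y hy u; have [] := hy u. Qed.

Let adir y u : (forall u, analytic_at (fun p : V * V => JJ p.1 p.2) (y, u)) ->
  analytic_at (JJ^~ u) y.
Proof.
move=> aJ; have ay : analytic_at (fun y : V => (y, u)) y.
  by apply: analytic_pair; [exact: analytic_id|exact: analytic_cst].
exact: (analytic_comp ay (aJ u)).
Qed.

(** The torsion of JJ on constant fields, written without brackets. *)
Let tors y u v := JJ y (D (JJ^~ u) y v) - JJ y (D (JJ^~ v) y u)
  - D (JJ^~ u) y (JJ y v) + D (JJ^~ v) y (JJ y u).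

Let torsC y u v : tors y u v = - tors y v u.
Proof. by rewrite /tors; module. Qed.

Let torsZ y u k v : (forall u, analytic_at (fun p : V * V => JJ p.1 p.2) (y, u)) ->
  tors y u (k *: v) = k *: tors y u v.
Proof.
move=> aJ; rewrite /tors.
have E w : D (JJ^~ (k *: v)) y w = k *: D (JJ^~ v) y w.
  rewrite -D_scale; last exact: adir.
  by congr (D _ y w); apply/funext => z; rewrite JJZ.
rewrite !E !DZ !JJZ DZ; module.
Qed.

Let JJtorsion : \forall y \near 0, forall u v, tors y u v = 0.
Proof.
pose K3 : {linear ((V * V) * V)%type -> ((V * V) * V)%type} := pair_lin (pair_lin II II) II.
have hC (a b : (V * V) * V -> V) : a 0 = 0 -> holo K3 II a 0 -> holo K3 II b 0 ->
    holo K3 II (fun q => JJ (a q) (b q)) 0.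
  move=> a0 ha hb; apply: (holo_comp (holo_pair ha hb) (g := fun p => JJ p.1 p.2)).
  by rewrite a0.
have hD (a b c : (V * V) * V -> V) : a 0 = 0 -> holo K3 II a 0 -> holo K3 II b 0 ->
    holo K3 II c 0 -> holo K3 II (fun q => D (fun p : V * V => JJ p.1 p.2) (a q, b q) (c q, 0)) 0.
  move=> a0 ha hb hc.
  apply: (holo_along (I' := pair_lin II II) (f := fun p : V * V => JJ p.1 p.2)
    (g := fun q => (a q, b q)) (G := fun q => (c q, 0))) => //.
  - by rewrite a0.
  - exact: (holo_pair ha hb).
  - exact: (holo_pair hc (holo_cst K3 II 0 0)).
have h1 : holo K3 II (fun q => q.1.1) 0.
  by apply: (holo_comp (f := fst) (g := fst)); [exact: holo_fst|exact: holo_fst].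
have h2 : holo K3 II (fun q => q.1.2) 0.
  by apply: (holo_comp (f := fst) (g := snd)); [exact: holo_fst|exact: holo_snd].
have h3 : holo K3 II (fun q => q.2) 0 by exact: holo_snd.
pose Tf (y u v : V) := D (fun p : V * V => JJ p.1 p.2) (y, u) (v, 0).
pose G (q : (V * V) * V) := JJ q.1.1 (Tf q.1.1 q.1.2 q.2) - JJ q.1.1 (Tf q.1.1 q.2 q.1.2)
  - Tf q.1.1 q.1.2 (JJ q.1.1 q.2) + Tf q.1.1 q.2 (JJ q.1.1 q.1.2).
have TE y u v : (forall u, analytic_at (fun p : V * V => JJ p.1 p.2) (y, u)) ->
    Tf y u v = D (JJ^~ u) y v.
  by move=> aJ; rewrite /Tf JJD1 // JJ_0 addr0.
have GT y u v : (forall u, analytic_at (fun p : V * V => JJ p.1 p.2) (y, u)) ->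
    G ((y, u), v) = tors y u v.
  by move=> aJ; rewrite /G /= !TE.
have hG : holo K3 II G 0.
  have t1 := hD _ _ _ (erefl _) h1 h2 h3; have t2 := hD _ _ _ (erefl _) h1 h3 h2.
  have c1 := hC _ _ (erefl _) h1 t1; have c2 := hC _ _ (erefl _) h1 t2.
  have t3 := hD _ _ _ (erefl _) h1 h2 (hC _ _ (erefl _) h1 h3).
  have t4 := hD _ _ _ (erefl _) h1 h3 (hC _ _ (erefl _) h1 h2).
  exact: (holoD (holoB (holoB c1 c2) t3) t4).
have G0 : \forall q \near 0, G (iota3 q) = 0.
  have cd := linear_analytic (0 : X) (@diag_continuous R X).
  have aJd : \forall x \near (0 : X), forall u,
      analytic_at (fun p : V * V => JJ p.1 p.2) (diag x, u).
    by apply: (near_comp (P := fun y => forall u,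
      analytic_at (fun p : V * V => JJ p.1 p.2) (y, u)) cd); rewrite linear0.
  have JJdn := near_near JJdiag.
  have H : \forall x \near (0 : X), forall u v, tors (diag x) (diag u) (diag v) = 0.
    near=> x => u v.
    have ax : forall u, analytic_at (fun p : V * V => JJ p.1 p.2) (diag x, u) by near: x.
    have ex : \forall x \near x, forall v, JJ (diag x) (diag v) = diag (J x v) by near: x.
    have cdx : analytic_at (@diag R X) x by apply: linear_analytic; exact: diag_continuous.
    have aJ w : analytic_at (J^~ w) x.
      apply: (analytic_ext (f := fun x => mean (JJ (diag x) (diag w)))).
        by apply: filterS ex => z ez; rewrite ez mean_diag.
      apply: analytic_comp_linear (@mean_continuous R X) _.
      exact: (analytic_comp cdx (adir (diag w) ax)).
    have E w w' : D (JJ^~ (diag w)) (diag x) (diag w') = diag (D (J^~ w) x w').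
      rewrite -(D_comp_lin _ (@diag_continuous R X) (aJ w)).
      rewrite -[X in D _ _ X](D_lin x _ (@diag_continuous R X)).
      rewrite -(D_comp _ cdx (adir (diag w) ax)); apply: D_near_eq.
        exact: (analytic_comp cdx (adir (diag w) ax)).
      by apply: filterS ex => z ez; rewrite ez.
    have ex0 := nbhs_singleton ex.
    have N0 : forall u v, J x (D (J^~ u) x v) - J x (D (J^~ v) x u)
      - D (J^~ u) x (J x v) + D (J^~ v) x (J x u) = 0 by near: x.
    rewrite /tors !E !ex0 !E.
    by rewrite -[RHS](linear0 (@diag R X)) -(N0 u v) linearD !linearB.
  have H' : \forall x \near (0 : X), (forall u v, tors (diag x) (diag u) (diag v) = 0) /\
     forall u, analytic_at (fun p : V * V => JJ p.1 p.2) (diag x, u).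
    by near=> x; split; near: x.
  have a11 : analytic_at (fun q : (X * X) * X => q.1.1) 0.
    by apply: (analytic_comp (f := fst)); [exact: analytic_fst|exact: analytic_fst].
  have := near_comp (P := fun x => (forall u v, tors (diag x) (diag u) (diag v) = 0) /\
     forall u, analytic_at (fun p : V * V => JJ p.1 p.2) (diag x, u)) a11 H'.
  apply: filterS => q [t aJ].
  by rewrite -[iota3 q]/((diag q.1.1, diag q.1.2), diag q.2) GT // t.
have Gn := holo_identity IIc iota3c span3 hG G0.
have Gn' : \forall q \near (0 : (V * V) * V), (forall u, analytic_at (fun p : V * V => JJ p.1 p.2) (q.1.1, u)) ->
    tors q.1.1 q.1.2 q.2 = 0.
  by apply: filterS Gn => -[[y u] v] Gq aJ; rewrite -GT.
have Gn2 : \forall p \near (0 : V * V), forall v, (forall u, analytic_at (fun p : V * V => JJ p.1 p.2) (p.1, u)) ->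
    tors p.1 p.2 v = 0.
  apply: near_homog Gn' => p k v k0 H aJ; apply: (scalerI k0).
  by rewrite -torsZ // H // scaler0.
have Gn3 : \forall y \near (0 : V), forall u v, (forall u, analytic_at (fun p : V * V => JJ p.1 p.2) (y, u)) ->
    tors y u v = 0.
  apply: near_homog Gn2 => y k v k0 H u aJ; apply: (scalerI k0).
  by rewrite torsC scalerN -torsZ // -torsC H // scaler0.
by near=> y => u v; apply: (near Gn3 y) => //; near: y.
Unshelve. all: by end_near. Qed.

(** The projection onto the eigenvectors of JJ y for -II. *)
Let Q y u := 2^-1 *: (u + II (JJ y u)).

Let Qlin y k u v : Q y (k *: u + v) = k *: Q y u + Q y v.
Proof. by rewrite /Q JJlin IID IIZ; module. Qed.
Let QL y : {linear V -> V} := HB.pack (Q y) (GRing.isLinear.Build _ _ _ _ _ (Qlin y)).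
Let Q_0 y : Q y 0 = 0. Proof. exact: (linear0 (QL y)). Qed.

Let half : (2^-1 + 2^-1 : R) = 1. Proof. by field. Qed.

Let Q0 u : Q 0 u = (0, u.2).
Proof.
rewrite /Q JJ0 /dbl /pair_lin /= !I2 opprK; case: u => u1 u2; congr (_, _) => /=.
  by rewrite subrr scaler0.
by rewrite scalerDr -scalerDl half scale1r.
Qed.

Let hQ : \forall y \near 0, forall u,
  holo (pair_lin II II) II (fun p : V * V => Q p.1 p.2) (y, u).
Proof.
apply: filterS hJJ => y hy u; apply: holoZ; apply: holoD; first exact: holo_snd.
exact: (holo_comp_lin IIc _ (hy u)).
Qed.

Let JJQ : \forall y \near 0, forall u, JJ y (Q y u) = - II (Q y u).
Proof.
near=> y => u; rewrite /Q JJZ IIZ JJD IID II2.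
have -> : JJ y (II (JJ y u)) = II (JJ y (JJ y u)) by move: (JJ y u); near: y.
have -> : JJ y (JJ y u) = - u by move: u; near: y.
by rewrite IIN; module.
Unshelve. all: by end_near. Qed.

Let Qfix y u : JJ y u = - II u -> Q y u = u.
Proof.
move=> e; rewrite /Q e IIN II2 opprK -[X in _ *: (X + _)]scale1r -[X in _ *: (_ + X)]scale1r.
by rewrite -scalerDl scalerA mulVf ?scale1r // pnatr_eq0.
Qed.

Let KK : {linear (V * X)%type -> (V * X)%type} := pair_lin II (\- I).
(** At y = 0 the eigenvectors are those of the second factor; nearby they form a
    graph over it, and q y is the map to be inverted in order to parametrize it.
    *)
Let q y eta := (Q y (0, eta)).2.

Let in2 (eta : X) : V := (0, eta).
Let in1 (b : X) : V := (b, 0).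
Let in2_linear : linear in2.
Proof. by move=> k u v; congr (_, _) => /=; rewrite scaler0 addr0. Qed.
HB.instance Definition _ := GRing.isLinear.Build R X (X * X)%type _ in2 in2_linear.
Let in1_linear : linear in1.
Proof. by move=> k u v; congr (_, _) => /=; rewrite scaler0 addr0. Qed.
HB.instance Definition _ := GRing.isLinear.Build R X (X * X)%type _ in1 in1_linear.
Let in2c : continuous in2.
Proof. by move=> z; apply: cvg_pair; [exact: cvg_cst|exact: cvg_id]. Qed.
Let in1c : continuous in1.
Proof. by move=> z; apply: cvg_pair; [exact: cvg_id|exact: cvg_cst]. Qed.
Let in2I eta : in2 ((\- I) eta) = II (in2 eta).
Proof. by rewrite /in2 /dbl /pair_lin /= linear0. Qed.

Let qlin y k u v : q y (k *: u + v) = k *: q y u + q y v.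
Proof. by rewrite /q -/(in2 _) linearP Qlin. Qed.

Let hin2 eta : holo (\- I) II in2 eta.
Proof. by apply: holo_lin => // v; rewrite in2I. Qed.

Let hq : \forall y \near 0, forall eta,
  holo KK (\- I) (fun p : V * X => q p.1 p.2) (y, eta).
Proof.
apply: filterS hQ => y hy eta.
have h2 : holo KK II (fun p : V * X => in2 p.2) (y, eta).
  apply: (holo_comp (f := snd) (g := in2)); first exact: holo_snd.
  by apply: holo_lin => // v; rewrite in2I.
have h := holo_comp (holo_pair (holo_fst _ _ (y, eta)) h2) (hy (0, eta)).
exact: (holo_comp h (holo_snd _ _ _)).
Qed.

Let q0 eta : q 0 eta = eta. Proof. by rewrite /q Q0. Qed.
Let q_0 y : q y 0 = 0. Proof. by rewrite /q Q_0. Qed.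

Let Qfixb : \forall y \near 0, forall b, Q y (b, 0) = (b, 0) -> b = 0.
Proof.
have : \forall y \near 0, forall b, (Q y (in1 b)).1 = b -> b = 0.
  apply: (@small_injective R V X (fun y b => (Q y (in1 b)).1)) => [y k u v|b|].
  - by rewrite linearP Qlin.
  - by rewrite Q0.
  apply: filterS hQ => y hy b; have [aQ _] := hy (b, 0).
  have a1 : analytic_at (fun p : V * X => (p.1, in1 p.2)) (y, b).
    apply: analytic_pair; first exact: analytic_fst.
    exact: analytic_comp_linear in1c (analytic_snd _).
  exact: (analytic_comp (analytic_comp a1 aQ) (analytic_fst _)).
by apply: filterS => y H b e; apply: H; rewrite /in1 e.
Qed.

Section Distribution.
Context (S : V -> X -> X).
Hypothesis Slin : forall y k u v, S y (k *: u + v) = k *: S y u + S y v.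
Hypothesis hS : \forall y \near 0, forall eta,
  holo KK (\- I) (fun p : V * X => S p.1 p.2) (y, eta).
Hypothesis qS : \forall y \near 0, forall eta, q y (S y eta) = eta.

Let m y eta := (Q y (0, S y eta)).1.

Let mlin y k u v : m y (k *: u + v) = k *: m y u + m y v.
Proof. by rewrite /m Slin -/(in2 _) linearP Qlin. Qed.

Let m0 eta : m 0 eta = 0. Proof. by rewrite /m Q0. Qed.

Let hm : \forall y \near (0 : V), forall eta, holo KK I (fun p : V * X => m p.1 p.2) (y, eta).
Proof.
near=> y => eta.
have hSy : forall eta, holo KK (\- I) (fun p : V * X => S p.1 p.2) (y, eta) by near: y.
have hQy : forall u, holo (pair_lin II II) II (fun p : V * V => Q p.1 p.2) (y, u) by near: y.
have h2 : holo KK II (fun p : V * X => in2 (S p.1 p.2)) (y, eta).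
  exact: (holo_comp (hSy eta) (hin2 _)).
have h := holo_comp (holo_pair (holo_fst _ _ (y, eta)) h2) (hQy _).
exact: (holo_comp h (holo_fst _ _ _)).
Unshelve. all: by end_near. Qed.

Let JJm : \forall y \near 0, forall eta, JJ y (m y eta, eta) = - II (m y eta, eta).
Proof.
near=> y => eta; have qy : forall eta, q y (S y eta) = eta by near: y.
have JQy : forall u, JJ y (Q y u) = - II (Q y u) by near: y.
have -> : (m y eta, eta) = Q y (0, S y eta).
  by rewrite /m [RHS]surjective_pairing; congr (_, _); exact: esym (qy eta).
exact: JQy.
Unshelve. all: by end_near. Qed.

Let am : \forall y \near 0, forall eta, analytic_at (m^~ eta) y.
Proof.
apply: filterS hm => y hy eta; have [a _] := hy eta.
have ay : analytic_at (fun y : V => (y, eta)) y.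
  by apply: analytic_pair; [exact: analytic_id|exact: analytic_cst].
exact: (analytic_comp ay a).
Qed.

Let dJJm : \forall y \near 0, forall eta w,
  D (JJ^~ (m y eta, eta)) y w + JJ y (in1 (D (m^~ eta) y w)) = - II (in1 (D (m^~ eta) y w)).
Proof.
have JJmn := near_near JJm.
near=> y => eta w.
have aJ : forall u, analytic_at (fun p : V * V => JJ p.1 p.2) (y, u) by near: y.
have amy : analytic_at (m^~ eta) y by move: eta; near: y.
have e : \forall z \near y, forall eta, JJ z (m z eta, eta) = - II (m z eta, eta) by near: y.
have aU : analytic_at (fun z => (m z eta, eta)) y.
  by apply: analytic_pair amy _; exact: analytic_cst.
have dU : D (fun z => (m z eta, eta)) y w = in1 (D (m^~ eta) y w).
  by rewrite D_pair ?D_cst //; exact: analytic_cst.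
have ap := analytic_pair (analytic_id y) aU.
rewrite -dU -(D_comp_lin _ IIc aU) -D_opp; last exact: analytic_comp_linear IIc aU.
transitivity (D (fun z => JJ z (m z eta, eta)) y w).
  rewrite (D_comp (g := fun p : V * V => JJ p.1 p.2) _ ap (aJ _)).
  by rewrite (D_pair _ (analytic_id y) aU) D_id JJD1.
apply: D_near_eq; first exact: analytic_comp ap (aJ _).
by apply: filterS e.
Unshelve. all: by end_near. Qed.

(** For eigenvectors u and v of JJ for -II, differentiated within the
    distribution, the torsion is -(JJ + II)^2 B where B = (b, 0) is the
    difference of the two derivatives of the sections. Hence B is an eigenvector
    for -II as well; as these vectors are determined by their second component,
    b = 0. *)
Let invol y eta xi (u := (m y eta, eta)) (v := (m y xi, xi)) :
  tors y u v = 0 -> JJ y u = - II u -> JJ y v = - II v ->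
  (forall w, JJ y (II w) = II (JJ y w)) -> (forall w, JJ y (JJ y w) = - w) ->
  (forall u w, D (JJ^~ u) y (II w) = II (D (JJ^~ u) y w)) ->
  (forall eta w, D (JJ^~ (m y eta, eta)) y w + JJ y (in1 (D (m^~ eta) y w)) =
    - II (in1 (D (m^~ eta) y w))) ->
  (forall b, Q y (b, 0) = (b, 0) -> b = 0) ->
  D (m^~ eta) y v = D (m^~ xi) y u.
Proof.
move=> t0 Ju Jv cJ sJ dI dm fix0; apply/eqP; rewrite -subr_eq0; apply/eqP.
apply: fix0; rewrite -/(in1 _).
have -> : in1 (D (m^~ eta) y v - D (m^~ xi) y u) =
    in1 (D (m^~ eta) y v) - in1 (D (m^~ xi) y u) by exact: linearB.
set a := in1 (D (m^~ eta) y v); set b := in1 (D (m^~ xi) y u).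
have Tu : D (JJ^~ u) y v = - II a - JJ y a by rewrite -(dm eta v) addrK.
have Tv : D (JJ^~ v) y u = - II b - JJ y b by rewrite -(dm xi u) addrK.
move: t0; rewrite /tors Ju Jv !DN !dI Tu Tv.
rewrite !(JJD, JJN, IID, IIN) !cJ !sJ !II2 !opprK => e.
have e2 : II (JJ y a) - II (JJ y b) = a - b.
  apply: (@scalerI _ _ (2 : R)); first by rewrite pnatr_eq0.
  apply/eqP; rewrite -subr_eq0; apply/eqP; rewrite -[RHS]oppr0 -e; module.
rewrite /Q JJD JJN IID IIN e2 -[X in _ *: (X + _)]scale1r -[X in _ *: (_ + X)]scale1r.
by rewrite -scalerDl scalerA mulVf ?scale1r // pnatr_eq0.
Qed.

Let minv : \forall y \near 0, involutive_at I m y.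
Proof.
near=> y.
have hmy : forall eta, holo KK I (fun p : V * X => m p.1 p.2) (y, eta) by near: y.
have amy eta : analytic_at (fun p : V * X => m p.1 p.2) (y, eta) by have [] := hmy eta.
have mI eta v w : D (m^~ eta) y (II v) + m y (- I w) = I (D (m^~ eta) y v + m y w).
  have [_ /nbhs_singleton/(_ (v, w))] := hmy eta.
  by rewrite /KK /= /pair_lin /= !D_bundle.
have m_0 : m y 0 = 0.
  have := mlin y 1 0 0; rewrite !scale1r addr0 => /eqP.
  by rewrite -subr_eq subrr eq_sym => /eqP.
split=> // [eta u|eta xi|eta].
- by have := mI eta u 0; rewrite linear0 oppr0 m_0 !addr0.
- have t0 : forall u v, tors y u v = 0 by near: y.
  have JU : forall eta, JJ y (m y eta, eta) = - II (m y eta, eta) by near: y.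
  have cJ : forall w, JJ y (II w) = II (JJ y w) by near: y.
  have sJ : forall w, JJ y (JJ y w) = - w by near: y.
  have dI : forall u w, D (JJ^~ u) y (II w) = II (D (JJ^~ u) y w) by near: y.
  have dm : forall eta w, D (JJ^~ (m y eta, eta)) y w + JJ y (in1 (D (m^~ eta) y w)) =
    - II (in1 (D (m^~ eta) y w)) by near: y.
  have fix0 : forall b, Q y (b, 0) = (b, 0) -> b = 0 by near: y.
  exact: invol (t0 _ _) (JU _) (JU _) cJ sJ dI dm fix0.
- by have := mI 0 0 eta; rewrite linear0 !D0 !add0r.
Unshelve. all: by end_near. Qed.

(** The vector diag v + II (JJ (diag v)) is twice the projection of diag v, so
    it lies on the graph of m; this is the equation that frobenius asks for. *)
Lemma straightened_with : exists Phi : X -> X,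
  [/\ analytic_at Phi 0, Phi 0 = 0, forall v, D Phi 0 v = v
    & \forall x \near 0, forall v, D Phi x (J x v) = I (D Phi x v)].
Proof.
have [Phi [aP P0 DP PI]] := frobenius Ic mlin m0 minv I2.
exists Phi; split=> //.
have cd := linear_analytic (0 : X) (@diag_continuous R X).
have H : \forall y \near 0, [/\ forall u, JJ y (Q y u) = - II (Q y u),
    forall b, Q y (b, 0) = (b, 0) -> b = 0 &
    forall eta, JJ y (m y eta, eta) = - II (m y eta, eta)].
  by near=> y; split; near: y.
have {}H : \forall x \near (0 : X), [/\ forall u, JJ (diag x) (Q (diag x) u) = - II (Q (diag x) u),
    forall b, Q (diag x) (b, 0) = (b, 0) -> b = 0 &
    forall eta, JJ (diag x) (m (diag x) eta, eta) = - II (m (diag x) eta, eta)].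
  apply: (near_comp (P := fun y => [/\ forall u, JJ y (Q y u) = - II (Q y u),
    forall b, Q y (b, 0) = (b, 0) -> b = 0 &
    forall eta, JJ y (m y eta, eta) = - II (m y eta, eta)]) cd).
  by rewrite linear0.
near=> x => v; apply: (near PI x) => //.
have [JQ fix0 Jm] : [/\ forall u, JJ (diag x) (Q (diag x) u) = - II (Q (diag x) u),
    forall b, Q (diag x) (b, 0) = (b, 0) -> b = 0 &
    forall eta, JJ (diag x) (m (diag x) eta, eta) = - II (m (diag x) eta, eta)] by near: x.
have Jx : forall v, JJ (diag x) (diag v) = diag (J x v) by near: x.
pose w : V := (v + I (J x v), v - I (J x v)).
have wE : w = 2 *: Q (diag x) (diag v).
  rewrite /Q scalerA divff ?pnatr_eq0 // scale1r Jx.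
  by [].
have Jw : JJ (diag x) w = - II w by rewrite wE JJZ JQ (IIZ 2) scalerN.
rewrite -/(diag x); apply/eqP; rewrite -subr_eq0; apply/eqP; apply: fix0.
have -> : (v + I (J x v) - m (diag x) (v - I (J x v)), 0) = w - (m (diag x) w.2, w.2) :> V.
  by congr (_, _); rewrite /= subrr.
by apply: Qfix; rewrite JJD JJN Jw Jm IID IIN opprD.
Unshelve. all: by end_near. Qed.

End Distribution.

Lemma straightened : exists Phi : X -> X,
  [/\ analytic_at Phi 0, Phi 0 = 0, forall v, D Phi 0 v = v
    & \forall x \near 0, forall v, D Phi x (J x v) = I (D Phi x v)].
Proof.
have [S [Slin hS qS]] := inverse_family (linear_opp_continuous Ic) qlin q0 hq.
exact: straightened_with Slin hS qS.
Qed.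

End Antiholomorphic.

(** * Holomorphic coordinates *)

Section ComplexCoordinates.
Context (R : realType) (X : completeNormedModType R) (I : {linear X -> X}).
Hypotheses (Ic : continuous I) (I2 : forall v, I (I v) = - v).
Local Notation II := (dbl I).

(** The lemma straightened applies to the derivatives JJ y, along the fibres, of
    the holomorphic extension of (x, v) |-> J x v. They are linear by
    construction, for all y, and agree with J on the diagonal, where J is linear
    in v. *)
Lemma complex_coordinates (J : X -> X -> X) :
  analytic_at (fun p : X * X => J p.1 p.2) 0 ->
  (forall v, J 0 v = I v) ->
  (\forall x \near 0, forall k u v, J x (k *: u + v) = k *: J x u + J x v) ->
  (\forall x \near 0, forall v, J x (J x v) = - v) ->
  (\forall x \near 0, forall u v,
    J x (D (J^~ u) x v) - J x (D (J^~ v) x u)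
    - D (J^~ u) x (J x v) + D (J^~ v) x (J x u) = 0) ->
  exists Phi : X -> X,
  [/\ analytic_at Phi 0, Phi 0 = 0, forall v, D Phi 0 v = v
    & \forall x \near 0, forall v, D Phi x (J x v) = I (D Phi x v)].
Proof.
move=> aJ J0 Jl J2 JN.
pose I4 : {linear ((X * X) * (X * X))%type -> ((X * X) * (X * X))%type} := pair_lin II II.
pose iota : {linear (X * X)%type -> ((X * X) * (X * X))%type} :=
  pair_lin (@diag R X) (@diag R X).
pose re : {linear ((X * X) * (X * X))%type -> (X * X)%type} :=
  pair_lin (@mean R X) (@mean R X).
have IIc : continuous II by exact: dbl_continuous.
have I4c : continuous I4 by exact: pair_lin_continuous.
have rec : continuous re by apply: pair_lin_continuous; exact: mean_continuous.
have ic : continuous iota by apply: pair_lin_continuous; exact: diag_continuous.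
have I42 v : I4 (I4 v) = - v.
  by case: v => a b; rewrite /I4 /= /pair_lin /= !dbl2.
have reK v : re (iota v) = v.
  by case: v => a b; rewrite /re /iota /= /pair_lin /= !mean_diag.
have reI v : re (I4 (iota v)) = 0.
  by case: v => a b; rewrite /re /I4 /iota /= /pair_lin /= !mean_dbl_diag.
have aF : analytic_at (fun p : X * X => diag (J p.1 p.2)) 0.
  exact: analytic_comp_linear (@diag_continuous R X) aJ.
have [r [M [b [d [F [r0 fb dM bF FE]]]]]] := complexification I4c IIc rec I42 (dbl2 I2)
  reK reI (ic 0) (linear0 iota) aF.
have hF : holo I4 II F 0.
  apply: (equivariant_holo IIc r0 _ _ dM bF) => n; first by have [] := fb n.
  by have [_] := fb n.
pose JJ (y u : X * X) := D F (y, 0) (0, u).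
have ain : analytic_at (fun y : X * X => (y, 0 : X * X)) 0.
  by apply: analytic_pair; [exact: analytic_id|exact: analytic_cst].
have hFn : \forall y \near (0 : X * X), holo I4 II F (y, 0).
  by apply: (near_comp (P := fun p => holo I4 II F p) ain); exact: holo_near.
have hJJ : \forall y \near (0 : X * X), forall u,
    holo I4 II (fun p => JJ p.1 p.2) (y, u).
  apply: filterS hFn => y hy u.
  apply: (holo_along (I' := I4) (f := F) (g := fun p : (X * X) * (X * X) => (p.1, 0))
     (G := fun p : (X * X) * (X * X) => (0, p.2))) => //.
  - exact: (holo_pair (holo_fst _ _ _) (holo_cst I4 II 0 _)).
  - exact: (holo_pair (holo_cst I4 II 0 _) (holo_snd _ _ _)).
have JJlin y k u v : JJ y (k *: u + v) = k *: JJ y u + JJ y v.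
  rewrite /JJ -DZ -DD; congr (D F _ _).
  by congr (_, _) => /=; rewrite scaler0 addr0.
apply: (straightened Ic I2 (JJ := JJ)) => //.
have ainX : analytic_at (fun x : X => (x, 0 : X)) 0.
  by apply: analytic_pair; [exact: analytic_id|exact: analytic_cst].
have FEn := near_comp (P := fun q => \forall p \near q, F (iota p) = diag (J p.1 p.2))
  ainX (near_near FE).
have aJn := near_comp (P := fun q => analytic_at (fun p : X * X => J p.1 p.2) q)
  ainX (analytic_near aJ).
have ad : analytic_at (fun x : X => (diag x, 0 : X * X)) 0.
  by apply: analytic_pair; [apply: linear_analytic; exact: diag_continuous|exact: analytic_cst].
have aFn : \forall x \near (0 : X), analytic_at F (diag x, 0).
  apply: (near_comp (P := fun q => analytic_at F q) ad).
  by rewrite linear0; have [a0 _] := hF; exact: analytic_near.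
near=> x => v.
have FEx : \forall p \near (x, 0), F (iota p) = diag (J p.1 p.2) by near: x.
have aJx : analytic_at (fun p : X * X => J p.1 p.2) (x, 0) by near: x.
have aFx : analytic_at F (iota (x, 0)).
  rewrite -[iota _]/(diag x, diag 0) linear0; near: x; exact: aFn.
have Jlx : forall k u v, J x (k *: u + v) = k *: J x u + J x v by near: x.
have e1 : D (fun p => F (iota p)) (x, 0) (0, v) = JJ (diag x) (diag v).
  rewrite (D_comp _ (linear_analytic _ ic) aFx) (D_lin _ _ ic).
  by rewrite -[iota (x, 0)]/(diag x, diag 0) -[iota (0, v)]/(diag 0, diag v) !linear0.
rewrite -e1.
have -> : D (fun p => F (iota p)) (x, 0) (0, v) = D (fun p : X * X => diag (J p.1 p.2)) (x, 0) (0, v).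
  apply: D_near_eq FEx; exact: analytic_comp (linear_analytic _ ic) aFx.
rewrite (D_comp_lin _ (@diag_continuous R X) aJx); congr diag.
pose L : {linear X -> X} := HB.pack (J x) (GRing.isLinear.Build _ _ _ _ _ Jlx).
have al : analytic_at (fun t : R => (x, line v t)) 0.
  apply: analytic_pair; first exact: analytic_cst.
  by apply: linear_analytic; exact: line_continuous.
have dl : D (fun t : R => (x, line v t)) 0 (1 : R^o) = (0, v).
  rewrite D_pair; [|exact: analytic_cst|by apply: linear_analytic; exact: line_continuous].
  rewrite D_cst (D_lin (L := line v) _ _ (@line_continuous _ _ v)).
  by congr (_, _); exact: scale1r.
have aJl : analytic_at (fun p : X * X => J p.1 p.2) (x, line v (0 : R)).
  by rewrite /line scale0r.
rewrite -dl -[in D _ (x, 0)](scale0r v) -(D_comp _ al aJl).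
have -> : (fun t : R => J x (line v t)) = line (J x v).
  by apply/funext => t; rewrite /line; exact: (linearZ_LR L).
rewrite (D_lin (L := line (J x v)) _ _ (@line_continuous _ _ _)).
exact: scale1r.
Unshelve. all: by end_near. Qed.

End ComplexCoordinates.

(** * Complex analyticity *)

Section ComplexAnalytic.
Context (R : realType).

Definition mulI (E : completeNormedModType R[i]) (x : realified E) : realified E :=
  'i%C *: (x : E).

Section MulI.
Context (E : completeNormedModType R[i]).
Let mulI_linear : linear (@mulI E).
Proof.
move=> k u v; rewrite /mulI -[k *: u]/(k%:C *: (u : E)) scalerDr !scalerA.
by rewrite -[k *: _]/(k%:C *: ('i%C *: (u : E)))  scalerA mulrC.
Qed.
HB.instance Definition _ :=
  GRing.isLinear.Build R (realified E) (realified E) _ (@mulI E) mulI_linear.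

Lemma mulI_continuous : continuous (@mulI E).
Proof.
apply: (@bounded_continuous _ _ _ _ 1) => v; rewrite -lecR rmorphM /= mul1r.
by rewrite !realified_normE /mulI normrZ normc_def /= expr0n expr1n add0r sqrtr1 mul1r.
Qed.

Lemma mulI2 v : mulI (mulI v) = - v :> realified E.
Proof. by rewrite /mulI scalerA -expr2 sqr_i scaleN1r. Qed.

Lemma scalec_split (z : R[i]) (x : E) :
  z *: x = complex.Re z *: (x : realified E) + complex.Im z *: mulI x :> realified E.
Proof.
rewrite -[complex.Re z *: _]/((complex.Re z)%:C *: x).
rewrite -[complex.Im z *: _]/((complex.Im z)%:C *: ('i%C *: x)).
transitivity ((complex.Re z)%:C *: x + (complex.Im z)%:C *: ('i%C *: x)) => //.
by rewrite scalerA -scalerDl {1}[z]complexE [_ * 'i%C]mulrC.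
Qed.
End MulI.

(** A real multilinear form that commutes with the multiplication by i in each
    argument is complex multilinear; holo_forms provides a power series made of
    such forms. *)
Lemma complex_analytic_of_holo (E F : completeNormedModType R[i])
    (f : realified E -> realified F) (x : realified E) :
  holo (@mulI E) (@mulI F) f x -> analytic_at (f : E -> F) (x : E).
Proof.
move=> hf.
pose g h := f (x + h).
have hg : holo (@mulI E) (@mulI F) g 0.
  have ha : holo (@mulI E) (@mulI E) (fun h : realified E => x + h) 0.
    by apply: holoD; [exact: holo_cst|exact: holo_id].
  by apply: (holo_comp ha); rewrite addr0.
have [r [M [b [d [r0 fb dM bf]]]]] := holo_forms (@mulI_continuous E) (@mulI_continuous F)
  (@mulI2 E) (@mulI2 F) hg.
exists (fun n (v : 'I_n -> E) => b n (fun k => if insub k is Some i then v i else 0)).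
exists M%:C, r%:C; split=> [|n v i|n v|].
- by rewrite ltcR.
- have [fbn eb] := fb n.
  have E1 t : b n (fun k => if insub k is Some j then (if j == i then t else v j) else 0) =
     b n (upd (fun k => if insub k is Some j then v j else 0) i t).
    apply: (form_ext fbn) => k kn; rewrite /upd insubT /=.
    by rewrite -val_eqE.
  move=> k s t; rewrite !E1 scalec_split.
  rewrite -[_ + t]/((complex.Re k *: (s : realified E) + complex.Im k *: mulI s) + (t : realified E)).
  rewrite (form_linD _ _ _ fbn) // (form_linD _ _ _ fbn) // !(form_linZ _ _ _ fbn) //.
  by rewrite eb // [k *: _]scalec_split.
- have [fbn _] := fb n.
  rewrite -realified_normE -fmorphV -rmorphXn -rmorphM.
  under eq_bigr do rewrite -realified_normE.
  rewrite -rmorph_prod -rmorphM lecR; apply: (le_trans (form_bd fbn _)).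
  rewrite (eq_bigr (fun i => `|v i : realified E|)); last by move=> i _; rewrite valK.
  apply: ler_wpM2r; first by rewrite prodr_ge0.
  rewrite exprVn ler_pdivlMr ?exprn_gt0 //; apply: le_trans (dM n.+1).
  rewrite big_ord_recr /= lerDr; apply: sumr_ge0 => i _.
  have [fbi _] := fb i.
  by rewrite mulr_ge0 ?(form_ge0 fbi) // exprn_ge0 // ltW.
apply: filterS bf => h; apply: eq_sums => n; apply: (form_ext (fb n).1) => k kn.
by rewrite insubT.
Qed.

End ComplexAnalytic.

(** * The complex Banach space defined by a complex structure *)

Section CircleNorm.
Context (R : realType) (X : completeNormedModType R) (I : {linear X -> X}).
Hypotheses (Ic : continuous I) (I2 : forall v, I (I v) = - v).

Definition cscale (z : R[i]) (x : X) : X := complex.Re z *: x + complex.Im z *: I x.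

Lemma cscaleA a b v : cscale a (cscale b v) = cscale (a * b) v.
Proof.
have e1 : complex.Re (a * b) = complex.Re a * complex.Re b - complex.Im a * complex.Im b.
  by move: (a) (b) => [? ?] [? ?].
have e2 : complex.Im (a * b) = complex.Re a * complex.Im b + complex.Im a * complex.Re b.
  by move: (a) (b) => [? ?] [? ?].
have e3 : I (complex.Re b *: v + complex.Im b *: I v) =
    complex.Re b *: I v - complex.Im b *: v.
  by rewrite linearD !linearZ_LR I2 scalerN.
rewrite /cscale e1 e2 e3; move: (complex.Re a) (complex.Im a) (complex.Re b) (complex.Im b).
by move=> p q r s; module.
Qed.

Lemma cscale1 : left_id 1 cscale.
Proof. by move=> v; rewrite /cscale /= scale1r scale0r addr0. Qed.

Lemma cscaleDr : right_distributive cscale +%R.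
Proof. by move=> a u v; rewrite /cscale (_ : I (u + v) = I u + I v) ?linearD //; module. Qed.

Lemma cscaleDl v : {morph cscale^~ v : a b / a + b}.
Proof. by move=> [a a'] [b b']; rewrite /cscale /=; move: (I v) => w; module. Qed.

(** The given norm is only real homogeneous; its supremum over the orbits of
    the circle is an equivalent complex homogeneous one. *)
Definition circle_norm (x : X) : R :=
  sup [set `|cscale z x| | z in [set z : R[i] | `|z| = 1]].

Local Notation N := circle_norm.

Let circle1 (z : R[i]) : `|z| = 1 -> `|complex.Re z| <= 1 /\ `|complex.Im z| <= 1.
Proof.
case: z => a b; rewrite normc_def /= => -[s1].
have := congr1 (fun x => x ^+ 2) s1; rewrite sqr_sqrtr ?addr_ge0 ?sqr_ge0 // expr1n => e.
by split; rewrite -[leRHS]normr1 -ler_sqr ?nnegrE // !real_normK ?num_real // expr1n -e ?lerDl ?lerDr sqr_ge0.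
Qed.

Lemma circle_norm_bounded : exists2 C : R, 0 < C & forall x z, `|z| = 1 -> `|cscale z x| <= C * `|x|.
Proof.
have [k k0 Ik] := linear_lipschitz Ic; exists (1 + k); first by rewrite addr_gt0.
move=> x z /circle1[h1 h2]; apply: (le_trans (ler_normD _ _)); rewrite mulrDl !normrZ.
apply: lerD; first by rewrite ler_wpM2r.
apply: le_trans (Ik x); rewrite -[leRHS]mul1r; exact: ler_wpM2r.
Qed.

Let norm1 : `|1 : R[i]| = 1. Proof. by rewrite normr1. Qed.

Let has x : has_sup [set `|cscale z x| | z in [set z : R[i] | `|z| = 1]].
Proof.
split; first by exists `|cscale 1 x|, 1.
have [C _ HC] := circle_norm_bounded; exists (C * `|x|) => _ [z z1 <-]; exact: HC.
Qed.

Lemma circle_norm_ge x z : `|z| = 1 -> `|cscale z x| <= N x.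
Proof. by move=> z1; apply: (ub_le_sup (has x).2); exists z. Qed.

Lemma circle_norm_le x c : (forall z, `|z| = 1 -> `|cscale z x| <= c) -> N x <= c.
Proof.
move=> H; apply: (ge_sup (has x).1) => _ [z z1 <-]; exact: H.
Qed.

Lemma circle_norm_ge_norm x : `|x| <= N x.
Proof. by rewrite -{1}[x]cscale1; exact: circle_norm_ge. Qed.

Lemma circle_normD x y : N (x + y) <= N x + N y.
Proof.
apply: circle_norm_le => z z1; rewrite cscaleDr; apply: (le_trans (ler_normD _ _)).
by apply: lerD; exact: circle_norm_ge.
Qed.

Lemma circle_norm0 x : N x = 0 -> x = 0.
Proof.
by move=> x0; apply/eqP; rewrite -normr_eq0 eq_le normr_ge0 -x0 circle_norm_ge_norm.
Qed.

Let normE (z : R[i]) : (complex.Re `|z|)%:C = `|z|.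
Proof. by rewrite normc_def. Qed.

Let ReM (z w : R[i]) : complex.Re `|z * w| = complex.Re `|z| * complex.Re `|w|.
Proof. by apply: complexI; rewrite rmorphM /= !normE normrM. Qed.

Let cscale0 x : cscale 0 x = 0.
Proof. by rewrite /cscale /= !scale0r addr0. Qed.

Lemma circle_normZ z x : N (cscale z x) = complex.Re `|z| * N x.
Proof.
have le w y : N (cscale w y) <= complex.Re `|w| * N y.
  have w0 : 0 <= complex.Re `|w| by rewrite -lecR normE normr_ge0.
  apply: circle_norm_le => u u1; rewrite cscaleA.
  have [->|w1] := eqVneq w 0.
    by rewrite mulr0 cscale0 !normr0 /= mul0r.
  have E : u * w = (complex.Re `|w|)%:C * (u * w / `|w|).
    by rewrite normE [RHS]mulrC divfK // normr_eq0.
  have -> : cscale (u * w) y = complex.Re `|w| *: cscale (u * w / `|w|) y.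
    by rewrite {1}E -cscaleA {1}/cscale /= scale0r addr0.
  rewrite normrZ (ger0_norm w0); apply: ler_wpM2l => //; apply: circle_norm_ge.
  by rewrite normrM normfV normr_id normrM u1 mul1r divff // normr_eq0.
have [->|z0] := eqVneq z 0.
  rewrite cscale0 normr0 /= mul0r; apply/eqP; rewrite eq_le.
  rewrite (le_trans (normr_ge0 _) (circle_norm_ge_norm _)) andbT.
  by apply: circle_norm_le => u _; rewrite /cscale (linear0 I) !scaler0 addr0 normr0.
apply/eqP; rewrite eq_le le /=.
have := le z^-1 (cscale z x); rewrite cscaleA mulVf // cscale1 => H.
have nz : 0 < complex.Re `|z| by rewrite -ltcR normE normr_gt0.
apply: (le_trans (ler_wpM2l (ltW nz) H)); rewrite mulrA -ReM divff //.
by rewrite normr1 mul1r.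
Qed.

Lemma circle_normN x : N (- x) = N x.
Proof.
have -> : - x = cscale (-1) x by rewrite /cscale /= oppr0 scale0r addr0 scaleN1r.
by rewrite circle_normZ normrN normr1 mul1r.
Qed.

Lemma circle_normMn x n : N (x *+ n) = N x *+ n.
Proof.
have -> : x *+ n = cscale (n%:R%:C) x by rewrite /cscale /= scale0r addr0 scaler_nat.
rewrite circle_normZ -[in RHS]mulr_natl; congr (_ * _); apply: complexI.
by rewrite normE ger0_norm // lecR.
Qed.

End CircleNorm.

(** The proofs are parameters of this copy of X, for its instances depend on
    them. *)
Definition complexified (R : realType) (X : completeNormedModType R) (I : {linear X -> X})
  (Ic : continuous I) (I2 : forall v, I (I v) = - v) : Type := X.

Section Complexified.
Context (R : realType) (X : completeNormedModType R) (I : {linear X -> X}).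
Context (Ic : continuous I) (I2 : forall v, I (I v) = - v).
Local Notation T := (complexified Ic I2).
Local Notation N := (circle_norm I).

HB.instance Definition _ := GRing.Zmodule.copy T X.
HB.instance Definition _ := PointedUniform.copy T X.
HB.instance Definition _ := Uniform_isComplete.Build T (@cauchy_cvg X).

HB.instance Definition _ := GRing.Zmodule_isLmodule.Build R[i] T
  (cscaleA I2) (cscale1 I) (cscaleDr I) (@cscaleDl _ _ I).

Let norm (x : T) : R[i] := (N x)%:C.
Let norm_triangle x y : norm (x + y) <= norm x + norm y.
Proof. by rewrite /norm -rmorphD lecR; exact: circle_normD. Qed.
Let norm0_eq0 x : norm x = 0 -> x = 0.
Proof. by move=> [] /(circle_norm0 Ic). Qed.
Let normMn x n : norm (x *+ n) = norm x *+ n.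
Proof. by rewrite /norm -rmorphMn; congr (_%:C); exact: circle_normMn. Qed.
Let normN x : norm (- x) = norm x.
Proof. by congr (_%:C); exact: circle_normN. Qed.
HB.instance Definition _ :=
  Num.Zmodule_isNormed.Build R[i] T norm_triangle norm0_eq0 normMn normN.

Let cball (x : T) (e : R[i]) : set T := ball_ (fun x : T => norm x) x e.
Let cball_center x e : 0 < e -> cball x e x.
Proof. by move=> e0; rewrite /cball /ball_ /= subrr /norm -[N 0]/(N 0); have -> : N 0 = 0;
 [have := circle_normMn Ic I2 (0 : X) 0; rewrite !mulr0n|]. Qed.
Let cball_sym x y e : cball x e y -> cball y e x.
Proof. by rewrite /cball /ball_ /= -normN opprB. Qed.
Let cball_triangle x y z e1 e2 : cball x e1 y -> cball y e2 z -> cball x (e1 + e2) z.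
Proof.
rewrite /cball /ball_ /= => h1 h2.
have -> : x - z = (x - y) + (y - z) by rewrite addrA subrK.
exact: le_lt_trans (norm_triangle _ _) (ltrD h1 h2).
Qed.
Let centourageE : @entourage T = entourage_ cball.
Proof.
rewrite -[LHS](@entourage_ballE _ X); apply/seteqP; split => A [e e0 eA].
  exists e%:C => [|xy xye]; first by rewrite /= ltcR.
  apply: eA; rewrite /= -ball_normE /=; apply: le_lt_trans (circle_norm_ge_norm Ic _) _.
  by rewrite -ltcR; exact: xye.
have [C C0 HC] := circle_norm_bounded Ic.
have eE : (complex.Re e)%:C = e.
  by case: e e0 {eA} => a b; rewrite /= ltcE /= => /andP[/eqP-> _].
have e0' : 0 < complex.Re e by rewrite -ltcR eE.
exists (complex.Re e / C) => [|xy xye]; first by rewrite /= divr_gt0.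
apply: eA; rewrite /cball /ball_ /= -eE ltcR.
apply: (@le_lt_trans _ _ (C * `|(xy.1 : X) - xy.2|)).
  by apply: (circle_norm_le Ic) => z; exact: HC.
by rewrite mulrC -ltr_pdivlMr //; move: xye; rewrite /= -ball_normE.
Qed.
HB.instance Definition _ := Uniform_isPseudoMetric.Build R[i] T
  cball_center cball_sym cball_triangle centourageE.
HB.instance Definition _ := NormedZmod_PseudoMetric_eq.Build R[i] T erefl.
Let normZ (a : R[i]) (x : T) : `|a *: x| = `|a| * `|x|.
Proof.
rewrite -[`|a *: x|]/((N (cscale I a x))%:C) -[`|x|]/((N x)%:C) (circle_normZ Ic I2).
by rewrite rmorphM /=; congr (_ * _); rewrite normc_def.
Qed.
HB.instance Definition _ :=
  PseudoMetricNormedZmod_Lmodule_isNormedModule.Build R[i] T normZ.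

(** The identity, from the given real norm to the equivalent one of the complex
    space. *)
Definition to_complexified (x : X) : realified T := x.
Definition of_complexified (x : realified T) : X := x.

Let to_linear : linear to_complexified.
Proof.
move=> k u v; rewrite /to_complexified -[k *: (u : realified T)]/(cscale I k%:C u).
by rewrite /cscale /= scale0r addr0.
Qed.
HB.instance Definition _ := GRing.isLinear.Build R X (realified T) _ to_complexified to_linear.
Let of_linear : linear of_complexified.
Proof.
move=> k u v; rewrite /of_complexified -[k *: (u : realified T)]/(cscale I k%:C u).
by rewrite /cscale /= scale0r addr0.
Qed.
HB.instance Definition _ := GRing.isLinear.Build R (realified T) X _ of_complexified of_linear.

Lemma to_complexified_continuous : continuous to_complexified.
Proof. by move=> x; exact: cvg_id. Qed.

Lemma of_complexified_continuous : continuous of_complexified.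
Proof. by move=> x; exact: cvg_id. Qed.

Lemma to_complexifiedI x : to_complexified (I x) = mulI (to_complexified x).
Proof.
rewrite /mulI -[RHS]/(cscale I 'i%C x) /cscale /= scale0r add0r.
by rewrite scale1r.
Qed.

End Complexified.

(** * Analytic maps are smooth *)

Section Smooth.
Context (R : realType) (X : normedModType R) (Y : completeNormedModType R).

(** The newest direction is the first argument, as in vcons. *)
Fixpoint iterD (f : X -> Y) n (x : X) : ('I_n -> X) -> Y :=
  if n is n'.+1 return ('I_n -> X) -> Y then
    fun w => D (fun y => iterD f y (fun i : 'I_n' => w (lift ord0 i))) x (w ord0)
  else fun _ => f x.

(** Each derivative halves the radius, by Cauchy's estimate. The bound is a
    multiple of the norms of the directions, which makes the estimates of the
    derivatives hold in operator norm. *)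
Lemma iterD_pser f x n : analytic_at f x -> exists r M, [/\ 0 < r, 0 <= M &
  forall v : 'I_n -> X, pser r (M * \prod_(i < n) `|v i|) (fun h => iterD f (x + h) v)].
Proof.
move=> /analytic_atP[r [M pf]]; have r0 := pser_gt0 pf; have M0 := pser_ge0 pf.
elim: n => [|n [s [N [s0 N0 IH]]]].
  by exists r, M; split=> // v; rewrite big_ord0 mulr1.
have s20 : 0 < s / 2 by rewrite divr_gt0.
have ss : s / 2 < s by lra.
have ss' : 0 < s - s / 2 by rewrite subr_gt0.
exists (s / 2), (N / (s - s / 2)).
split=> [||w]; [exact: s20|by rewrite divr_ge0 // ltW|].
have pid : pser (s / 2) (s / 2) (fun h : X => h) by exact: pser_id.
have pw := pser_const X (w ord0) s20.
have := pser_deriv (IH (fun i => w (lift ord0 i))) ss pid pw.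
rewrite (_ : _ * `|w ord0| / _ = N / (s - s / 2) * \prod_(i < n.+1) `|w i|); last first.
  by rewrite big_ord_recl; ring.
apply: pser_ext => h hs; have hs' : `|h| < s by exact: le_lt_trans ss.
by rewrite /= (D_shift _ (pser_analytic_in (IH _) hs')).
Qed.

Lemma iterD_analytic f x n v : analytic_at f x -> analytic_at (fun y => iterD (n := n) f y v) x.
Proof. by move=> /(iterD_pser n)[r [M [_ _ H]]]; apply/analytic_atP; eexists _, _; exact: H. Qed.

Lemma iterD_multilinear f x n : analytic_at f x -> multilinear (@iterD f n x).
Proof.
elim: n x => [|n IH] x af v i; first by case: i.
move=> k s t /=; have [->|[j ->]] : i = ord0 \/ exists j, i = lift ord0 j.
  by case: (unliftP ord0 i) => [j ->|->]; [right; exists j|left].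
- rewrite eqxx.
  have E u : (fun i0 : 'I_n => if lift ord0 i0 == ord0 then u else v (lift ord0 i0)) =
    fun i0 => v (lift ord0 i0) by apply/funext.
  by rewrite (E s) /= DD DZ.
have -> : ord0 == lift ord0 j = false by [].
pose v' i0 := v (lift ord0 i0).
have E u : (fun i0 : 'I_n => if lift ord0 i0 == lift ord0 j then u else v (lift ord0 i0)) =
    fun i0 => if i0 == j then u else v' i0.
  by apply/funext => i0; rewrite (inj_eq (@lift_inj _ _)).
rewrite !E.
have a1 u : analytic_at (fun y => iterD f y (fun i0 => if i0 == j then u else v' i0)) x.
  exact: iterD_analytic.
rewrite -(D_scale _ _ (a1 s)) -D_add //; last exact: analyticZ.
apply: D_near_eq; first exact: a1.
by apply: filterS (analytic_near af) => y ay; exact: IH.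
Qed.

Lemma analytic_smooth (A : set X) (f : X -> Y) : analytic_on A f -> smooth_on A f.
Proof.
move=> af; exists (fun n x => @iterD f n x); split=> // n x /af ax.
split; first exact: iterD_multilinear.
  have [r [M [r0 M0 H]]] := iterD_pser n ax; exists M => v.
  by have := pser_bd (H v) (h := 0); rewrite addr0; apply; rewrite normr0 ltW.
move=> e e0; have [r [M [r0 M0 H]]] := iterD_pser n ax.
pose C := M / r ^+ 2; have C0 : 0 <= C by rewrite divr_ge0 // exprn_ge0 // ltW.
have d0 : 0 < e / (C + 1) by rewrite divr_gt0 // ltr_wpDl.
near=> h => v.
have hr : `|h| <= r by near: h; exact: nbhs0_le.
have hd : `|h| <= e / (C + 1) by near: h; exact: nbhs0_le.
have r_ : `|0 : X| + r <= r by rewrite normr0 add0r.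
have [_ _ q] := pser_diff (H v) r0 r_.
have := q h hr; rewrite add0r addr0.
have -> : D (fun h => iterD f (x + h) v) 0 h = iterD f x (vcons h v).
  have a0 : analytic_at (fun h => iterD f (x + h) v) 0 := pser_analytic (H v).
  rewrite -(D_shift (f := fun y => iterD f y v) _ a0) addr0 /= /vcons unlift_none; congr (D _ x h).
  by apply/funext => y; congr (iterD f y _); apply/funext => i; rewrite liftK.
move=> /le_trans; apply; rewrite expr2 mulrA -/C.
rewrite (_ : M * _ / _ = C * \prod_(i < n) `|v i|); last by rewrite /C; ring.
rewrite (_ : C * _ * _ * _ = C * `|h| * (`|h| * \prod_(i < n) `|v i|)); last by ring.
rewrite -[leRHS]mulrA; apply: ler_wpM2r; first by rewrite mulr_ge0 // prodr_ge0.
apply: (le_trans (ler_wpM2l C0 hd)); rewrite mulrCA ger_pMr // ler_pdivrMr ?ltr_wpDl //.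
by rewrite mul1r lerDl.
Unshelve. all: by end_near. Qed.

End Smooth.

(** * Tangent vectors in charts *)

Section Charts.
Context (R : realType) (M : topologicalType).
Implicit Types c : chart R M.

Lemma chart_inv_map c p : chart_dom c p -> chart_inv c (chart_map c p) = p.
Proof. by move=> cp; apply: chart_mapK; rewrite inE. Qed.

Lemma near_chart_cod c p : chart_dom c p ->
  \forall x \near chart_map c p, (chart_map c @` chart_dom c) x.
Proof.
move=> cp; apply: open_nbhs_nbhs; split; first exact: chart_cod_open.
by exists p.
Qed.

Lemma chart_codP c x : (chart_map c @` chart_dom c) x ->
  chart_dom c (chart_inv c x) /\ chart_map c (chart_inv c x) = x.
Proof. by move=> [p cp <-]; rewrite chart_inv_map. Qed.

Lemma near_chart_inv c p (P : M -> Prop) : chart_dom c p ->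
  (\forall q \near p, P q) -> \forall x \near chart_map c p, P (chart_inv c x).
Proof.
move=> cp nP; have ic : {for chart_map c p, continuous (chart_inv c)}.
  by apply: chart_inv_continuous; rewrite inE; exists p.
by apply: ic; rewrite chart_inv_map.
Qed.

Lemma near_chart_dom c p : chart_dom c p -> \forall q \near p, chart_dom c q.
Proof. by move=> cp; apply: open_nbhs_nbhs; split=> //; exact: chart_dom_open. Qed.

(** Transition maps are total; they are meaningful near the images of the common
    points of the two charts. *)
Definition transition c c' : model c -> model c' := fun x => chart_map c' (chart_inv c x).
Arguments transition : clear implicits.

(** Compatibility at one point, which composes through a middle chart defined at
    this point only. *)
Definition related p c c' : Prop := analytic_at (transition c c') (chart_map c p).

Lemma related_of_compatible p c c' : compatible c c' ->
  chart_dom c p -> chart_dom c' p -> related p c c'.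
Proof. by move=> [h _] cp c'p; apply: h; exists p. Qed.

Lemma compatible_of_related c c' :
  (forall p, chart_dom c p -> chart_dom c' p -> related p c c' /\ related p c' c) ->
  compatible c c'.
Proof. by move=> H; split=> _ [p [cp c'p] <-]; have [] := H p cp c'p. Qed.

Lemma compatible_sym c c' : compatible c c' -> compatible c' c.
Proof. by rewrite /compatible setIC => -[h h']. Qed.

Lemma transition_map c c' p : chart_dom c p -> transition c c' (chart_map c p) = chart_map c' p.
Proof. by move=> cp; rewrite /transition chart_inv_map. Qed.

Lemma near_transition c c' c'' p : chart_dom c p -> chart_dom c' p ->
  \forall x \near chart_map c p, transition c' c'' (transition c c' x) = transition c c'' x.
Proof.
move=> cp c'p; have := near_chart_inv cp (near_chart_dom c'p).
by apply: filterS => x c'x; rewrite /transition chart_inv_map.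
Qed.

Lemma related_trans c c' c'' p : chart_dom c p -> chart_dom c' p ->
  related p c c' -> related p c' c'' -> related p c c''.
Proof.
move=> cp c'p r1 r2; apply: (analytic_ext (near_transition c'' cp c'p)).
by apply: (analytic_comp r1); rewrite transition_map.
Qed.

Lemma D_transition c c' c'' p v : chart_dom c p -> chart_dom c' p ->
  related p c c' -> related p c' c'' ->
  D (transition c c'') (chart_map c p) v =
  D (transition c' c'') (chart_map c' p) (D (transition c c') (chart_map c p) v).
Proof.
move=> cp c'p r1 r2.
have r2' : analytic_at (transition c' c'') (transition c c' (chart_map c p)).
  by rewrite transition_map.
rewrite -(transition_map c' cp) -(D_comp _ r1 r2'); apply/esym/D_near_eq.
  exact: analytic_comp r1 r2'.
exact: near_transition.
Qed.

Lemma D_transition_id c p v : chart_dom c p -> D (transition c c) (chart_map c p) v = v.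
Proof.
move=> cp; rewrite -[RHS](D_id (chart_map c p)); apply/esym/D_near_eq; first exact: analytic_id.
by apply: filterS (near_chart_cod cp) => x /chart_codP[_ e]; rewrite /transition e.
Qed.

Lemma D_transitionK c c' p v : chart_dom c p -> chart_dom c' p ->
  related p c c' -> related p c' c ->
  D (transition c' c) (chart_map c' p) (D (transition c c') (chart_map c p) v) = v.
Proof. by move=> cp c'p r1 r2; rewrite -D_transition // D_transition_id. Qed.

End Charts.
Arguments transition {R M} c c' x.

Section SameStructure.
Context (R : realType) (M : topologicalType).
Implicit Types S : analytic_structure R M.

Lemma related_admissible S c i p : admissible S c ->
  chart_dom c p -> chart_dom (atlas S i) p ->
  related p c (atlas S i) /\ related p (atlas S i) c.
Proof.
by move=> /(_ i) h cp ip; split; apply: related_of_compatible => //; exact: compatible_sym.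
Qed.

Lemma related_atlas S i j p : chart_dom (atlas S i) p -> chart_dom (atlas S j) p ->
  related p (atlas S i) (atlas S j).
Proof. by move=> ip jp; apply: related_of_compatible => //; exact: atlas_compatible. Qed.

Lemma atlas_admissible S i : admissible S (atlas S i).
Proof. by move=> j; exact: atlas_compatible. Qed.

(** Both implications compare two charts at a point through a third one, taken
    from S or from S' according to the direction. *)
Lemma same_structure_of_admissible S S' :
  (forall j, admissible S (atlas S' j)) -> same_structure S' S.
Proof.
move=> adm c; split=> h k; apply: compatible_of_related => p cp kp.
  have [j jp] := atlas_cover S' p.
  have [r1 r2] := related_admissible h cp jp.
  have [r3 r4] := related_admissible (adm j) jp kp.
  by split; [apply: related_trans r1 r3|apply: related_trans r4 r2].
have [i ip] := atlas_cover S p.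
have [r1 r2] := related_admissible h cp ip.
have [r3 r4] := related_admissible (adm k) kp ip.
by split; [apply: related_trans r1 r4|apply: related_trans r3 r2].
Qed.

End SameStructure.

Section TangentVectors.
Context (R : realType) (M : topologicalType) (S : analytic_structure R M).
Local Notation chart_ := (atlas S).

Lemma tcoordE p (u : tangent S p) i j : chart_dom (chart_ i) p -> chart_dom (chart_ j) p ->
  tcoord u j = D (transition (chart_ i) (chart_ j)) (chart_map (chart_ i) p) (tcoord u i).
Proof. by move=> ip jp; exact: tcoord_transition. Qed.

Lemma tangent_inj p (u v : tangent S p) i : chart_dom (chart_ i) p ->
  tcoord u i = tcoord v i -> u = v.
Proof.
move=> ip e; apply: tangent_eq => j; have [jp|jp] := pselect (chart_dom (chart_ j) p).
  by rewrite (tcoordE u ip jp) (tcoordE v ip jp) e.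
by rewrite !tcoord_default.
Qed.

Lemma tcoord_tvec p i v : chart_dom (chart_ i) p -> tcoord (tvec p i v) i = v.
Proof.
move=> ip.
pose co j : model (chart_ j) := if pselect (chart_dom (chart_ j) p) then
  D (transition (chart_ i) (chart_ j)) (chart_map (chart_ i) p) v else 0.
have coE j : chart_dom (chart_ j) p ->
    co j = D (transition (chart_ i) (chart_ j)) (chart_map (chart_ i) p) v.
  by rewrite /co; case: pselect.
have h1 j k : chart_dom (chart_ j) p -> chart_dom (chart_ k) p ->
    co k = 'd (chart_map (chart_ k) \o chart_inv (chart_ j)) (chart_map (chart_ j) p) (co j).
  move=> jp kp; rewrite (coE j jp) (coE k kp).
  by apply: D_transition => //; exact: related_atlas.
have h2 j : ~ chart_dom (chart_ j) p -> co j = 0.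
  by rewrite /co; case: pselect.
have := @xgetPex _ 0 [set u : tangent S p | tcoord u i = v]; apply.
exists (Tangent h1 h2); rewrite /= coE //.
exact: D_transition_id.
Qed.

Lemma tvecK p i (u : tangent S p) : chart_dom (chart_ i) p -> tvec p i (tcoord u i) = u.
Proof. by move=> ip; apply: (tangent_inj ip); rewrite tcoord_tvec. Qed.

Lemma tcoord_tvec_other p i j v : chart_dom (chart_ i) p -> chart_dom (chart_ j) p ->
  tcoord (tvec p i v) j = D (transition (chart_ i) (chart_ j)) (chart_map (chart_ i) p) v.
Proof. by move=> ip jp; rewrite (tcoordE _ ip jp) tcoord_tvec. Qed.

Lemma dchartE p i c (u : tangent S p) : dchart i c u =
  D (transition (chart_ i) c) (chart_map (chart_ i) p) (tcoord u i).
Proof. by []. Qed.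

Lemma dchart_indep p i j c (u : tangent S p) : admissible S c -> chart_dom c p ->
  chart_dom (chart_ i) p -> chart_dom (chart_ j) p -> dchart i c u = dchart j c u.
Proof.
move=> adm cp ip jp; rewrite !dchartE (tcoordE u ip jp).
have [_ rj] := related_admissible adm cp jp; have rij := related_atlas ip jp.
exact: D_transition.
Qed.

End TangentVectors.

(** * The torsion in a chart *)

Section TorsionChart.
Context (R : realType) (M : topologicalType) (S : analytic_structure R M).
Context (J : almost_complex S) (J_analytic : analytic_acs J).
Local Notation chart_ := (atlas S).
Local Notation cod i := (chart_map (chart_ i) @` chart_dom (chart_ i)).

Definition acs_coord i (x v : model (chart_ i)) : model (chart_ i) :=
  tcoord (J _ (tvec (chart_inv (chart_ i) x) i v)) i.
Arguments acs_coord : clear implicits.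

Lemma acs_coord_map i p v : chart_dom (chart_ i) p ->
  acs_coord i (chart_map (chart_ i) p) v = tcoord (J p (tvec p i v)) i.
Proof. by move=> ip; rewrite /acs_coord chart_inv_map. Qed.

Lemma tcoord_acs i p (u : tangent S p) : chart_dom (chart_ i) p ->
  tcoord (J p u) i = acs_coord i (chart_map (chart_ i) p) (tcoord u i).
Proof. by move=> ip; rewrite acs_coord_map // tvecK. Qed.

Lemma tvec_linear p i k u v : chart_dom (chart_ i) p ->
  tvec p i (k *: u + v) = k *: tvec p i u + tvec p i v.
Proof. by move=> ip; apply: (tangent_inj ip); rewrite tcoord_tvec //= !tcoord_tvec. Qed.

Lemma acs_coord_linear i x k u v : cod i x ->
  acs_coord i x (k *: u + v) = k *: acs_coord i x u + acs_coord i x v.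
Proof. by case=> p ip <-; rewrite !acs_coord_map // tvec_linear // acs_linear. Qed.

Lemma acs_coordN i x v : cod i x -> acs_coord i x (- v) = - acs_coord i x v.
Proof.
move=> cx; have Jl k u w := acs_coord_linear k u w cx.
pose L : {linear model (chart_ i) -> model (chart_ i)} :=
  HB.pack (acs_coord i x) (GRing.isLinear.Build _ _ _ _ _ Jl).
exact: (linearN L).
Qed.

Lemma acs_coord_sqr i x v : cod i x -> acs_coord i x (acs_coord i x v) = - v.
Proof.
case=> p ip <-; rewrite [acs_coord i _ v]acs_coord_map // acs_coord_map // tvecK //.
by rewrite acs_sqr /= tcoord_tvec.
Qed.

Lemma acs_coord_analytic i x v : cod i x ->
  analytic_at (fun xv : model (chart_ i) * model (chart_ i) => acs_coord i xv.1 xv.2) (x, v).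
Proof. by move=> cx; exact: (J_analytic (x := (x, v))). Qed.

Lemma acs_coord_analytic1 i x v : cod i x -> analytic_at ((acs_coord i)^~ v) x.
Proof.
move=> cx; have ax : analytic_at (fun x : model (chart_ i) => (x, v)) x.
  by apply: analytic_pair; [exact: analytic_id|exact: analytic_cst].
exact: (analytic_comp ax (acs_coord_analytic v cx)).
Qed.

(** The torsion on fields that are constant in the chart i, whose brackets are
    derivatives of J. *)
Definition torsion_coord i (x u v : model (chart_ i)) : model (chart_ i) :=
  acs_coord i x (D ((acs_coord i)^~ u) x v) - acs_coord i x (D ((acs_coord i)^~ v) x u)
  - D ((acs_coord i)^~ u) x (acs_coord i x v) + D ((acs_coord i)^~ v) x (acs_coord i x u).
Arguments torsion_coord : clear implicits.

Definition constant_field i (v : model (chart_ i)) : vector_field S := fun p => tvec p i v.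
Arguments constant_field : clear implicits.

(** In another chart the field is the image of v under the differential of the
    transition map. *)
Lemma constant_field_smooth i v : smooth_field (chart_dom (chart_ i)) (constant_field i v).
Proof.
move=> j; apply: analytic_smooth => x [p [jp ip] <-].
have ra := related_atlas ip jp; have ra' := related_atlas jp ip.
have ra2 : analytic_at (transition (chart_ i) (chart_ j))
    (transition (chart_ j) (chart_ i) (chart_map (chart_ j) p)) by rewrite transition_map.
have := analytic_along (f := transition (chart_ i) (chart_ j))
  (G := fun=> v) ra2 ra' (analytic_cst v _).
apply: analytic_ext.
have h := near_chart_inv jp (near_chart_dom ip); have h' := near_chart_cod jp.
near=> y; have iy : chart_dom (chart_ i) (chart_inv (chart_ j) y) by near: y.
have /chart_codP[jy _] : (chart_map (chart_ j) @` chart_dom (chart_ j)) y by near: y.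
by rewrite /field_coord /constant_field (tcoord_tvec_other _ iy jy).
Unshelve. all: by end_near. Qed.

Lemma tcoord_lie_bracket i a b p : chart_dom (chart_ i) p ->
  tcoord (lie_bracket i a b p) i =
  D (field_coord a (i := i)) (chart_map (chart_ i) p) (tcoord (b p) i) -
  D (field_coord b (i := i)) (chart_map (chart_ i) p) (tcoord (a p) i).
Proof.
by move=> ip; rewrite /lie_bracket tcoord_tvec // /field_coord chart_inv_map.
Qed.

Lemma D_constant_field i v x w : cod i x ->
  D (field_coord (constant_field i v) (i := i)) x w = 0.
Proof.
move=> [p ip <-]; rewrite -(D_cst v (chart_map (chart_ i) p) w); apply/esym/D_near_eq.
  exact: analytic_cst.
apply: filterS (near_chart_cod ip) => y /chart_codP[iy _].
by rewrite /field_coord tcoord_tvec.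
Qed.

Lemma torsion_chart Omega i p u v : is_torsion J Omega -> chart_dom (chart_ i) p ->
  tcoord (Omega p (tvec p i u) (tvec p i v)) i = torsion_coord i (chart_map (chart_ i) p) u v.
Proof.
move=> [_ tO] ip; have cp : cod i (chart_map (chart_ i) p) by exists p.
have /= -> := tO _ _ _ (chart_dom_open (chart_ i)) (@constant_field_smooth i u)
  (@constant_field_smooth i v) i p ip ip.
pose x := chart_map (chart_ i) p; pose cst := constant_field i.
have fE w : field_coord (acs_field J (cst w)) (i := i) = (acs_coord i)^~ w by [].
have cE w : tcoord (cst w p) i = w by exact: tcoord_tvec.
have aE w : tcoord (acs_field J (cst w) p) i = acs_coord i x w.
  by rewrite /acs_field tcoord_acs // cE.
have e1 : tcoord (lie_bracket i (acs_field J (cst u)) (cst v) p) i = D ((acs_coord i)^~ u) x v.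
  by rewrite (tcoord_lie_bracket _ _ ip) fE (D_constant_field v _ cp) cE subr0.
have e2 : tcoord (lie_bracket i (cst u) (acs_field J (cst v)) p) i = - D ((acs_coord i)^~ v) x u.
  by rewrite (tcoord_lie_bracket _ _ ip) fE (D_constant_field u _ cp) cE sub0r.
have e3 : tcoord (lie_bracket i (cst u) (cst v) p) i = 0.
  by rewrite (tcoord_lie_bracket _ _ ip) (D_constant_field u _ cp) (D_constant_field v _ cp) subr0.
have e4 : tcoord (lie_bracket i (acs_field J (cst u)) (acs_field J (cst v)) p) i =
    D ((acs_coord i)^~ u) x (acs_coord i x v) - D ((acs_coord i)^~ v) x (acs_coord i x u).
  by rewrite (tcoord_lie_bracket _ _ ip) !fE !aE.
have t4 (A B C E : tangent S p) :
    tcoord (A + B + C - E) i = tcoord A i + tcoord B i + tcoord C i - tcoord E i by [].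
transitivity (acs_coord i x (D ((acs_coord i)^~ u) x v)
  + acs_coord i x (- D ((acs_coord i)^~ v) x u) + 0
  - (D ((acs_coord i)^~ u) x (acs_coord i x v) - D ((acs_coord i)^~ v) x (acs_coord i x u))).
  rewrite t4; congr (_ + _ + _ - _); [|exact: etrans (tcoord_acs _ ip) (congr1 _ e2)|exact: e3|exact: e4].
  exact: etrans (tcoord_acs _ ip) (congr1 _ e1).
by rewrite (acs_coordN _ cp) /torsion_coord addr0 opprD opprK addrA.
Qed.

End TorsionChart.
Arguments acs_coord {R M S} J i x v.
Arguments torsion_coord {R M S} J i x u v.

(** * Complex charts *)

Section LinearCharts.
Context (R : realType) (M : topologicalType) (S : analytic_structure R M).
Context (J : almost_complex S) (J_analytic : analytic_acs J).
Local Notation chart_ := (atlas S).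

Definition complex_linear_chart (c : chart R[i] M) : Prop :=
  forall i p (u : tangent S p), chart_dom (chart_ i) p -> chart_dom c p ->
  dchart i (real_chart c) (J p u) = mulI (dchart i (real_chart c) u).

Lemma D_dchart c c' i p (u : tangent S p) : admissible S c -> admissible S c' ->
  chart_dom c p -> chart_dom c' p -> chart_dom (chart_ i) p ->
  D (transition c c') (chart_map c p) (dchart i c u) = dchart i c' u.
Proof.
move=> ac ac' cp c'p ip; rewrite !dchartE.
have [ci ic] := related_admissible ac cp ip.
have [c'i ic'] := related_admissible ac' c'p ip.
by rewrite -D_transition //; exact: related_trans ci ic'.
Qed.

Lemma dchart_tvec c i p v : admissible S c -> chart_dom c p -> chart_dom (chart_ i) p ->
  dchart i c (tvec p i (D (transition c (chart_ i)) (chart_map c p) v)) = v.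
Proof.
move=> ac cp ip; have [ci ic] := related_admissible ac cp ip.
by rewrite dchartE tcoord_tvec // D_transitionK.
Qed.

(** The differential of a transition map takes the differential of one chart to
    that of the other, and both turn J into the multiplication by i; so the
    transition map has a complex linear differential. *)
Lemma complex_linear_compatible (c c' : chart R[i] M) :
  admissible S (real_chart c) -> admissible S (real_chart c') ->
  complex_linear_chart c -> complex_linear_chart c' -> compatible c c'.
Proof.
suff H (c1 c2 : chart R[i] M) : admissible S (real_chart c1) -> admissible S (real_chart c2) ->
    complex_linear_chart c1 -> complex_linear_chart c2 ->
    forall p, chart_dom c1 p -> chart_dom c2 p ->
    analytic_at (chart_map c2 \o chart_inv c1) (chart_map c1 p).
  move=> ac ac' lc lc'; split=> _ [p [cp c'p] <-]; exact: H.
move=> ac1 ac2 l1 l2 p p1 p2.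
pose C1 := real_chart c1; pose C2 := real_chart c2.
suff h : holo (@mulI R (model c1)) (@mulI R (model c2)) (transition C1 C2) (chart_map C1 p).
  exact: complex_analytic_of_holo h.
have rel q : chart_dom C1 q -> chart_dom C2 q -> related q C1 C2.
  move=> q1 q2; have [i iq] := atlas_cover S q.
  have [ci _] := related_admissible ac1 q1 iq.
  have [_ ic] := related_admissible ac2 q2 iq.
  exact: related_trans ci ic.
split; first exact: rel.
have n2 : \forall x \near chart_map C1 p, chart_dom C2 (chart_inv C1 x).
  exact: (near_chart_inv (c := C1) p1 (near_chart_dom (c := C2) p2)).
have n1 := near_chart_cod (c := C1) p1.
near=> y => v; have [q1 yE] : chart_dom C1 (chart_inv C1 y) /\ chart_map C1 (chart_inv C1 y) = y.
  by apply: chart_codP; near: y.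
have q2 : chart_dom C2 (chart_inv C1 y) by near: y.
move: q1 q2 yE; set q := chart_inv C1 y => q1 q2 <-.
have [i iq] := atlas_cover S q.
pose u := tvec q i (D (transition C1 (chart_ i)) (chart_map C1 q) v).
have uE : dchart i C1 u = v by exact: (dchart_tvec (c := C1) v ac1 q1 iq).
rewrite -{1}uE -(l1 i q u iq q1) (D_dchart _ ac1 ac2 q1 q2 iq) (l2 i q u iq q2).
by rewrite -(D_dchart u ac1 ac2 q1 q2 iq) uE.
Unshelve. all: by end_near. Qed.

(** Differentiation of the equation D phi (J v) = i D phi v expresses the image
    of the torsion under D phi by the second differential of phi, whose symmetry
    makes it vanish. *)
Lemma torsion_of_complex_linear (c : chart R[i] M) i p u v :
  admissible S (real_chart c) -> complex_linear_chart c ->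
  chart_dom c p -> chart_dom (chart_ i) p ->
  torsion_coord J i (chart_map (chart_ i) p) u v = 0.
Proof.
pose C := real_chart c => ac lc cp ip.
have [ci ic] := related_admissible ac cp ip.
pose phi := transition (chart_ i) C; set x := chart_map (chart_ i) p.
have aphi : analytic_at phi x := ic.
have cx : (chart_map (chart_ i) @` chart_dom (chart_ i)) x by exists p.
pose Jc := acs_coord J i.
have phiJ : \forall y \near x, forall w, D phi y (Jc y w) = mulI (D phi y w).
  have n1 := near_chart_cod ip.
  have n2 : \forall y \near x, chart_dom c (chart_inv (chart_ i) y).
    exact: near_chart_inv ip (near_chart_dom (c := C) cp).
  near=> y => w.
  have [iq yE] : chart_dom (chart_ i) (chart_inv (chart_ i) y) /\
      chart_map (chart_ i) (chart_inv (chart_ i) y) = y by apply: chart_codP; near: y.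
  have cq : chart_dom c (chart_inv (chart_ i) y) by near: y.
  move: iq cq yE; set q := chart_inv (chart_ i) y => iq cq <-.
  have := lc i q (tvec q i w) iq cq; rewrite !dchartE tcoord_tvec //.
  by rewrite (tcoord_acs J _ iq) tcoord_tvec.
have phiJx w : D phi x (Jc x w) = mulI (D phi x w) by move: w; exact: nbhs_singleton phiJ.
have aJ w : analytic_at (Jc^~ w) x by exact: acs_coord_analytic1.
pose B a b := D (fun y => D phi y a) x b.
have BC a b : B a b = B b a by exact: D2C.
have key a b : D phi x (D (Jc^~ a) x b) = mulI (B a b) - B (Jc x a) b.
  have e1 := D_along (f := phi) (g := fun y => y) (G := Jc^~ a) b aphi (analytic_id x) (aJ a).
  rewrite D_id in e1; apply/eqP; rewrite eq_sym subr_eq eq_sym addrC -e1; apply/eqP.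
  rewrite -(D_comp_lin _ (@mulI_continuous R _) (analytic_dir a aphi)).
  apply: D_near_eq; last by apply: filterS phiJ => y Hy; exact: Hy.
  exact: (analytic_along (f := phi) (g := fun y => y) (G := Jc^~ a) aphi (analytic_id x) (aJ a)).
have inj w : D phi x w = 0 -> w = 0.
  move=> e; rewrite -[LHS](D_transitionK w ip (cp : chart_dom C p) ic ci).
  by rewrite -/phi -/x e D0.
have mB (a b : realified (model c)) : mulI (a - b) = mulI a - mulI b by exact: linearB.
apply: inj; rewrite /torsion_coord -/Jc DD !DB !phiJx !key !mB !mulI2.
rewrite (BC v u) (BC v (Jc x u)) (BC (Jc x v) (Jc x u)) (BC (Jc x v) u).
set b1 := mulI _; set b2 := mulI _; move: (B u v) (B (Jc x u) (Jc x v)) => b3 b4.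
by module.
Unshelve. all: by end_near. Qed.

End LinearCharts.

(** The chart c, translated by x0 and followed by a local isomorphism Phi with
    inverse g, with values in the complex Banach space defined by I. *)
Section StraightChart.
Context (R : realType) (M : topologicalType) (c : chart R M).
Local Notation X := (model c).
Context (I : {linear X -> X}) (Ic : continuous I) (I2 : forall v, I (I v) = - v).
Context (x0 : X) (Phi g : X -> X) (B B' : set X).
Hypotheses (Bo : open B) (B'o : open B').
Hypothesis gPhi : forall x, B x -> B' (Phi x) /\ g (Phi x) = x.
Hypothesis Phig : forall y, B' y -> B (g y) /\ Phi (g y) = y.
Hypothesis Bcod : forall x, B x -> (chart_map c @` chart_dom c) (x0 + x).
Hypothesis aPhi : forall x, B x -> analytic_at Phi x.
Hypothesis ag : forall y, B' y -> analytic_at g y.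

Let T : completeNormedModType R[i] := complexified Ic I2.
Let dom : set M := [set q | chart_dom c q /\ B (chart_map c q - x0)].
Let map (q : M) : T := Phi (chart_map c q - x0).
Let inv (y : T) : M := chart_inv c (x0 + g y).

Let map_cvg q : chart_dom c q -> chart_map c r - x0 @[r --> q] --> chart_map c q - x0.
Proof.
by move=> cq; apply: cvgB; [apply: chart_map_continuous; rewrite inE|exact: cvg_cst].
Qed.

Let dom_open : open dom.
Proof.
rewrite openE => q [cq Bq]; rewrite /interior.
have n1 := near_chart_dom cq.
have n2 : \forall r \near q, B (chart_map c r - x0).
  by apply: (map_cvg cq); exact: open_nbhs_nbhs.
by near=> r; split; near: r.
Unshelve. all: by end_near. Qed.

Let codE : map @` dom = B'.
Proof.
apply/seteqP; split=> [_ [q [cq Bq] <-]|y B'y]; first by have [] := gPhi Bq.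
have [Bg e] := Phig B'y; have /chart_codP[cq e'] := Bcod Bg.
have e2 : x0 + g y - x0 = g y by rewrite addrC addKr.
exists (inv y); last by rewrite /map /inv e' e2.
by split=> //; rewrite /inv e' e2.
Qed.

Let cod_open : open (map @` dom).
Proof. by rewrite codE; exact: B'o. Qed.

Let mapK : {in dom, cancel map inv}.
Proof.
move=> q; rewrite inE => -[cq Bq]; have [_ e] := gPhi Bq.
by rewrite /inv /map e addrC subrK chart_inv_map.
Qed.

Let map_continuous : {in dom, continuous map}.
Proof.
move=> q; rewrite inE => -[cq Bq].
exact: (cvg_comp _ _ (map_cvg cq) (analytic_continuous (aPhi Bq))).
Qed.

Let inv_continuous : {in map @` dom, continuous inv}.
Proof.
move=> y; rewrite codE inE => B'y; have [Bg _] := Phig B'y.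
have c1 : x0 + g z @[z --> (y : X)] --> x0 + g y.
  by apply: cvgD; [exact: cvg_cst|exact: analytic_continuous (ag B'y)].
have c2 : {for x0 + g y, continuous (chart_inv c)}.
  by apply: chart_inv_continuous; rewrite inE; exact: Bcod.
exact: (cvg_comp _ _ c1 c2).
Qed.

Definition straight_chart : chart R[i] M :=
  @Chart R[i] M T dom map inv dom_open cod_open mapK map_continuous inv_continuous.

Local Notation C := (real_chart straight_chart).

Lemma straight_chart_transition q : chart_dom straight_chart q ->
  \forall x \near chart_map c q, transition c C x = to_complexified Ic I2 (Phi (x - x0)).
Proof.
move=> [cq _]; apply: filterS (near_chart_cod cq) => x /chart_codP[_ e].
by rewrite /transition /= /map e.
Qed.

Lemma straight_chart_related q : chart_dom straight_chart q ->
  related q c C /\ related q C c.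
Proof.
move=> dq; have [cq Bq] := dq; have [B'q e] := gPhi Bq; split.
  have a1 : analytic_at (fun x => x - x0) (chart_map c q).
    by apply: analyticB; [exact: analytic_id|exact: analytic_cst].
  apply: (analytic_ext (f := fun x => to_complexified Ic I2 (Phi (x - x0)))).
    by apply: filterS (straight_chart_transition dq) => x ->.
  apply: analytic_comp_linear; first exact: to_complexified_continuous.
  exact: (analytic_comp a1 (aPhi Bq)).
apply: (analytic_ext (f := fun y => x0 + g (of_complexified y))).
  have n1 : \forall y \near (chart_map C q : realified T), B' y.
    by apply: open_nbhs_nbhs.
  apply: filterS n1 => y B'y; have [Bg _] := Phig B'y.
  by have /chart_codP[_ e'] := Bcod Bg; rewrite /transition /= /inv e'.
apply: analyticD; first exact: analytic_cst.
have a1 : analytic_at (@of_complexified _ _ _ Ic I2) (chart_map C q).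
  by apply: linear_analytic; exact: of_complexified_continuous.
by apply: (analytic_comp a1); exact: ag.
Qed.

Lemma D_straight_chart q v : chart_dom straight_chart q ->
  D (transition c C) (chart_map c q) v = to_complexified Ic I2 (D Phi (chart_map c q - x0) v).
Proof.
move=> dq; have [cq Bq] := dq; have [r1 _] := straight_chart_related dq.
have a1 : analytic_at (fun x => x - x0) (chart_map c q).
  by apply: analyticB; [exact: analytic_id|exact: analytic_cst].
have a2 := aPhi Bq.
rewrite (D_near_eq _ r1 (straight_chart_transition dq)).
rewrite (D_comp_lin _ (@to_complexified_continuous _ _ _ Ic I2) (analytic_comp a1 a2)).
rewrite (D_comp _ a1 a2) D_sub; [|exact: analytic_id|exact: analytic_cst].
by rewrite D_id D_cst subr0.
Qed.

End StraightChart.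

Section ComplexStructure.
Context (R : realType) (M : topologicalType) (S : analytic_structure R M).
Context (J : almost_complex S) (J_analytic : analytic_acs J).
Local Notation chart_ := (atlas S).
Local Notation cod i := (chart_map (chart_ i) @` chart_dom (chart_ i)).

(** A chart at p followed by the coordinates of complex_coordinates, which turn
    J into its value at p; the latter makes the model space complex. *)
Lemma exists_complex_linear_chart p :
  (forall i x u v, cod i x -> torsion_coord J i x u v = 0) ->
  exists c : chart R[i] M,
    [/\ chart_dom c p, admissible S (real_chart c) & complex_linear_chart J c].
Proof.
move=> N0; have [i ip] := atlas_cover S p.
pose X := model (chart_ i); pose x0 : X := chart_map (chart_ i) p.
have cx0 : cod i x0 by exists p.
pose Jt (x v : X) : X := acs_coord J i (x0 + x) v.
have Il : linear (acs_coord J i x0) by move=> k u v; exact: acs_coord_linear.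
pose I : {linear X -> X} := HB.pack (acs_coord J i x0) (GRing.isLinear.Build _ _ _ _ _ Il).
have Ic : continuous I.
  have [k Hk] := acs_bounded J ip; apply: (@bounded_continuous _ _ _ _ k) => v.
  by have := Hk (tvec p i v); rewrite (tcoord_acs J _ ip) tcoord_tvec.
have I2 v : I (I v) = - v by exact: acs_coord_sqr.
have sh (x : X) : analytic_at (fun x : X => x0 + x) x.
  by apply: analyticD; [exact: analytic_cst|exact: analytic_id].
have codn : \forall x \near (0 : X), cod i (x0 + x).
  apply: (near_comp (P := fun x => cod i x) (sh 0)); rewrite addr0.
  exact: near_chart_cod.
have aJt : analytic_at (fun q : X * X => Jt q.1 q.2) 0.
  have a1 : analytic_at (fun q : X * X => (x0 + q.1, q.2)) 0.
    apply: analytic_pair; last exact: analytic_snd.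
    exact: (analytic_comp (analytic_fst 0) (sh 0)).
  apply: (analytic_comp (g := fun q : X * X => acs_coord J i q.1 q.2) a1).
  by apply: acs_coord_analytic => //; rewrite addr0.
have [||||Phi [aP P0 DP PJ]] := @complex_coordinates R X I Ic I2 Jt aJt.
- by move=> v; rewrite /Jt addr0.
- by apply: filterS codn => x cx k u v; exact: acs_coord_linear.
- by apply: filterS codn => x cx v; exact: acs_coord_sqr.
- apply: filterS codn => x cx u v; rewrite -[RHS](N0 i (x0 + x) u v cx) /torsion_coord.
  have E w w' : D (Jt^~ w) x w' = D ((acs_coord J i)^~ w) (x0 + x) w'.
    rewrite (D_comp (f := fun x => x0 + x) (g := (acs_coord J i)^~ w)) //; last exact: acs_coord_analytic1.
    by rewrite D_add ?D_cst ?D_id ?add0r //; [exact: analytic_cst|exact: analytic_id].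
  by rewrite !E.
have [tau [s [g [t0 s0 [Mg pg] [fg inj_ aPs]]]]] := local_inverse aP P0 DP.
have ag0 := pser_analytic pg.
have g0 : g 0 = 0.
  have z0 (r : R) : 0 < r -> `|0 : X| <= r by rewrite normr0; exact: ltW.
  have [gs e] := fg 0 (z0 _ t0).
  by apply: (inj_ _ _ (ltW gs) (z0 _ s0)); rewrite e P0.
(* the ball of radius t is so small that g maps it into the set where Phi
   straightens J *)
pose good (x : X) := cod i (x0 + x) /\ forall v, D Phi x (Jt x v) = I (D Phi x v).
have goodn : \forall x \near (0 : X), good x by near=> x; split; near: x.
have gn : \forall y \near (0 : X), good (g y).
  by apply: (near_comp (P := good) ag0); rewrite g0.
have [t [tpos ttau tgood]] : exists t : R, [/\ 0 < t, t <= tau & forall y, `|y| < t -> good (g y)].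
  move/nbhs_ballP: gn => [e /= e0 He]; exists (Num.min e tau).
  split; [by rewrite lt_min e0|by rewrite ge_min lexx orbT|].
  by move=> y; rewrite lt_min => /andP[ye _]; apply: He; rewrite -ball_normE /= sub0r normrN.
pose B : set X := [set x | `|x| < s /\ `|Phi x| < t].
pose B' : set X := [set y | `|y| < t].
have norm_open (r : R) : open [set x : X | `|x| < r].
  have -> : [set x : X | `|x| < r] = ball (0 : X) r.
    by apply/seteqP; split=> x; rewrite -ball_normE /= sub0r normrN.
  exact: ball_open.
have Bo : open B.
  rewrite openE => x [xs xt]; rewrite /interior.
  have n1 : \forall y \near x, `|y| < s by apply: open_nbhs_nbhs; split=> //; exact: norm_open.
  have n2 : \forall y \near x, `|Phi y| < t.
    apply: (near_comp (P := fun y => `|y| < t) (aPs x (ltW xs))).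
    by apply: open_nbhs_nbhs; split=> //; exact: norm_open.
  by near=> y; split; near: y.
have Bg x : B x -> B' (Phi x) /\ g (Phi x) = x.
  move=> [xs xt]; split=> //; have [gs e] := fg (Phi x) (le_trans (ltW xt) ttau).
  by apply: inj_ => //; exact: ltW.
have B'g y : B' y -> B (g y) /\ Phi (g y) = y.
  by move=> yt; have [gs e] := fg y (le_trans (ltW yt) ttau); split=> //; split=> //; rewrite e.
have Bgood x : B x -> good x.
  by move=> Bx; have [B'x <-] := Bg x Bx; exact: tgood.
have Bcod x : B x -> cod i (x0 + x) by move=> /Bgood[].
have aB x : B x -> analytic_at Phi x by move=> [xs _]; exact: aPs (ltW xs).
have aB' y : B' y -> analytic_at g y.
  by move=> yt; apply: (pser_analytic_in pg); exact: lt_le_trans ttau.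
pose c := straight_chart Ic I2 Bo (norm_open t) Bg B'g Bcod aB aB'.
have adm : admissible S (real_chart c).
  move=> j; apply: compatible_of_related => q cq jq; have [iq _] := cq.
  have [r1 r2] := straight_chart_related (cq : chart_dom c q).
  have rij := related_atlas iq jq; have rji := related_atlas jq iq.
  by split; [exact: related_trans r2 rij|exact: related_trans rji r1].
exists c; split=> //.
  split=> //; rewrite /= -/x0 subrr /B /= P0 !normr0.
  by [].
move=> j q u jq cq; have [iq Bq] := cq.
rewrite !(dchart_indep _ adm cq jq iq) !dchartE (tcoord_acs J u iq).
rewrite !(D_straight_chart _ (cq : chart_dom c q)).
rewrite -to_complexifiedI; congr to_complexified.
have [_ <-] := Bgood _ Bq; rewrite /Jt.
by congr (D Phi _ (acs_coord J i _ _)); rewrite addrC subrK.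
Unshelve. all: by end_near. Qed.

End ComplexStructure.

(** * The integrability theorem *)

Unset Implicit Arguments.

Theorem theorem7 (R : realType) (C : topologicalType)
    (S : analytic_structure R C)
    (J : almost_complex S) (J_analytic : analytic_acs J)
    (Omega : forall p : C, tangent S p -> tangent S p -> tangent S p)
    (OmegaJ : is_torsion J Omega) :
  (forall (p : C) (u v : tangent S p), Omega p u v = 0) <->
  (exists Z : analytic_structure R[i] C,
     same_structure (real_structure Z) S /\
     forall (i : chart_index S) (j : chart_index Z) (p : C) (v : tangent S p),
       chart_dom (atlas S i) p -> chart_dom (atlas Z j) p ->
       dchart i (real_chart (atlas Z j)) (J p v) =
       'i%C *: (dchart i (real_chart (atlas Z j)) v : model (atlas Z j))).
Proof.
split=> [Om0|[Z [same lin]] p u v].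
  have N0 i x u v : (chart_map (atlas S i) @` chart_dom (atlas S i)) x ->
      torsion_coord J i x u v = 0.
    by case=> p ip <-; rewrite -(torsion_chart u v OmegaJ ip) Om0.
  have /choice[c Hc] := fun p => exists_complex_linear_chart J_analytic p N0.
  have cover p : exists q, chart_dom (c q) p by exists p; have [] := Hc p.
  have compat q r : compatible (c q) (c r).
    have [_ aq lq] := Hc q; have [_ ar lr] := Hc r.
    exact: complex_linear_compatible aq ar lq lr.
  exists (AnalyticStructure cover compat); split.
    by apply: same_structure_of_admissible => q; have [] := Hc q.
  by move=> i q p v ip qp; have [_ _] := Hc q; apply.
have [i ip] := atlas_cover S p; have [j jp] := atlas_cover Z p.
have adm : admissible S (real_chart (atlas Z j)).
  exact: (same _).1 (atlas_admissible (S := real_structure Z) j).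
have clin : complex_linear_chart J (atlas Z j) by move=> k q w kq jq; exact: lin.
apply: (tangent_inj ip); rewrite -(tvecK u ip) -(tvecK v ip).
rewrite (torsion_chart _ _ OmegaJ ip).
rewrite -[RHS]/(0 : model (atlas S i)).
exact: (torsion_of_complex_linear J_analytic _ _ adm clin jp ip).
Qed.
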